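(* Assume Hypothesis (H) below. Let $t_1,\dots,t_d\ge 0$, $T=\sum_{k=1}^d t_k$, and let $(n_k,f^{(k)})_{k\ge1}$ be a sequence with $n_k\to\infty$, $f^{(k)}\in\mathcal K$, $\rho(f^{(k)})\to1$; write $n=n_k$, $\rho=\rho(f^{(k)})$ and evaluate all $f$-dependent quantities at $f=f^{(k)}$. For a vector $m_n$ specified below, put $$\Phi_{n,j}=E\Big(\exp\Big\{-\sum_{l=1}^d \tfrac{t_l\,Y_{n,l}}{m_{n,l}}\Big\}\,\Big|\,N=n,\ Z_0=e_j\Big).$$ Then for every $j\in\{1,\dots,d\}$, as $k\to\infty$: (1) if $\rho\neq1$ for all $k$, $n|1-\rho|\to-\ln r$ with $r\in(0,1)$, and $m_n=\frac{2Q(1-\rho_\mu^n)^2h(\theta_n)}{(1-\rho_\mu)^2}v$, then with $D=d(T,r)$, $\Phi_{n,j}\to\frac{(1-r)^2r^{D}D^2}{r(1-r^{D})^2}$; (2) if $n|1-\rho|\to0$ and $m_n=\frac{Qn^2}{3}v$, then $\Phi_{n,j}\to\frac{3T}{\sinh^2\sqrt{3T}}$; (3) if $\rho\ne1$ for all $k$, $n|1-\rho|\to\infty$ and $m_n=\frac{2Qn}{1-\rho_\mu}v$, then $\Phi_{n,j}\to e^{-T}$.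
   Context: Fix $d\ge1$, $X=\mathbb Z_{\ge0}^d$, $C=[0,1]^d$; $s^\alpha=\prod_i s_i^{\alpha_i}$; vector inequalities and the product $sw$ are componentwise; $\mathbf 1,\mathbf 0,e_k$ as usual. A $d$-type Galton–Watson process $(Z_n)_{n\ge0}$ in $X$ has offspring p.g.f. $f=(f_1,\dots,f_d)'$, $f_k(s)=\sum_{i\in X}p_k(i)s^i$. $Y_n=\sum_{l=0}^nZ_l$ is the total progeny and $N=\min\{n:Z_n=\mathbf 0\}$ the extinction time. $M(s)=(\partial f_k(s)/\partial s_l)_{k,l}$, $M=M(\mathbf 1)$, $b^k_{lm}$ and $c^k_{lmj}$ the second and third partial derivatives of $f_k$ at $\mathbf 1$. For fixed $a,b,c>0$, $U\in\mathbb N$, $\mathcal K=\mathcal K(a,b,c,U)$ is the class of such $f$ with $[M^U]_{kl}\ge a$ for all $k,l$, $\sum_{k,l,m}b^k_{lm}\ge b$, $\sum_{k,l,m,j}c^k_{lmj}\le c$. $\rho=\rho(f)$ is the Perron root of $M$, $u,v$ the right and left eigenvectors normalized by $\sum_ku_k=1$, $\sum_ku_kv_k=1$; $Q=\frac12\sum_kv_k\sum_{l,m}b^k_{lm}u_lu_m$. $\mu$ is the extinction probability vector, $\rho_\mu$ the Perron root of $M(\mu)$, $\theta_n=n\ln\rho_\mu$. Define $h(x)=\frac{x(1+e^x)-2(1-e^x)}{(e^x-1)^3}$ and $d(y,x)=\sqrt{1+\frac{2y}{(1-x)^2h(\ln x)}}$. Hypothesis (H): for $f\in\mathcal K$, $s\in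 C$ let $h_0(s)=\mathbf 0$, $h_n(s)=sf(h_{n-1}(s))$, $h^*(s)=\lim_nh_n(s)$ (the unique solution in $C$ of $h=sf(h)$), and $v_{h^*}$ the left Perron eigenvector of $M(h^*(s))$, normalized with the right one $u_{h^*}$ by $\sum_ku_{h^*,k}=1$, $\sum_ku_{h^*,k}v_{h^*,k}=1$. (H): for every sequence $(n_k,f^{(k)},s^{(k)})$ with $n_k\to\infty$, $f^{(k)}\in\mathcal K$, $\rho(f^{(k)})\to1$, $s^{(k)}\in C$, $s^{(k)}\to\mathbf 1$, $v_{h^*}'(h^*(s^{(k)})-h_{n_k}(s^{(k)}))\to0$. *)

(* Defs.v *)
From HB Require Import structures.
From mathcomp Require Import all_boot all_order all_algebra.
From mathcomp Require Import all_classical all_reals all_analysis.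
Set Implicit Arguments. Unset Strict Implicit. Unset Printing Implicit Defensive.
Import Order.TTheory GRing.Theory Num.Theory.
Import numFieldNormedType.Exports.
Local Open Scope classical_set_scope.
Local Open Scope ring_scope.

Section GW.
Variables (R : realType) (d : nat).

Definition X := {ffun 'I_d -> nat}.
Definition e_ (j : 'I_d) : X := [ffun k => nat_of_bool (k == j)].
Definition zeroX : X := [ffun => 0%N].

Definition offspring := 'I_d -> X -> R.

Definition is_offspring (p : offspring) : Prop :=
  (forall k i, 0 <= p k i) /\ (forall k, \esum_(i in [set: X]) (p k i)%:E = 1%E).

Definition pgf (p : offspring) (k : 'I_d) (s : 'I_d -> R) : R :=
  fine (\esum_(i in [set: X]) (p k i * \prod_(l < d) s l ^+ i l)%:E).

(* M(s)_{kl} = d f_k / d s_l (s), written as the termwise derivative of the series *)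
Definition Ms (p : offspring) (s : 'I_d -> R) : 'M[R]_d :=
  \matrix_(k, l) fine (\esum_(i in [set: X])
     (p k i * (i l)%:R * s l ^+ (i l).-1 * \prod_(m < d | m != l) s m ^+ i m)%:E).

Definition Mmat (p : offspring) : 'M[R]_d := Ms p (fun=> 1).

(* second and third partial derivatives of f_k at 1 (factorial moments) *)
Definition bder (p : offspring) (k l m : 'I_d) : \bar R :=
  \esum_(i in [set: X]) (p k i * (i l * (i m - nat_of_bool (l == m)))%:R)%:E.
Definition cder (p : offspring) (k l m j : 'I_d) : \bar R :=
  \esum_(i in [set: X]) (p k i *
     (i l * (i m - nat_of_bool (l == m)) *
      (i j - nat_of_bool (l == j) - nat_of_bool (m == j)))%:R)%:E.

Definition inK (a b c : R) (U : nat) (p : offspring) : Prop :=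
  is_offspring p /\
  (forall k l, a <= (Mmat p ^+ U) k l) /\
  (b%:E <= \sum_(k < d) \sum_(l < d) \sum_(m < d) bder p k l m)%E /\
  (\sum_(k < d) \sum_(l < d) \sum_(m < d) \sum_(j < d) cder p k l m j <= c%:E)%E.

Definition perron_triple (A : 'M[R]_d) (r : R) (u v : 'cV[R]_d) : Prop :=
  (forall k, 0 < u k 0) /\ (forall k, 0 < v k 0) /\
  A *m u = r *: u /\ (v^T) *m A = r *: v^T /\
  \sum_(k < d) u k 0 = 1 /\ \sum_(k < d) u k 0 * v k 0 = 1.

Definition perron (A : 'M[R]_d) : R * 'cV[R]_d * 'cV[R]_d :=
  xget (0, 0, 0) (fun t => perron_triple A t.1.1 t.1.2 t.2).
Definition perron_root A := (perron A).1.1.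
Definition perron_u A := (perron A).1.2.
Definition perron_v A := (perron A).2.

Definition rho (p : offspring) := perron_root (Mmat p).
Definition uvec (p : offspring) (k : 'I_d) := perron_u (Mmat p) k 0.
Definition vvec (p : offspring) (k : 'I_d) := perron_v (Mmat p) k 0.

Definition Qc (p : offspring) : R :=
  2^-1 * \sum_(k < d) vvec p k *
    \sum_(l < d) \sum_(m < d) fine (bder p k l m) * uvec p l * uvec p m.

Definition conv (a b : X -> R) (z : X) : R :=
  \sum_(x : {ffun 'I_d -> 'I_(\sum_(k < d) z k)%N.+1} | [forall k, (x k <= z k)%N])
     a [ffun k => nat_of_ord (x k)] * b [ffun k => (z k - x k)%N].

Definition delta0 (z : X) : R := if z == zeroX then 1 else 0.

Definition powconv (a : X -> R) (n : nat) : X -> R := iter n (conv a) delta0.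

Definition trans (p : offspring) (z z' : X) : R :=
  (\big[conv/delta0]_(k < d) powconv (p k) (z k)) z'.

(* E(F(Z_0,...,Z_n) | Z_0 = z) for nonnegative F, paths as sequences *)
Fixpoint Ex (p : offspring) (n : nat) (z : X) (F : seq X -> \bar R) : \bar R :=
  match n with
  | 0 => F [:: z]
  | n'.+1 => \esum_(z' in [set: X])
               ((trans p z z')%:E * Ex p n' z' (fun s => F (z :: s)))%E
  end.

Definition extinct_at (n : nat) (s : seq X) : bool :=
  (nth zeroX s n == zeroX) && all (fun z => z != zeroX) (take n s).

Definition Ytot (s : seq X) (l : 'I_d) : nat := (\sum_(z <- s) z l)%N.

Definition Phi (p : offspring) (n : nat) (j : 'I_d) (t m : 'I_d -> R) : R :=
  fine (Ex p n (e_ j) (fun s => if extinct_at n s then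
          (expR (- \sum_(l < d) t l * (Ytot s l)%:R / m l))%:E else 0%E))
  / fine (Ex p n (e_ j) (fun s => if extinct_at n s then 1%E else 0%E)).

Definition mu (p : offspring) (j : 'I_d) : R :=
  lim ((fun n => fine (Ex p n (e_ j) (fun s => if last zeroX s == zeroX then 1%E else 0%E)))
        @ \oo).
Definition rho_mu (p : offspring) := perron_root (Ms p (mu p)).

Fixpoint hn (p : offspring) (n : nat) (s : 'I_d -> R) : 'I_d -> R :=
  match n with
  | 0 => fun=> 0
  | n'.+1 => fun k => s k * pgf p k (hn p n' s)
  end.
Definition hstar (p : offspring) (s : 'I_d -> R) (k : 'I_d) : R :=
  lim ((fun n => hn p n s k) @ \oo).
Definition vh (p : offspring) (s : 'I_d -> R) (k : 'I_d) : R :=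
  perron_v (Ms p (hstar p s)) k 0.

Definition HypH (a b c : R) (U : nat) : Prop :=
  forall (n_ : nat -> nat) (f_ : nat -> offspring) (s_ : nat -> 'I_d -> R),
    ((fun k => (n_ k)%:R : R) @ \oo --> +oo) ->
    (forall k, inK a b c U (f_ k)) ->
    ((fun k => rho (f_ k)) @ \oo --> (1 : R)) ->
    (forall k l, 0 <= s_ k l <= 1) ->
    (forall l, (fun k => s_ k l) @ \oo --> (1 : R)) ->
    (fun k => \sum_(l < d) vh (f_ k) (s_ k) l *
                 (hstar (f_ k) (s_ k) l - hn (f_ k) (n_ k) (s_ k) l)) @ \oo --> (0 : R).

End GW.

Section Fun.
Variable R : realType.
Definition hfun (x : R) : R :=
  (x * (1 + expR x) - 2 * (1 - expR x)) / (expR x - 1) ^+ 3.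
Definition dfun (y x : R) : R :=
  Num.sqrt (1 + 2 * y / ((1 - x) ^+ 2 * hfun (ln x))).
Definition sinhR (x : R) : R := (expR x - expR (- x)) / 2.
(* 3T / sinh^2 (sqrt (3T)), extended by continuity (value 1) at T = 0 *)
Definition lim2 (T : R) : R :=
  if T == 0 then 1 else 3 * T / (sinhR (Num.sqrt (3 * T))) ^+ 2.
End Fun.

(* Main.v *)
Require Import Defs.
From HB Require Import structures.
From mathcomp Require Import all_boot all_order all_algebra.
From mathcomp Require Import all_classical all_reals all_analysis.
From mathcomp Require Import ring lra.
Import Order.TTheory GRing.Theory Num.Theory.
Import numFieldNormedType.Exports.
Local Open Scope classical_set_scope.
Local Open Scope ring_scope.

(* Let h_n(s) be the iterates h_n = s f(h_(n-1)), h_0 = 0. Then E(s^(Y_n); N = n | Z_0 = e_j) is the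
   increment h_n(s)_j - h_(n-1)(s)_j, so the conditional transform is the quotient of the increments
   at s = (exp(-t_l/m_l))_l and at s = 1. Let r(s) be the Perron root of the Jacobian of
   h |-> s f(h) at its fixed point h*(s); in particular r(1) = rho_mu. Uniformly over near-critical f
   and s near 1, h*(s) - h_n(s) aligns with the Perron direction, and its coordinate y_n satisfies
   y_(n+1) = r(s) y_n - Q y_n^2 (1 + o(1)); passing to r(s)^n / y_n, this yields
   h_(n+1)(s)_j - h_n(s)_j ~ u_j r(s)^n / (Q (1 + r(s) + ... + r(s)^(n-1))^2).
   Expanding f between the fixed points h*(s) <= h*(1) = mu <= 1 gives
   (1 - r(s))^2 - (1 - rho_mu)^2 ~ 4 Q v.(1 - s) and 1 - rho_mu ~ |1 - rho|. As m_n is a multiple of v,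
   v.(1 - s) is asymptotic to T divided by that multiple, and each case is an elementary limit. *)

Set Implicit Arguments. Unset Strict Implicit. Unset Printing Implicit Defensive.

(** * Nonnegative series and the generating functions of the process *)

(** Since f varies with n, no limit may be taken for a fixed law: constants must depend on d, a, b,
    c, U only. Three devices provide them. A minorization A^U >= tau u v' contracts the complement
    of the Perron direction at a fixed rate, so a fixed number of almost linear steps aligns any
    nonnegative sequence, whatever its past. Smallness of 1 - h_n(s), before any rate is known,
    comes from telescoping v.(1 - h_n) and the monotonicity of the convexity defect of f. Taylor
    remainders are controlled by third factorial moments. The relation between r(s) and rho_mu is a
    discriminant identity: if z is the Perron coordinate of mu - [hstar], then (1 - rho_mu) z + Q
    z^2 ~ v.(1 - s) and rho_mu - r(s) ~ 2 Q z, so (1 - r(s))^2 - (1 - rho_mu)^2 ~ 4 Q ((1 - rho_mu)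
    z + Q z^2). The same relations between the fixed points 1 and mu, with zero in place of v.(1 -
    s), give 1 - rho_mu ~ |1 - rho| for both signs of rho - 1. In the quotient of increments Q and
    u_j cancel, which leaves a limit in r(s), rho_mu and n alone. *)

Section NonnegSums.
Variables (R : realType) (T : choiceType).
Implicit Types (F G : T -> R) (x y k : R).

(** Positivity and a real value in one predicate: exhibiting a value discharges the finiteness that
    [fine] hides in [pgf], [Ms] and the factorial moments. *)
Definition hsum F x := (forall i, 0 <= F i) /\ \esum_(i in [set: T]) (F i)%:E = x%:E.

Lemma hsum_fine F x : hsum F x -> fine (\esum_(i in [set: T]) (F i)%:E) = x.
Proof. by move=> [_ ->]. Qed.

Lemma hsum_uniq F x y : hsum F x -> hsum F y -> x = y.
Proof. by move=> [_ Fx] [_]; rewrite Fx => -[]. Qed.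

Lemma hsum_ge0 F x : hsum F x -> 0 <= x.
Proof. by move=> [F0 Fx]; rewrite -lee_fin -Fx; apply: esum_ge0 => i _; rewrite lee_fin. Qed.

Lemma hsum_eq F G x : F =1 G -> hsum F x -> hsum G x.
Proof. by move=> /funext ->. Qed.

Lemma hsumD F G x y : hsum F x -> hsum G y -> hsum (fun i => F i + G i) (x + y).
Proof.
move=> [F0 Fx] [G0 Gy]; split=> [i|]; first exact: addr_ge0.
under eq_esum do rewrite EFinD.
by rewrite esumD ?Fx ?Gy // => i _; rewrite lee_fin.
Qed.

Lemma hsum0 : hsum (fun=> 0) 0.
Proof. by split=> //; rewrite esum1. Qed.

Lemma hsum_le F G x y : (forall i, F i <= G i) -> hsum F x -> hsum G y -> x <= y.
Proof.
move=> FG [_ Fx] [_ Gy]; rewrite -lee_fin -Fx -Gy.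
by apply: le_esum => i _; rewrite lee_fin.
Qed.

Lemma hsum_dom F G y : (forall i, 0 <= F i) -> (forall i, F i <= G i) -> hsum G y ->
  exists2 x, hsum F x & x <= y.
Proof.
move=> F0 FG [_ Gy].
have E0 : (0 <= \esum_(i in [set: T]) (F i)%:E)%E.
  by apply: esum_ge0 => i _; rewrite lee_fin.
have EG : (\esum_(i in [set: T]) (F i)%:E <= y%:E)%E.
  by rewrite -Gy; apply: le_esum => i _; rewrite lee_fin.
have fE : \esum_(i in [set: T]) (F i)%:E \is a fin_num.
  by rewrite ge0_fin_numE// (le_lt_trans EG) ?ltry.
exists (fine (\esum_(i in [set: T]) (F i)%:E)); first by split=> //; rewrite fineK.
by rewrite -lee_fin fineK.
Qed.

Lemma hsumZ k F x : 0 <= k -> hsum F x -> hsum (fun i => k * F i) (k * x).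
Proof.
move=> k0 [F0 Fx]; split=> [i|]; first exact: mulr_ge0.
rewrite EFinM -Fx.
have [->|kN0] := eqVneq k 0.
  by rewrite mul0e esum1 // => i _; rewrite mul0r.
have kp : 0 < k by rewrite lt0r kN0.
(* Only one inequality is proved from finite partial sums; the other is the same one applied to
   [k^-1] and the family [k * F]. *)
have sub (c : R) (G : T -> R) : 0 < c -> (forall i, 0 <= G i) ->
    (\esum_(i in [set: T]) (c * G i)%:E <= c%:E * \esum_(i in [set: T]) (G i)%:E)%E.
  move=> cp G0; apply: ge_ereal_sup => _ [X [finX _]] <-.
  under eq_fsbigr do rewrite EFinM.
  rewrite -ge0_mule_fsumr; last by move=> i; rewrite lee_fin.
  rewrite lee_pmul2l ?lte_fin //.
  by apply: ereal_sup_ubound; exists X.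
apply/eqP; rewrite eq_le sub //=.
have := sub k^-1 (fun i => k * F i).
rewrite invr_gt0 => /(_ kp (fun i => mulr_ge0 k0 (F0 i))).
under eq_esum do rewrite mulKf //.
by rewrite lee_pdivlMl.
Qed.

Lemma hsum_sum (I : finType) (P : pred I) (F : I -> T -> R) (x : I -> R) :
  (forall j, P j -> hsum (F j) (x j)) ->
  hsum (fun i => \sum_(j | P j) F j i) (\sum_(j | P j) x j).
Proof.
move=> Fx; elim: (index_enum I) => [|j s IH].
  by rewrite big_nil; under eq_fun do rewrite big_nil; exact: hsum0.
rewrite big_cons; under eq_fun do rewrite big_cons.
by case: ifP => // Pj; apply: hsumD => //; exact: Fx.
Qed.

End NonnegSums.

Section Monomials.
Variables (R : realType) (d : nat).
Local Notation X := (X d).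
Local Notation vec := ('I_d -> R).
Implicit Types (i x y z : X) (s t q : vec).

Definition addX x y : X := [ffun k => (x k + y k)%N].
Definition mon s i : R := \prod_(l < d) s l ^+ i l.
Definition degX i : nat := (\sum_(l < d) i l)%N.
Definition cube s := forall l, 0 <= s l <= 1.
Definition nrm s : R := \sum_(l < d) s l.

Lemma mon_ge0 s i : (forall l, 0 <= s l) -> 0 <= mon s i.
Proof. by move=> s0; apply: prodr_ge0 => l _; apply: exprn_ge0. Qed.

Lemma mon_le1 s i : cube s -> mon s i <= 1.
Proof.
by move=> s1; apply: prodr_ile1 => l _; have /andP[a b] := s1 l; rewrite exprn_ge0 ?exprn_ile1.
Qed.

Lemma mon1 i : mon (fun=> 1) i = 1.
Proof. by rewrite /mon big1 // => l _; rewrite expr1n. Qed.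

Lemma monD s x y : mon s (addX x y) = mon s x * mon s y.
Proof. by rewrite /mon -big_split; apply: eq_bigr => l _; rewrite ffunE exprD. Qed.

Lemma monM s t i : mon (fun l => s l * t l) i = mon s i * mon t i.
Proof. by rewrite /mon -big_split; apply: eq_bigr => l _; rewrite exprMn. Qed.

Lemma mon_zeroX s : mon s (zeroX d) = 1.
Proof. by rewrite /mon big1 // => l _; rewrite ffunE expr0. Qed.

Lemma mon_e s l : mon s (e_ l) = s l.
Proof.
rewrite /mon (bigD1 l) //= ffunE eqxx expr1 big1 ?mulr1 // => m /negbTE ml.
by rewrite ffunE ml expr0.
Qed.

Lemma mon0 i : mon (fun=> 0) i = (i == zeroX d)%:R.
Proof.
have [->|iN0] := eqVneq i (zeroX d); first exact: mon_zeroX.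
have [l il] : exists l, i l != 0%N.
  apply/existsP; apply: contraNT iN0; rewrite negb_exists => /forallP i0.
  by apply/eqP/ffunP => l; rewrite ffunE; apply/eqP; rewrite -[_ == _]negbK i0.
by rewrite /mon (bigD1 l) //= expr0n (negbTE il) mul0r.
Qed.

Lemma hsum_delta0 s : hsum (fun z => delta0 R z * mon s z) 1.
Proof.
split=> [z|]; first by rewrite /delta0; case: eqP => [->|_]; rewrite ?mon_zeroX ?mulr1 ?mul0r.
rewrite (esumID [set zeroX d]) ?setTI //; last first.
  move=> z _; rewrite lee_fin /delta0; case: eqP => [->|_]; rewrite ?mon_zeroX ?mulr1 ?mul0r //.
rewrite esum_set1 /delta0 ?eqxx ?mul1r ?mon_zeroX ?lee_fin // esum1 ?adde0 // => z /= /eqP/negbTE ->.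
by rewrite mul0r.
Qed.

(** [conv] is a finite sum because its index functions take values in an ordinal bounded by the
    total of [z]; as a series over [X] it can enter an exchange of summations. *)
Lemma convE (a b : X -> R) z : (forall i, 0 <= a i) -> (forall i, 0 <= b i) ->
  (Defs.conv a b z)%:E = \esum_(x in [set x : X | forall k, (x k <= z k)%N])
     (a x * b [ffun k => (z k - x k)%N])%:E.
Proof.
move=> a0 b0; set N := (\sum_(k < d) z k)%N.
pose toX (x : {ffun 'I_d -> 'I_N.+1}) : X := [ffun k => nat_of_ord (x k)].
pose Q (x : {ffun 'I_d -> 'I_N.+1}) := [forall k, (x k <= z k)%N].
rewrite (@reindex_esum _ _ _ [set` Q] _ toX); last first.
  split.
  - by move=> x /= /forallP Qx k; rewrite ffunE.
  - move=> x y _ _ /ffunP xy; apply/ffunP => k; apply/val_inj.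
    by have := xy k; rewrite !ffunE.
  - move=> x /= xz.
    have xN k : (x k < N.+1)%N.
      by rewrite ltnS (leq_trans (xz k)) // /N (bigD1 k) //= leq_addr.
    exists [ffun k => Ordinal (xN k)] => /=; last by apply/ffunP => k; rewrite !ffunE.
    rewrite unfold_in /Q; apply/forallP => k; rewrite ffunE; exact: xz.
rewrite esum_fset //; last by move=> x _; rewrite lee_fin mulr_ge0.
rewrite -(@bigfs _ _ _ _ (index_enum _)) ?index_enum_uniq //; last first.
  by move=> x _; rewrite mem_index_enum.
rewrite sumEFin; congr (_%:E); apply: eq_bigr => x _.
by congr (_ * b _); apply/ffunP => k; rewrite !ffunE.
Qed.

(** After Tonelli, the pairs (z, x) with x <= z are reparametrized as (x + y, x), and the monomial
    of x + y factors. *)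
Lemma hsum_conv (a b : X -> R) s A B : (forall l, 0 <= s l) ->
  (forall i, 0 <= a i) -> (forall i, 0 <= b i) ->
  hsum (fun z => a z * mon s z) A -> hsum (fun z => b z * mon s z) B ->
  hsum (fun z => Defs.conv a b z * mon s z) (A * B).
Proof.
move=> s0 a0 b0 hA hB.
have m0 := mon_ge0 _ s0.
have c0 z : 0 <= Defs.conv a b z.
  by rewrite -lee_fin convE //; apply: esum_ge0 => x _; rewrite lee_fin mulr_ge0.
split=> [z|]; first by rewrite mulr_ge0.
pose L z := [set x : X | forall k, (x k <= z k)%N].
pose F z x := (a x * b [ffun k => (z k - x k)%N] * mon s z)%:E.
have -> : \esum_(z in [set: X]) (Defs.conv a b z * mon s z)%:E =
          \esum_(z in [set: X]) \esum_(x in L z) F z x.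
  apply: eq_esum => z _; rewrite EFinM convE // -/(L z).
  transitivity (mon s z * fine (\esum_(x in L z) (a x * b [ffun k => (z k - x k)%N])%:E))%:E.
    by rewrite -convE // mulrC.
  have h1 : hsum (fun x => if x \in L z then a x * b [ffun k => (z k - x k)%N] else 0) (Defs.conv a b z).
    split=> [x|]; first by case: ifP => // _; rewrite mulr_ge0.
    rewrite convE // [RHS]esum_mkcond; apply: eq_esum => x _; by case: ifP.
  have [_] := hsumZ (m0 z) h1.
  rewrite -convE //= => <-.
  rewrite [RHS]esum_mkcond; apply: eq_esum => x _; case: ifP => _; last by rewrite mulr0.
  by rewrite /F mulrC.
rewrite esum_esum; last by move=> z x _ _; rewrite lee_fin !mulr_ge0.
rewrite (@reindex_esum _ _ _ ([set: X] `*`` (fun=> [set: X])) _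
   (fun u : X * X => (addX u.1 u.2, u.1))); last first.
  split.
  - by move=> u _ /=; split=> // k; rewrite ffunE leq_addr.
  - move=> [x y] [x' y'] _ _ [] /ffunP /= h xx'; subst x'; congr pair.
    by apply/ffunP => k; have /eqP := h k; rewrite !ffunE eqn_add2l => /eqP.
  - move=> [z x] /= [_ xz]; exists (x, [ffun k => (z k - x k)%N]) => //=.
    by congr pair; apply/ffunP => k; rewrite !ffunE subnKC.
rewrite -(@esum_esum _ _ _ _ _ (fun x y => F (addX x y) x)); last first.
  by move=> z x _ _; rewrite lee_fin !mulr_ge0.
have [_ E] := hsumZ (hsum_ge0 hB) hA; rewrite mulrC -E.
apply: eq_esum => x _.
have [_ E'] := hsumZ (mulr_ge0 (a0 x) (m0 x)) hB; rewrite mulrC -E'.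
apply: eq_esum => y _; rewrite /F monD.
have -> : [ffun k => (addX x y k - x k)%N] = y by apply/ffunP => k; rewrite !ffunE addKn.
by congr (_%:E); ring.
Qed.

End Monomials.

Lemma hsumB (R : realType) (T : choiceType) (F G : T -> R) x y :
  (forall i, G i <= F i) -> hsum F x -> hsum G y -> hsum (fun i => F i - G i) (x - y).
Proof.
move=> GF hF hG.
have [||w hw _] := @hsum_dom R T (fun i => F i - G i) F x _ _ hF.
- by move=> i; rewrite subr_ge0.
- by move=> i; rewrite lerBlDr lerDl; have [] := hG.
suff -> : x - y = w by [].
have /(hsum_uniq hF) -> : hsum F (w + y); last by rewrite addrK.
by apply: hsum_eq (hsumD hw hG) => i; rewrite subrK.
Qed.

(** * Generating functions of the branching process and of its total progeny *)

Section Branching.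
Variables (R : realType) (d : nat).
Local Notation X := (X d).
Local Notation vec := ('I_d -> R).
Implicit Types (i x y z : X) (s t q : vec).

Lemma mon_mono s t i : (forall l, 0 <= s l) -> (forall l, s l <= t l) -> mon s i <= mon t i.
Proof. by move=> s0 st; apply: ler_prod => l _; rewrite exprn_ge0 ?lerXn2r ?nnegrE ?(le_trans (s0 l)). Qed.

Lemma conv_ge0 (a b : X -> R) z : (forall i, 0 <= a i) -> (forall i, 0 <= b i) ->
  0 <= Defs.conv a b z.
Proof.
move=> a0 b0; rewrite -lee_fin convE //.
by apply: esum_ge0 => x _; rewrite lee_fin mulr_ge0.
Qed.

Lemma delta0_ge0 z : 0 <= delta0 R z.
Proof. by rewrite /delta0; case: ifP. Qed.

Variable p : offspring R d.
Hypothesis hp : is_offspring p.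

Lemma pk_ge0 k i : 0 <= p k i. Proof. by have [] := hp. Qed.

Lemma hsum_p k : hsum (p k) 1.
Proof. by split; [exact: pk_ge0 | have [_ ->] := hp]. Qed.

Lemma hsum_pgf k s : cube s -> hsum (fun i => p k i * mon s i) (pgf p k s) /\ pgf p k s <= 1.
Proof.
move=> cs; have s0 l : 0 <= s l by have /andP[] := cs l.
have [||x hx x1] := @hsum_dom R X (fun i => p k i * mon s i) (p k) 1 _ _ (hsum_p k).
- by move=> i; rewrite mulr_ge0 ?pk_ge0 ?mon_ge0.
- by move=> i; rewrite ler_piMr ?pk_ge0 ?mon_le1.
by suff -> : pgf p k s = x by []; exact: hsum_fine hx.
Qed.

Lemma pgf_ge0 k s : cube s -> 0 <= pgf p k s.
Proof. by case/(hsum_pgf k)/proj1/hsum_ge0. Qed.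

Lemma pgf_le1 k s : cube s -> pgf p k s <= 1.
Proof. by case/(hsum_pgf k). Qed.

Lemma pgf_mono k s t : cube s -> cube t -> (forall l, s l <= t l) -> pgf p k s <= pgf p k t.
Proof.
move=> cs ct st; have [hs _] := hsum_pgf k cs; have [ht _] := hsum_pgf k ct.
apply: hsum_le hs ht => i; rewrite ler_wpM2l ?pk_ge0 // mon_mono // => l.
by have /andP[] := cs l.
Qed.

Lemma powconv_ge0 k n z : 0 <= powconv (p k) n z.
Proof.
elim: n z => [|n IH] z; first exact: delta0_ge0.
by apply: conv_ge0 => //; exact: pk_ge0.
Qed.

Lemma hsum_powconv k n s : cube s ->
  hsum (fun z => powconv (p k) n z * mon s z) (pgf p k s ^+ n).
Proof.
move=> cs; elim: n => [|n IH]; first exact: hsum_delta0.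
rewrite exprS; apply: hsum_conv => //; [|exact: pk_ge0|exact: powconv_ge0|exact: (hsum_pgf k cs).1].
by move=> l; have /andP[] := cs l.
Qed.

(** Branching property: the offspring laws of all individuals in [z] are convolved, so one
    generation replaces s by f(s) in the monomial of [z]. *)
Lemma hsum_trans z s : cube s ->
  hsum (fun z' => trans p z z' * mon s z') (mon (fun k => pgf p k s) z).
Proof.
move=> cs; have s0 l : 0 <= s l by have /andP[] := cs l.
rewrite /trans /mon -/(mon s _).
suff [] : (forall z', 0 <= (\big[@Defs.conv R d/@delta0 R d]_(k < d) powconv (p k) (z k)) z') /\
  hsum (fun z' => (\big[@Defs.conv R d/@delta0 R d]_(k < d) powconv (p k) (z k)) z' * mon s z')
    (\prod_(l < d) pgf p l s ^+ z l) by [].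
elim: (index_enum _) => [|k r [IH0 IH]].
  by rewrite !big_nil; split; [exact: delta0_ge0 | exact: hsum_delta0].
rewrite !big_cons; split; first by move=> z'; apply: conv_ge0 => //; exact: powconv_ge0.
by apply: hsum_conv => //; [exact: powconv_ge0 | exact: hsum_powconv].
Qed.

Lemma trans_ge0 z z' : 0 <= trans p z z'.
Proof.
have [/(_ z')] := @hsum_trans z (fun=> 1) (fun=> ltac:(by rewrite ler01 lexx)).
by rewrite mon1 mulr1.
Qed.

Lemma hn_cube n s : cube s -> cube (hn p n s).
Proof.
move=> cs; elim: n => [|n IH] k /=; first by rewrite lexx ler01.
have /andP[a b] := cs k.
by rewrite mulr_ge0 ?pgf_ge0 //= mulr_ile1 ?pgf_ge0 ?pgf_le1.
Qed.

Lemma hn_leS n s k : cube s -> hn p n s k <= hn p n.+1 s k.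
Proof.
move=> cs; elim: n k => [|n IH] k.
  by have /andP[] := hn_cube 1%N cs k.
by apply: ler_wpM2l; [have /andP[] := cs k | apply: pgf_mono; [exact: hn_cube | exact: (hn_cube n.+1) | exact: IH]].
Qed.

Lemma eq_Ex n z (F G : seq X -> \bar R) : (forall w, size w = n.+1 -> F w = G w) ->
  Ex p n z F = Ex p n z G.
Proof.
elim: n z F G => [|n IH] z F G FG /=; first exact: FG.
by apply: eq_esum => z' _; congr (_ * _)%E; apply: IH => w wn; apply: FG; rewrite /= wn.
Qed.

Lemma Ex_zero n z : Ex p n z (fun=> 0%E) = 0%E.
Proof. by elim: n z => //= n IH z; rewrite esum1 // => z' _; rewrite IH mule0. Qed.

Definition sY s (w : seq X) : R := \prod_(l < d) s l ^+ Ytot w l.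

Lemma sY_cons s z w : sY s (z :: w) = mon s z * sY s w.
Proof.
rewrite /sY /mon -big_split; apply: eq_bigr => l _.
by rewrite /Ytot big_cons exprD.
Qed.

Lemma sY1 s z : sY s [:: z] = mon s z.
Proof. by rewrite sY_cons /sY big1 ?mulr1 // => l _; rewrite /Ytot big_nil. Qed.

(** Conditioning on the first generation: the starting point contributes the factor s^z and the
    descendants restart from Z_1. The free constant [c] absorbs this factor, so that the induction
    hypothesis applies to the shifted functional. *)
Lemma Ex_dead n z s c : cube s -> 0 <= c ->
  Ex p n z (fun w => (c * (if nth (zeroX d) w n == zeroX d then sY s w else 0))%:E)
  = (c * mon (hn p n s) z)%:E.
Proof.
move=> cs; elim: n z c => [|n IH] z c c0 /=.
  by rewrite mon0; case: eqP => [->|//]; rewrite sY1 mon_zeroX.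
have c0' : 0 <= c * mon s z by rewrite mulr_ge0 ?mon_ge0 // => l; have /andP[] := cs l.
have -> : mon (fun k => s k * pgf p k (hn p n s)) z = mon s z * mon (fun k => pgf p k (hn p n s)) z.
  exact: monM.
have [_] := hsumZ c0' (hsum_trans z (hn_cube n cs)).
rewrite mulrA => <-; apply: eq_esum => z' _.
rewrite mulrCA EFinM; congr (_ * _)%E; rewrite -IH //; apply: eq_Ex => w _.
by rewrite sY_cons; case: ifP; rewrite ?mulr0 ?mulrA.
Qed.

(** The event N = n is Z_n = 0 without Z_(n-1) = 0, hence a difference of two transforms as in
    [Ex_dead]. For n = 0 there is no earlier generation and nothing is subtracted. A start at zero
    is extinct at time 0, so both sides vanish for it as soon as n > 0. *)
Lemma Ex_extinct n z s c : cube s -> 0 <= c ->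
  Ex p n z (fun w => (c * (if extinct_at n w then sY s w else 0))%:E)
  = (c * (mon (hn p n s) z - (if n is m.+1 then mon (hn p m s) z else 0)))%:E.
Proof.
move=> cs; elim: n z c => [|n IH] z c c0 /=.
  by rewrite subr0 mon0 /extinct_at /= andbT; case: eqP => [->|//]; rewrite sY1 mon_zeroX.
have [->|zN0] := eqVneq z (zeroX d).
  rewrite !mon_zeroX subrr mulr0 esum1 // => z' _.
  rewrite (@eq_Ex _ _ _ (fun=> 0%E)) ?Ex_zero ?mule0 // => w _.
  by rewrite /extinct_at /= eqxx /= andbF mulr0.
have c0' : 0 <= c * mon s z by rewrite mulr_ge0 ?mon_ge0 // => l; have /andP[] := cs l.
have -> : mon (fun k => s k * pgf p k (hn p n s)) z = mon s z * mon (fun k => pgf p k (hn p n s)) z.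
  exact: monM.
transitivity (c * mon s z * (mon (fun k => pgf p k (hn p n s)) z
   - if n is m.+1 then mon (fun k => pgf p k (hn p m s)) z else 0))%:E; last first.
  case: n {IH} => [|m]; first by rewrite mon0 (negbTE zN0) !subr0 mulrA.
  have -> : mon (hn p m.+1 s) z = mon s z * mon (fun k => pgf p k (hn p m s)) z by exact: monM.
  by congr _%:E; ring.
(* Monotonicity of [hn] in n keeps the terms of the difference nonnegative, as [hsumB] requires. *)
have hT : hsum (fun z' => trans p z z' * (mon (hn p n s) z'
     - if n is m.+1 then mon (hn p m s) z' else 0)) (mon (fun k => pgf p k (hn p n s)) z
   - if n is m.+1 then mon (fun k => pgf p k (hn p m s)) z else 0).
  case: n {IH} => [|m].
    rewrite subr0; apply: hsum_eq (hsum_trans z (hn_cube 0%N cs)) => z'; by rewrite subr0.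
  apply: hsum_eq (hsumB _ (hsum_trans z (hn_cube m.+1 cs)) (hsum_trans z (hn_cube m cs))) => z'.
    by rewrite mulrBr.
  rewrite ler_wpM2l ?trans_ge0 // mon_mono // => l; last exact: hn_leS.
  by have /andP[] := hn_cube m cs l.
have [_ <-] := hsumZ c0' hT; apply: eq_esum => z' _.
rewrite mulrCA EFinM; congr (_ * _)%E; rewrite -IH //; apply: eq_Ex => w _.
rewrite /extinct_at /= zN0 sY_cons /=.
by case: ifP; rewrite ?mulr0 ?mulrA.
Qed.

Lemma cube1 : cube ((fun=> 1) : vec).
Proof. by move=> l; rewrite ler01 lexx. Qed.

(** The exponential weight of a path is s^Y for s_l = exp(-t_l/m_l), and the sign condition puts s
    in the unit cube, where [Ex_extinct] applies to numerator and denominator. *)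
Lemma PhiE n j t m : (forall l, 0 <= t l / m l) ->
  let s := fun l => expR (- (t l / m l)) in
  Phi p n.+1 j t m = (hn p n.+1 s j - hn p n s j) /
    (hn p n.+1 (fun=> 1) j - hn p n (fun=> 1) j).
Proof.
move=> tm s.
have cs : cube s.
  by move=> l; rewrite /s expR_ge0 -[leRHS]expR0 ler_expR oppr_le0 tm.
have c1 := @cube1.
rewrite /Phi.
have -> : Ex p n.+1 (e_ j) (fun w => if extinct_at n.+1 w then
    (expR (- \sum_(l < d) t l * (Ytot w l)%:R / m l))%:E else 0%E)
  = (hn p n.+1 s j - hn p n s j)%:E.
  rewrite -(mon_e (hn p n.+1 s)) -(mon_e (hn p n s)) -[X in _ = X%:E]mul1r -(Ex_extinct n.+1) //.
  apply: eq_Ex => w _; rewrite mul1r; case: ifP => // _; congr _%:E.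
  rewrite -sumrN expR_sum; apply: eq_bigr => l _.
  by rewrite /s -expRM_natl; congr expR; ring.
have -> // : Ex p n.+1 (e_ j) (fun w => if extinct_at n.+1 w then 1%E else 0%E)
  = (hn p n.+1 (fun=> 1) j - hn p n (fun=> 1) j)%:E.
rewrite -(mon_e (hn p n.+1 _)) -(mon_e (hn p n _)) -[X in _ = X%:E]mul1r -(Ex_extinct n.+1) //.
apply: eq_Ex => w _; rewrite mul1r; case: ifP => // _; congr _%:E.
by rewrite /sY big1 // => l _; rewrite expr1n.
Qed.

(** At s = 1 the path weight is trivial, so [Ex_dead] gives h_n(1) for the probability of extinction
    by time n. *)
Lemma muE : mu p = hstar p (fun=> 1).
Proof.
apply/funext => j; rewrite /mu /hstar; congr (lim (_ @ \oo)); apply/funext => n.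
have c1 := @cube1.
rewrite -(mon_e (hn p n _)) -[RHS]mul1r -[RHS]/(fine _%:E) -Ex_dead //; congr fine.
apply: eq_Ex => w wn; rewrite mul1r -nth_last wn /=; case: ifP => // _; congr _%:E.
by rewrite /sY big1 // => l _; rewrite expr1n.
Qed.

End Branching.

(** * Second-order expansion of the offspring generating functions *)

Section MonomialTaylor.
Variables (R : realType) (d : nat).
Local Notation X := (X d).
Local Notation vec := ('I_d -> R).
Implicit Types (i x : X) (s y q : vec) (l m : 'I_d).

Lemma degX_add l i : (degX (addX (e_ l) i)) = (degX i).+1.
Proof.
rewrite /degX; under eq_bigr do rewrite !ffunE.
rewrite big_split /= (bigD1 l) //= eqxx big1 ?addn0 ?add1n //.
by move=> m /negbTE ->.
Qed.

(** Monomials are estimated by multiplying with one variable at a time; the [_add] rules below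
    describe what each differential does under such a step. *)
Lemma X_ind (P : X -> Prop) : P (zeroX d) -> (forall l i, P i -> P (addX (e_ l) i)) ->
  forall i, P i.
Proof.
move=> P0 PS i; move Dn : (degX i) => n; elim: n i Dn => [|n IH] i Dn.
  suff -> : i = zeroX d by [].
  apply/ffunP => l; rewrite ffunE; apply/eqP; rewrite -leqn0 -Dn /degX (bigD1 l) //=.
  exact: leq_addr.
have [l il] : exists l, (0 < i l)%N.
  apply/existsP; apply: contra_eqT Dn; rewrite negb_exists => /forallP i0.
  by rewrite /degX big1 // => l _; have := i0 l; rewrite -eqn0Ngt => /eqP.
have Di : i = addX (e_ l) [ffun m => (i m - (m == l))%N].
  apply/ffunP => m; rewrite !ffunE; case: eqP => [->|_].
    by rewrite subnKC.
  by rewrite subn0.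
rewrite Di; apply: PS; apply: IH; move: Dn; rewrite {1}Di degX_add => -[].
by [].
Qed.

(** Differentials of the monomial s^i in direction q: [lin] is the first one at 1, [dlin] the first
    one at y, [quad] half the second one at 1, and [hlin] a row of the Hessian at 1 applied to q. *)
Definition lin q i : R := \sum_l (i l)%:R * q l.
Definition dmon l s i : R := (i l)%:R * s l ^+ (i l).-1 * \prod_(m < d | m != l) s m ^+ i m.
Definition dlin y q i : R := \sum_l dmon l y i * q l.
Definition fac2 i l m : R := (i l * (i m - nat_of_bool (l == m)))%:R.
Definition quad q i : R := 2^-1 * \sum_l \sum_m fac2 i l m * q l * q m.
Definition hlin l q i : R := \sum_m fac2 i l m * q m.

Lemma sum_pick (F : vec) l' : \sum_l (l == l')%:R * F l = F l'.
Proof.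
rewrite (bigD1 l') //= eqxx mul1r big1 ?addr0 // => l /negbTE ->.
by rewrite mul0r.
Qed.

Lemma mon_add l s i : mon s (addX (e_ l) i) = s l * mon s i.
Proof. by rewrite monD mon_e. Qed.

Lemma lin_add l q i : lin q (addX (e_ l) i) = q l + lin q i.
Proof.
rewrite /lin -[X in X + _](sum_pick q) -big_split; apply: eq_bigr => m _ /=.
by rewrite !ffunE natrD mulrDl.
Qed.

Lemma mon_split l s i : mon s i = s l ^+ i l * \prod_(m < d | m != l) s m ^+ i m.
Proof. by rewrite /mon (bigD1 l). Qed.

Lemma dmon_add l l' s i :
  dmon l s (addX (e_ l') i) = (l == l')%:R * mon s i + s l' * dmon l s i.
Proof.
rewrite /dmon (mon_split l) !ffunE; have [<-|ll'] := eqVneq l l'.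
  rewrite add1n [in RHS]mulrA [in RHS]mulrA mul1r -!mulrDl.
  have -> : \prod_(m < d | m != l) s m ^+ (addX (e_ l) i) m = \prod_(m < d | m != l) s m ^+ i m.
    by apply: eq_bigr => m /negbTE ml; rewrite !ffunE ml.
  congr (_ * _); case: (i l) => [|n] /=; first by rewrite !expr0; ring.
  by rewrite exprS [_.+2%:R]mulrS; ring.
rewrite add0n mul0r add0r.
have -> : \prod_(m < d | m != l) s m ^+ (addX (e_ l') i) m = s l' * \prod_(m < d | m != l) s m ^+ i m.
  rewrite (bigD1 l') 1?eq_sym //= [in RHS](bigD1 l') 1?eq_sym //= !ffunE eqxx add1n exprS -mulrA.
  by congr (_ * (_ * _)); apply: eq_bigr => m /andP[_ /negbTE ml]; rewrite !ffunE ml.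
by ring.
Qed.

Lemma dlin_add l y q i : dlin y q (addX (e_ l) i) = q l * mon y i + y l * dlin y q i.
Proof.
rewrite /dlin -[q l * _](sum_pick (fun l => q l * mon y i)) mulr_sumr -big_split.
apply: eq_bigr => m _ /=; rewrite dmon_add; by case: (eqVneq m l) => [->|_]; rewrite /= ?mulr0n; ring.
Qed.

Lemma fac2E i l m : fac2 i l m = (i l)%:R * ((i m)%:R - (l == m)%:R).
Proof.
rewrite /fac2 natrM; have [<-|_] := eqVneq l m; last by rewrite subn0 subr0.
by case: (i l) => [|n]; rewrite ?mul0r // natrB.
Qed.

Lemma hlinE l q i : hlin l q i = (i l)%:R * (lin q i - q l).
Proof.
rewrite /hlin /lin -(sum_pick q l) -sumrB mulr_sumr; apply: eq_bigr => m _.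
by rewrite fac2E eq_sym; ring.
Qed.

Lemma quadE q i : quad q i = 2^-1 * \sum_l q l * hlin l q i.
Proof.
by congr (_ * _); apply: eq_bigr => l _; rewrite /hlin mulr_sumr; apply: eq_bigr => m _; ring.
Qed.

Lemma hlin_add l l' q i :
  hlin l q (addX (e_ l') i) = hlin l q i + (i l)%:R * q l' + (l == l')%:R * lin q i.
Proof.
rewrite !hlinE lin_add !ffunE natrD.
have key (e a L x x' : R) : e * (x' - x) = 0 ->
    (e + a) * (x' + L - x) = a * (L - x) + a * x' + e * L.
  by move=> h; rewrite -[RHS]addr0 -h; ring.
by apply: key; case: eqVneq => [->|_]; rewrite ?subrr ?mulr0 ?mul0r.
Qed.

Lemma quad_add l q i : quad q (addX (e_ l) i) = quad q i + q l * lin q i.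
Proof.
rewrite !quadE.
have -> : \sum_m q m * hlin m q (addX (e_ l) i) =
  \sum_m q m * hlin m q i + q l * lin q i + q l * lin q i.
  have {1}<- := sum_pick (fun l => q l * lin q i) l.
  have -> : q l * lin q i = \sum_m q l * ((i m)%:R * q m) by rewrite /lin mulr_sumr.
  by rewrite -!big_split; apply: eq_bigr => m _ /=; rewrite hlin_add; ring.
by field.
Qed.

Lemma mon_zero s : mon s (zeroX d) = 1. Proof. exact: mon_zeroX. Qed.
Lemma lin_zero q : lin q (zeroX d) = 0.
Proof. by rewrite /lin big1 // => l _; rewrite ffunE mul0r. Qed.
Lemma dmon_zero l s : dmon l s (zeroX d) = 0.
Proof. by rewrite /dmon ffunE !mul0r. Qed.
Lemma dlin_zero y q : dlin y q (zeroX d) = 0.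
Proof. by rewrite /dlin big1 // => l _; rewrite dmon_zero mul0r. Qed.
Lemma hlin_zero l q : hlin l q (zeroX d) = 0.
Proof. by rewrite hlinE ffunE mul0r. Qed.
Lemma quad_zero q : quad q (zeroX d) = 0.
Proof. by rewrite quadE big1 ?mulr0 // => l _; rewrite hlin_zero mulr0. Qed.

Lemma nrm_ge q l : (forall m, 0 <= q m) -> q l <= nrm q.
Proof. by move=> q0; rewrite /nrm (bigD1 l) //= lerDl sumr_ge0. Qed.

Lemma nrm_ge0 q : (forall m, 0 <= q m) -> 0 <= nrm q.
Proof. by move=> q0; apply: sumr_ge0. Qed.

Lemma coord_le_deg i l : (i l)%:R <= (degX i)%:R :> R.
Proof. by rewrite ler_nat /degX (bigD1 l) //= leq_addr. Qed.

Lemma lin_ge0 q i : (forall m, 0 <= q m) -> 0 <= lin q i.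
Proof. by move=> q0; apply: sumr_ge0 => l _; apply: mulr_ge0. Qed.

Lemma lin_le q i : (forall m, 0 <= q m) -> lin q i <= (degX i)%:R * nrm q.
Proof.
move=> q0; rewrite /lin /nrm mulr_sumr; apply: ler_sum => l _.
by apply: ler_wpM2r => //; exact: coord_le_deg.
Qed.

Lemma hlin_ge0 l q i : (forall m, 0 <= q m) -> 0 <= hlin l q i.
Proof. by move=> q0; apply: sumr_ge0 => m _; apply: mulr_ge0 => //; exact: ler0n. Qed.

Lemma hlin_le l q i : (forall m, 0 <= q m) -> hlin l q i <= (degX i)%:R ^+ 2 * nrm q.
Proof.
move=> q0; rewrite hlinE expr2 -mulrA.
have := lin_le i q0; have := coord_le_deg i l; have := lin_ge0 i q0; have := q0 l.
have : 0 <= (i l)%:R :> R by [].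
have := nrm_ge0 q0.
have : 0 <= (degX i)%:R :> R by [].
set a := (i l)%:R; set n := (degX i)%:R; set L := lin q i; set N := nrm q => *.
apply: (@le_trans _ _ (a * L)); first by apply: ler_wpM2l => //; lra.
by apply: ler_pM.
Qed.

Lemma quad_ge0 q i : (forall m, 0 <= q m) -> 0 <= quad q i.
Proof.
move=> q0; rewrite quadE mulr_ge0 ?invr_ge0 // sumr_ge0 // => l _.
by rewrite mulr_ge0 // hlin_ge0.
Qed.

Lemma quad_le q i : (forall m, 0 <= q m) -> quad q i <= (degX i)%:R ^+ 2 * nrm q ^+ 2.
Proof.
move=> q0; rewrite quadE.
have S : \sum_l q l * hlin l q i <= (degX i)%:R ^+ 2 * nrm q ^+ 2.
  rewrite expr2 mulrA {2}/nrm mulr_sumr; apply: ler_sum => l _.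
  by rewrite mulrC; apply: ler_wpM2r => //; exact: hlin_le.
have : 0 <= \sum_l q l * hlin l q i by apply: sumr_ge0 => l _; rewrite mulr_ge0 // hlin_ge0.
lra.
Qed.

Section Bounds.
Variables (y q : vec).
Hypotheses (cy : cube y) (q0 : forall l, 0 <= q l) (qy : forall l, q l <= y l).
Let s : vec := fun l => y l - q l.
(** Since s <= y <= 1, this distance of the lower point from 1 also dominates 1 - y and the
    increment q; all remainders below are measured by it. *)
Let w := nrm (fun l => 1 - s l).

Let s0 l : 0 <= s l. Proof. by rewrite subr_ge0. Qed.
Let sy l : s l <= y l. Proof. by rewrite lerBlDr lerDl. Qed.
Let y1 l : y l <= 1. Proof. by have /andP[] := cy l. Qed.
Let y0 l : 0 <= y l. Proof. by have /andP[] := cy l. Qed.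
Let cs : cube s. Proof. by move=> l; rewrite s0 (le_trans (sy l)). Qed.
Let s1 l : 0 <= 1 - s l. Proof. by rewrite subr_ge0; have /andP[] := cs l. Qed.
Let w0 : 0 <= w. Proof. exact: nrm_ge0. Qed.
Let sw l : 1 - s l <= w. Proof. exact: (nrm_ge l s1). Qed.
Let yw l : 1 - y l <= w. Proof. by apply: le_trans (sw l); rewrite lerB. Qed.

Lemma mon_diff_ge0 i : mon s i <= mon y i.
Proof. exact: mon_mono. Qed.

(** Along a nonnegative direction a monomial is convex, so its increment is at most its slope at the
    upper end. *)
Lemma mon_concave i : mon y i - mon s i <= dlin y q i.
Proof.
elim/X_ind: i => [|l i IH]; first by rewrite !mon_zero dlin_zero subrr.
rewrite !mon_add dlin_add.
have := mon_diff_ge0 i; have := q0 l; have := y0 l; rewrite /s.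
nra.
Qed.

Let N i : R := (degX i)%:R.
Let N0 i : 0 <= N i. Proof. exact: ler0n. Qed.
Let NS l i : N (addX (e_ l) i) = N i + 1. Proof. by rewrite /N degX_add natr1. Qed.
Let Q := nrm q.
Let Q0 : 0 <= Q. Proof. exact: nrm_ge0. Qed.
Let qQ l : q l <= Q. Proof. exact: nrm_ge. Qed.
Let normD3 (a b c A B C : R) : `|a| <= A -> `|b| <= B -> `|c| <= C -> `|a + b + c| <= A + B + C.
Proof. by move=> ha hb hc; rewrite (le_trans (ler_normD _ _)) // lerD // (le_trans (ler_normD _ _)) // lerD. Qed.
Let normM (x a A : R) : 0 <= x -> x <= 1 -> `|a| <= A -> `|x * a| <= A.
Proof.
move=> x0 x1 aA; rewrite normrM ger0_norm //.
by apply: le_trans aA; rewrite ler_piMl.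
Qed.
Let normMw (x a z A : R) : 0 <= x -> x <= z -> 0 <= a -> a <= A -> `|x * a| <= z * A.
Proof. by move=> x0 xz a0 aA; rewrite ger0_norm ?mulr_ge0 // ler_pM. Qed.

Lemma mon_one_sub i : 0 <= 1 - mon s i <= N i * w.
Proof.
apply/andP; split; first by rewrite subr_ge0 mon_le1.
elim/X_ind: i => [|l i IH]; first by rewrite mon_zero subrr mulr_ge0.
have -> : 1 - mon s (addX (e_ l) i) = (1 - s l) + s l * (1 - mon s i) by rewrite mon_add; ring.
have -> : N (addX (e_ l) i) * w = w + N i * w by rewrite NS; ring.
rewrite lerD ?sw //; apply: le_trans IH.
by rewrite ler_piMl ?subr_ge0 ?mon_le1 //; have /andP[] := cs l.
Qed.

Lemma mon_taylor1 i : `|mon y i - mon s i - lin q i| <= N i ^+ 2 * w * Q.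
Proof.
elim/X_ind: i => [|l i IH].
  by rewrite !mon_zero lin_zero subrr subr0 normr0 !mulr_ge0 ?exprn_ge0.
have -> : mon y (addX (e_ l) i) - mon s (addX (e_ l) i) - lin q (addX (e_ l) i) =
   y l * (mon y i - mon s i - lin q i) + - ((1 - y l) * lin q i) + - (q l * (1 - mon s i)).
  by rewrite !mon_add lin_add {1}/s; ring.
have /andP[m0 m1] := mon_one_sub i.
have hq : `|- (q l * (1 - mon s i))| <= Q * (N i * w) by rewrite normrN normMw.
have hl : `|- ((1 - y l) * lin q i)| <= w * (N i * Q).
  by rewrite normrN normMw ?subr_ge0 ?lin_ge0 ?lin_le.
apply: le_trans (normD3 (normM (y0 l) (y1 l) IH) hl hq) _.
rewrite NS; have := mulr_ge0 w0 Q0; have := N0 i.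
by set n := N i; nra.
Qed.

(** The linear term is taken at y but the quadratic one at 1, which costs the factor w.
    Multiplication by one variable adds at most 2 N^2 w Q^2, and N^3 + 2 N^2 <= (N + 1)^3 absorbs
    it. *)
Lemma mon_taylor2 i :
  `|mon y i - mon s i - dlin y q i + quad q i| <= N i ^+ 3 * w * Q ^+ 2.
Proof.
elim/X_ind: i => [|l i IH].
  by rewrite !mon_zero dlin_zero quad_zero subrr subr0 addr0 normr0 !mulr_ge0 ?exprn_ge0.
have -> : mon y (addX (e_ l) i) - mon s (addX (e_ l) i) - dlin y q (addX (e_ l) i)
     + quad q (addX (e_ l) i) =
   y l * (mon y i - mon s i - dlin y q i + quad q i) + (1 - y l) * quad q i
   + - (q l * (mon y i - mon s i - lin q i)).
  by rewrite !mon_add dlin_add quad_add {1}/s; ring.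
have hq : `|- (q l * (mon y i - mon s i - lin q i))| <= Q * (N i ^+ 2 * w * Q).
  by rewrite normrN normrM ger0_norm // ler_pM // mon_taylor1.
have hl : `|(1 - y l) * quad q i| <= w * (N i ^+ 2 * Q ^+ 2).
  by rewrite normMw ?subr_ge0 ?quad_ge0 ?quad_le.
apply: le_trans (normD3 (normM (y0 l) (y1 l) IH) hl hq) _.
rewrite NS; have := mulr_ge0 w0 (sqr_ge0 Q); have := N0 i.
set n := N i => n0 h.
have -> : n ^+ 3 * w * Q ^+ 2 + w * (n ^+ 2 * Q ^+ 2) + Q * (n ^+ 2 * w * Q)
  = (n ^+ 3 + 2 * n ^+ 2) * (w * Q ^+ 2) by ring.
rewrite -mulrA; apply: ler_wpM2r => //.
by have := sqr_ge0 n; nra.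
Qed.

Lemma dmon_ge0 l i : 0 <= dmon l s i.
Proof. by rewrite /dmon !mulr_ge0 ?exprn_ge0 // prodr_ge0 // => m _; rewrite exprn_ge0. Qed.

Lemma dmon_mono l i : dmon l s i <= dmon l y i.
Proof.
rewrite /dmon ler_pM ?mulr_ge0 ?exprn_ge0 ?prodr_ge0 //.
- by move=> m _; rewrite exprn_ge0.
- by rewrite ler_wpM2l // lerXn2r ?nnegrE.
- by apply: ler_prod => m _; rewrite exprn_ge0 ?lerXn2r ?nnegrE.
Qed.

Lemma dmon_le l i : dmon l s i <= (i l)%:R.
Proof.
rewrite /dmon -mulrA ler_piMr // mulr_ile1 ?exprn_ge0 ?prodr_ge0 //.
- by move=> m _; rewrite exprn_ge0.
- by apply: exprn_ile1 => //; have /andP[] := cs l.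
- by apply: prodr_ile1 => m _; have /andP[a b] := cs m; rewrite exprn_ge0 ?exprn_ile1.
Qed.

Lemma dmon_one_sub l i : (i l)%:R - dmon l s i <= N i ^+ 2 * w.
Proof.
elim/X_ind: i => [|l' i IH].
  by rewrite ffunE dmon_zero subrr mulr_ge0 ?exprn_ge0.
have -> : ((addX (e_ l') i) l)%:R - dmon l s (addX (e_ l') i) =
  (l == l')%:R * (1 - mon s i) + ((i l)%:R - dmon l s i) + (1 - s l') * dmon l s i.
  by rewrite !ffunE natrD dmon_add; ring.
have /andP[m0 m1] := mon_one_sub i.
have h1 : (l == l')%:R * (1 - mon s i) <= N i * w.
  by case: eqP => _; rewrite ?mul1r // mul0r mulr_ge0.
have h2 : (1 - s l') * dmon l s i <= w * N i.
  by rewrite ler_pM ?dmon_ge0 // (le_trans (dmon_le _ _)) // /N coord_le_deg.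
rewrite NS; move: IH h1 h2; set n := N i => IH h1 h2.
have -> : (n + 1) ^+ 2 * w = n * w + n ^+ 2 * w + w * n + w by ring.
by rewrite ler_wpDr // !lerD.
Qed.

Lemma dmon_taylor l i : `|dmon l y i - dmon l s i - hlin l q i| <= N i ^+ 3 * w * Q.
Proof.
elim/X_ind: i => [|l' i IH].
  by rewrite !dmon_zero hlin_zero !subr0 normr0 !mulr_ge0 ?exprn_ge0.
have -> : dmon l y (addX (e_ l') i) - dmon l s (addX (e_ l') i) - hlin l q (addX (e_ l') i) =
  (l == l')%:R * (mon y i - mon s i - lin q i) + y l' * (dmon l y i - dmon l s i - hlin l q i)
  + (- ((1 - y l') * hlin l q i) - q l' * ((i l)%:R - dmon l s i)).
  rewrite !dmon_add hlin_add {2}/s; ring.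
have e0 : (0 : R) <= (l == l')%:R by [].
have e1 : (l == l')%:R <= (1 : R) by case: eqP.
have hl : `|(1 - y l') * hlin l q i| <= w * (N i ^+ 2 * Q).
  by rewrite normMw ?subr_ge0 ?hlin_ge0 ?hlin_le.
have hd : `|q l' * ((i l)%:R - dmon l s i)| <= Q * (N i ^+ 2 * w).
  by rewrite normMw ?subr_ge0 ?dmon_le ?dmon_one_sub.
have hb : `|- ((1 - y l') * hlin l q i) - q l' * ((i l)%:R - dmon l s i)| <=
    w * (N i ^+ 2 * Q) + Q * (N i ^+ 2 * w).
  by rewrite (le_trans (ler_normB _ _)) // normrN lerD.
apply: le_trans (normD3 (normM e0 e1 (mon_taylor1 i)) (normM (y0 l') (y1 l') IH) hb) _.
rewrite NS; have := mulr_ge0 w0 Q0; have := N0 i.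
set n := N i => n0 h.
have -> : n ^+ 2 * w * Q + n ^+ 3 * w * Q + (w * (n ^+ 2 * Q) + Q * (n ^+ 2 * w))
  = (n ^+ 3 + 3 * n ^+ 2) * (w * Q) by ring.
rewrite -mulrA; apply: ler_wpM2r => //.
by have := sqr_ge0 n; nra.
Qed.
End Bounds.

End MonomialTaylor.

(** * Moments of the offspring law and expansion of its generating function *)

Section Moments.
Variables (R : realType) (d : nat) (p : offspring R d).
Local Notation X := (X d).
Local Notation vec := ('I_d -> R).
Implicit Types (i : X) (s q : vec) (l m j k : 'I_d) (F G : X -> R) (x y : R).

Definition pex k F (x : R) := hsum (fun i => p k i * F i) x.
Definition hess k l m : R := fine (bder p k l m).
Definition Mv (s : vec) (q : vec) k : R := \sum_l Ms p s k l * q l.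
Definition Bq (q q' : vec) k : R := \sum_l \sum_m hess k l m * q l * q' m.

Hypothesis hp : is_offspring p.
Let p0 k i : 0 <= p k i. Proof. exact: pk_ge0. Qed.

Lemma pexD k F G x y : pex k F x -> pex k G y -> pex k (fun i => F i + G i) (x + y).
Proof. by move=> hF hG; apply: hsum_eq (hsumD hF hG) => i; rewrite mulrDr. Qed.

Lemma pexZ k (c : R) F x : 0 <= c -> pex k F x -> pex k (fun i => c * F i) (c * x).
Proof. by move=> c0 hF; apply: hsum_eq (hsumZ c0 hF) => i; rewrite mulrCA. Qed.

Lemma pex_sum k (F : 'I_d -> X -> R) (x : vec) : (forall j, pex k (F j) (x j)) ->
  pex k (fun i => \sum_j F j i) (\sum_j x j).
Proof.
move=> hF; apply: hsum_eq (@hsum_sum _ _ _ xpredT (fun j i => p k i * F j i) x (fun j _ => hF j)) => i.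
by rewrite mulr_sumr.
Qed.

Lemma pex_eq k F G x y : F =1 G -> x = y -> pex k F x -> pex k G y.
Proof. by move=> FG <-; apply: hsum_eq => i; rewrite FG. Qed.

Lemma pex_dom k F G x : (forall i, 0 <= F i <= G i) -> pex k G x ->
  exists2 y, pex k F y & 0 <= y <= x.
Proof.
move=> FG hG; have F0 i : 0 <= F i by have /andP[] := FG i.
have FG' i : F i <= G i by have /andP[] := FG i.
have [||y hy yx] := @hsum_dom R X (fun i => p k i * F i) _ x _ _ hG.
- by move=> i; rewrite mulr_ge0.
- by move=> i; rewrite ler_wpM2l.
by exists y => //; rewrite yx (hsum_ge0 hy).
Qed.

Lemma pex_abs k F G H x y z (e : R) : 0 <= e -> pex k F x -> pex k G y -> pex k H z ->
  (forall i, `|F i - G i| <= e * H i) -> `|x - y| <= e * z.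
Proof.
move=> e0 hF hG hH FG.
have le (F' G' : X -> R) x' y' : pex k F' x' -> pex k G' y' ->
    (forall i, `|F' i - G' i| <= e * H i) -> x' <= y' + e * z.
  move=> hF' hG' FG'; apply: hsum_le hF' (pexD hG' (pexZ e0 hH)) => i.
  apply: ler_wpM2l => //; rewrite addrC -lerBlDr.
  exact: le_trans (ler_norm _) (FG' i).
have := le _ _ _ _ hF hG FG.
have := le _ _ _ _ hG hF (fun i => ltac:(rewrite distrC; exact: FG)).
by rewrite ler_norml; lra.
Qed.

Variables (a b c : R) (U : nat).
Hypothesis hK : inK a b c U p.

(** Bound for the third moment of the total number of children: n^3 <= 8 + 5 n(n-1)(n-2) for natural
    n (8 serves n <= 2, the factor 5 serves n >= 3), and the third factorial moments sum to at most
    c. *)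
Definition remainder_const : R := 8 + 5 * c.

Lemma cube_le_fac3 n : (n%:R : R) ^+ 3 <= 8 + 5 * (n%:R * (n%:R - 1) * (n%:R - 2)).
Proof.
case: n => [|[|[|n]]]; rewrite ?expr0n /=; try lra.
rewrite -(natr1 n.+2) -(natr1 n.+1) -(natr1 n).
have : 0 <= n%:R :> R by [].
by set x := n%:R => x0; have := sqr_ge0 x; nra.
Qed.

Lemma sum_delta (F : vec) (l : 'I_d) : \sum_m (F m - (l == m)%:R) = \sum_m F m - 1.
Proof.
rewrite sumrB; congr (_ - _); rewrite (bigD1 l) //= eqxx big1 ?addr0 // => m.
by rewrite eq_sym => /negbTE ->.
Qed.

Lemma natrB_le (m n : nat) : m%:R - n%:R <= (m - n)%:R :> R.
Proof.
have [mn|/ltnW mn] := leqP n m; first by rewrite natrB.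
by rewrite (le_trans _ (ler0n _ _)) // subr_le0 ler_nat.
Qed.

Definition fac3 i l m j : R :=
  (i l * (i m - nat_of_bool (l == m)) * (i j - nat_of_bool (l == j) - nat_of_bool (m == j)))%:R.

(** With real subtraction the triple sum collapses exactly to N(N-1)(N-2); the truncated subtraction
    in [cder] can only be larger, and this direction is the one needed for an upper moment bound. *)
Lemma sum_fac3 i : (degX i)%:R * ((degX i)%:R - 1) * ((degX i)%:R - 2) <=
  \sum_l \sum_m \sum_j fac3 i l m j.
Proof.
have Nsum : \sum_l (i l)%:R = (degX i)%:R :> R by rewrite /degX natr_sum.
set N : R := (degX i)%:R in Nsum *.
have -> : N * (N - 1) * (N - 2) =
    \sum_l \sum_m \sum_j fac2 R i l m * ((i j)%:R - (l == j)%:R - (m == j)%:R).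
  transitivity (\sum_l \sum_m fac2 R i l m * (N - 2)).
    transitivity (\sum_l (i l)%:R * ((N - 1) * (N - 2))); first by rewrite -mulr_suml Nsum; ring.
    apply: eq_bigr => l _; rewrite -mulr_suml mulrA; congr (_ * _).
    rewrite -Nsum -(sum_delta _ l) mulr_sumr; apply: eq_bigr => m _.
    by rewrite fac2E.
  apply: eq_bigr => l _; apply: eq_bigr => m _; rewrite -mulr_sumr; congr (_ * _).
  by rewrite sum_delta sum_delta Nsum; ring.
apply: ler_sum => l _; apply: ler_sum => m _; apply: ler_sum => j _.
rewrite /fac3 natrM -/(fac2 R i l m) ler_wpM2l ?ler0n //.
by apply: le_trans (natrB_le _ _); rewrite lerB ?natrB_le.
Qed.

Lemma pex_deg3 k : exists2 x, pex k (fun i => (degX i)%:R ^+ 3) x & x <= remainder_const.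
Proof.
have [_ [_ [_ hc]]] := hK.
have c0 k' l m j : (0 <= cder p k' l m j)%E.
  by apply: esum_ge0 => i _; rewrite lee_fin mulr_ge0.
have s0 (F : 'I_d -> \bar R) : (forall l, 0 <= F l)%E -> forall l, (F l <= \sum_l F l)%E.
  move=> F0 l; rewrite (bigD1 l) //= -[leLHS]adde0 leeD //.
  by apply: sume_ge0 => l' _.
have hk : (\sum_(l < d) \sum_(m < d) \sum_(j < d) cder p k l m j <= c%:E)%E.
  apply: le_trans hc; apply: (s0 (fun k => _)) => k'.
  by do 3!(apply: sume_ge0 => ? _).
have ck l m j : (cder p k l m j <= c%:E)%E.
  apply: le_trans hk; apply: le_trans (s0 (fun l => _) _ l); last first.
    by move=> l'; do 2!(apply: sume_ge0 => ? _).
  apply: le_trans (s0 (fun m => _) _ m); last by move=> m'; apply: sume_ge0 => ? _.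
  exact: (s0 (fun j => _)).
have fin l m j : (fine (cder p k l m j))%:E = cder p k l m j.
  by rewrite fineK // ge0_fin_numE // (le_lt_trans (ck _ _ _)) ?ltry.
have h3 l m j : pex k (fun i => fac3 i l m j) (fine (cder p k l m j)).
  by split=> [i|]; [rewrite mulr_ge0 ?ler0n | rewrite fin].
have := pex_sum (fun l => pex_sum (fun m => pex_sum (fun j => h3 l m j))).
set z := \sum_l _ => hz.
have zc : z <= c.
  rewrite -lee_fin; apply: le_trans hk; rewrite /z -sumEFin; apply: lee_sum => l _.
  rewrite -sumEFin; apply: lee_sum => m _; rewrite -sumEFin; apply: lee_sum => j _.
  by rewrite fin.
have h1 : pex k (fun=> 1) 1 by apply: hsum_eq (hsum_p hp k) => i; rewrite mulr1.
have := pexD (pexZ (ler0n _ 8) h1) (pexZ (ler0n _ 5) hz).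
case/(@pex_dom _ (fun i => (degX i)%:R ^+ 3)) => [i|x hx /andP[x0 xz]].
  rewrite exprn_ge0 //= (le_trans (cube_le_fac3 _)) // mulr1 lerD2l ler_wpM2l //.
  exact: sum_fac3.
by exists x => //; rewrite (le_trans xz) // /remainder_const mulr1 lerD2l ler_wpM2l.
Qed.

Lemma pex_deg_dom k F (e : R) : 0 <= e -> (forall i, 0 <= F i <= e * (degX i)%:R ^+ 3) ->
  exists2 x, pex k F x & 0 <= x <= e * remainder_const.
Proof.
move=> e0 FN; have [z hz zK] := pex_deg3 k.
have [x hx /andP[x0 xz]] := pex_dom FN (pexZ e0 hz).
by exists x => //; rewrite x0 (le_trans xz) // ler_wpM2l.
Qed.

Let natr_pow3 (n : nat) : n%:R <= (n%:R : R) ^+ 3.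
Proof. by case: n => [|n]; rewrite ?expr0n // ler_eXnr // ler1n. Qed.
Let natr_pow23 (n : nat) : (n%:R : R) ^+ 2 <= (n%:R : R) ^+ 3.
Proof. by case: n => [|n]; rewrite ?expr0n //= ler_weXn2l // ler1n. Qed.

Lemma pex_dmon k l s : cube s ->
  pex k (dmon l s) (Ms p s k l) /\ 0 <= Ms p s k l <= remainder_const.
Proof.
move=> cs; have s0 m : 0 <= s m by have /andP[] := cs m.
have z0 m : 0 <= 0 :> R by [].
have e i : dmon l (fun m => s m - 0) i = dmon l s i.
  by congr dmon; apply/funext => m; rewrite subr0.
have [i|x hx] := @pex_deg_dom k (dmon l s) 1 ler01.
  rewrite mul1r -e (dmon_ge0 (q := fun=> 0)) //= (le_trans (dmon_le (q := fun=> 0) _ _ _ _ _)) //.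
  by rewrite (le_trans (coord_le_deg _ _ _)).
rewrite mul1r; suff -> : Ms p s k l = x by [].
rewrite mxE -(hsum_fine hx); congr fine; apply: eq_esum => i _.
by rewrite /dmon !mulrA.
Qed.

Lemma pex_fac2 k l m : pex k (fun i => fac2 R i l m) (hess k l m) /\ 0 <= hess k l m <= remainder_const.
Proof.
have [i|x hx] := @pex_deg_dom k (fun i => fac2 R i l m) 1 ler01.
  rewrite mul1r ler0n /= (le_trans _ (natr_pow23 _)) // /fac2 natrM expr2.
  rewrite ler_pM // ?coord_le_deg // (le_trans _ (coord_le_deg _ i m)) //.
  by rewrite ler_nat leq_subr.
rewrite mul1r; suff -> : hess k l m = x by [].
by rewrite -(hsum_fine hx).
Qed.

Lemma hess_sum : b <= \sum_k \sum_l \sum_m hess k l m.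
Proof.
have [_ [_ [hb _]]] := hK.
rewrite -lee_fin (le_trans hb) // -sumEFin; apply: lee_sum => k _.
rewrite -sumEFin; apply: lee_sum => l _; rewrite -sumEFin; apply: lee_sum => m _.
by have [[_ h] _] := pex_fac2 k l m; rewrite -h /bder.
Qed.

Section Taylor.
Variables (y q : vec) (k : 'I_d).
Hypotheses (cy : cube y) (q0 : forall l, 0 <= q l) (qy : forall l, q l <= y l).
Let s : vec := fun l => y l - q l.
Let w := nrm (fun l => 1 - s l).
Let y0 l : 0 <= y l. Proof. by have /andP[] := cy l. Qed.
Let cs : cube s.
Proof.
move=> l; rewrite /s subr_ge0 qy /=; have /andP[_ y1] := cy l.
by apply: le_trans y1; rewrite lerBlDr lerDl.
Qed.
Let w0 : 0 <= w.
Proof. by apply: nrm_ge0 => l; rewrite subr_ge0; have /andP[] := cs l. Qed.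
Let Q0 : 0 <= nrm q. Proof. exact: nrm_ge0. Qed.

Lemma pex_mon z : cube z -> pex k (mon z) (pgf p k z).
Proof. by case/(hsum_pgf hp k). Qed.

Lemma pex_dlin : pex k (dlin y q) (Mv y q k).
Proof.
apply: pex_sum => l; by apply: pex_eq (pexZ (q0 l) (pex_dmon k l cy).1) => [i|]; rewrite mulrC.
Qed.

Lemma pex_quad : pex k (quad q) (2^-1 * Bq q q k).
Proof.
apply: pexZ => //; apply: pex_sum => l; apply: pex_sum => m.
by apply: pex_eq (pexZ (mulr_ge0 (q0 l) (q0 m)) (pex_fac2 k l m).1) => [i|]; ring.
Qed.

(** [mon_concave] integrated against the offspring law: f_k is convex along nonnegative directions,
    so the slope at the upper point dominates. *)
Lemma pgf_concave : pgf p k y - pgf p k s <= Mv y q k.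
Proof.
rewrite lerBlDl; apply: hsum_le (pex_mon cy) (pexD (pex_mon cs) pex_dlin) => i.
by rewrite ler_wpM2l // -lerBlDl mon_concave.
Qed.

(** [mon_taylor2] integrated against the offspring law; the cubed degree integrates to at most
    [remainder_const]. *)
Lemma pgf_taylor : `|pgf p k y - pgf p k s - Mv y q k + 2^-1 * Bq q q k| <=
  remainder_const * w * nrm q ^+ 2.
Proof.
have [z hz zK] := pex_deg3 k.
have e0 : 0 <= w * nrm q ^+ 2 by rewrite mulr_ge0 ?exprn_ge0.
have -> : pgf p k y - pgf p k s - Mv y q k + 2^-1 * Bq q q k =
  (pgf p k y + 2^-1 * Bq q q k) - (pgf p k s + Mv y q k) by ring.
have h i : `|mon y i + quad q i - (mon s i + dlin y q i)| <= w * nrm q ^+ 2 * (degX i)%:R ^+ 3.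
  have := mon_taylor2 cy q0 qy i; rewrite -/s -/w.
  have -> : mon y i + quad q i - (mon s i + dlin y q i) =
     mon y i - mon s i - dlin y q i + quad q i by ring.
  by move=> /le_trans -> //; rewrite le_eqVlt; apply/orP; left; apply/eqP; ring.
apply: le_trans (pex_abs e0 (pexD (pex_mon cy) pex_quad) (pexD (pex_mon cs) pex_dlin) hz h) _.
by rewrite mulrC mulrA ler_wpM2r ?exprn_ge0 // ler_wpM2r.
Qed.

Lemma Ms_mono l : Ms p s k l <= Ms p y k l.
Proof.
apply: hsum_le (pex_dmon k l cs).1 (pex_dmon k l cy).1 => i.
by rewrite ler_wpM2l // dmon_mono.
Qed.

Lemma Ms_taylor l : `|Ms p y k l - Ms p s k l - \sum_m hess k l m * q m| <= remainder_const * w * nrm q.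
Proof.
have [z hz zK] := pex_deg3 k.
have e0 : 0 <= w * nrm q by rewrite mulr_ge0.
have hh : pex k (hlin l q) (\sum_m hess k l m * q m).
  apply: pex_sum => m; by apply: pex_eq (pexZ (q0 m) (pex_fac2 k l m).1) => [i|]; rewrite mulrC.
have h i : `|dmon l y i - (dmon l s i + hlin l q i)| <= w * nrm q * (degX i)%:R ^+ 3.
  have := dmon_taylor cy q0 qy l i; rewrite -/s -/w opprD addrA.
  by move=> /le_trans -> //; rewrite le_eqVlt; apply/orP; left; apply/eqP; ring.
have := pex_abs e0 (pex_dmon k l cy).1 (pexD (pex_dmon k l cs).1 hh) hz h.
rewrite opprD addrA => /le_trans -> //.
by rewrite mulrC mulrA ler_wpM2r // ler_wpM2r.
Qed.
End Taylor.

End Moments.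

(** * Perron-Frobenius theory, uniformly over a class of primitive matrices *)

Section PerronFrobenius.
Variables (R : realType) (d : nat).
Local Notation vec := ('I_d -> R).
Implicit Types (A : 'M[R]_d) (x y z u v : vec) (n : nat) (k l : 'I_d).

Definition mv A x k : R := \sum_l A k l * x l.
Definition vm v A l : R := \sum_k v k * A k l.
Definition dot x y : R := \sum_k x k * y k.

Lemma mvM A (B : 'M[R]_d) x k : mv (A * B) x k = mv A (mv B x) k.
Proof.
rewrite /mv -mulmxE; under eq_bigr do rewrite mxE mulr_suml.
rewrite exchange_big; apply: eq_bigr => l _ /=; rewrite mulr_sumr.
by apply: eq_bigr => m _; rewrite mulrA.
Qed.

Lemma mv1 x k : mv (1 : 'M[R]_d) x k = x k.
Proof.
rewrite /mv (bigD1 k) //= mxE eqxx mul1r big1 ?addr0 // => l /negbTE lk.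
by rewrite mxE eq_sym lk mul0r.
Qed.

Lemma mvS A n x k : mv (A ^+ n.+1) x k = mv A (mv (A ^+ n) x) k.
Proof. by rewrite exprS mvM. Qed.

Lemma mvSr A n x k : mv (A ^+ n.+1) x k = mv (A ^+ n) (mv A x) k.
Proof. by rewrite exprSr mvM. Qed.

Lemma dot_mv v A x : dot v (mv A x) = dot (vm v A) x.
Proof.
rewrite /dot /mv /vm; under eq_bigr do rewrite mulr_sumr.
rewrite exchange_big; apply: eq_bigr => l _ /=; rewrite mulr_suml.
by apply: eq_bigr => k _; rewrite mulrA.
Qed.

Lemma mvD A x y k : mv A (fun l => x l + y l) k = mv A x k + mv A y k.
Proof. by rewrite /mv -big_split; apply: eq_bigr => l _; rewrite mulrDr. Qed.

Lemma mvB A x y k : mv A (fun l => x l - y l) k = mv A x k - mv A y k.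
Proof. by rewrite /mv -sumrB; apply: eq_bigr => l _; rewrite mulrBr. Qed.

Lemma mvZ A (c : R) x k : mv A (fun l => c * x l) k = c * mv A x k.
Proof. by rewrite /mv mulr_sumr; apply: eq_bigr => l _; rewrite mulrCA. Qed.

Lemma dotB v x y : dot v (fun l => x l - y l) = dot v x - dot v y.
Proof. by rewrite /dot -sumrB; apply: eq_bigr => l _; rewrite mulrBr. Qed.

Lemma dotD v x y : dot v (fun l => x l + y l) = dot v x + dot v y.
Proof. by rewrite /dot -big_split; apply: eq_bigr => l _; rewrite mulrDr. Qed.

Lemma dotZ v (c : R) x : dot v (fun l => c * x l) = c * dot v x.
Proof. by rewrite /dot mulr_sumr; apply: eq_bigr => l _; rewrite mulrCA. Qed.

Lemma dotZl (e : R) x y : dot (fun k => e * x k) y = e * dot x y.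
Proof. by rewrite /dot mulr_sumr; apply: eq_bigr => l _; rewrite mulrA. Qed.

Lemma dotC x y : dot x y = dot y x.
Proof. by apply: eq_bigr => k _; rewrite mulrC. Qed.

Lemma mv_le A x y k : (forall k l, 0 <= A k l) -> (forall l, x l <= y l) -> mv A x k <= mv A y k.
Proof. by move=> A0 xy; apply: ler_sum => l _; rewrite ler_wpM2l. Qed.

Lemma mv_ge0 A x k : (forall k l, 0 <= A k l) -> (forall l, 0 <= x l) -> 0 <= mv A x k.
Proof. by move=> A0 x0; apply: sumr_ge0 => l _; rewrite mulr_ge0. Qed.

Lemma dot_ge0 x y : (forall l, 0 <= x l) -> (forall l, 0 <= y l) -> 0 <= dot x y.
Proof. by move=> x0 y0; apply: sumr_ge0 => l _; rewrite mulr_ge0. Qed.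

Lemma dot_le v x y : (forall k, 0 <= v k) -> (forall l, x l <= y l) -> dot v x <= dot v y.
Proof. by move=> v0 xy; apply: ler_sum => l _; rewrite ler_wpM2l. Qed.

Lemma exp_mx_ge0 A n : (forall k l, 0 <= A k l) -> forall k l, 0 <= (A ^+ n) k l.
Proof.
move=> A0; elim: n => [|n IH] k l; first by rewrite expr0 mxE; case: eqP.
by rewrite exprS -mulmxE mxE sumr_ge0 // => m _; rewrite mulr_ge0.
Qed.

Lemma mv_eig A (r : R) x n k : (forall k, mv A x k = r * x k) -> mv (A ^+ n) x k = r ^+ n * x k.
Proof.
move=> e; elim: n k => [|n IH] k; first by rewrite expr0 mv1 mul1r.
rewrite mvSr (_ : mv A x = fun k => r * x k) ?mvZ ?IH ?exprS ?mulrA //.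
by apply/funext.
Qed.

Lemma trmx_exp A n : (A^T) ^+ n = (A ^+ n)^T.
Proof.
elim: n => [|n IH]; first by rewrite !expr0 trmx1.
by rewrite exprS exprSr IH -!mulmxE trmx_mul.
Qed.

Lemma mv_tr A x k : mv A^T x k = vm x A k.
Proof. by apply: eq_bigr => l _; rewrite mxE mulrC. Qed.

Section Existence.
Variables (A : 'M[R]_d) (U : nat) (al : R).
Hypotheses (d1 : (1 <= d)%N) (al0 : 0 < al) (U1 : (1 <= U)%N).
Hypotheses (A0 : forall k l, 0 <= A k l) (AU : forall k l, al <= (A ^+ U) k l).

(* Collatz-Wielandt sets: the Perron root is the largest [la] with [CW la] nonempty *)
Let CW (la : R) : set 'rV[R]_d := [set x | [/\ forall k, 0 <= x 0 k, \sum_k x 0 k = 1 &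
  forall k, la * x 0 k <= mv A (x 0) k]].

Let E : set R := [set la | CW la !=set0].

Let k0 : 'I_d. Proof. by case: d d1 => // d' _; exact: ord0. Qed.

Let CW_of (la : R) x : (forall k, 0 <= x k) -> 0 < nrm x -> (forall k, la * x k <= mv A x k) -> E la.
Proof.
move=> x0 xp hx; exists (\row_k ((nrm x)^-1 * x k)).
have nx : 0 <= (nrm x)^-1 by rewrite invr_ge0 ltW.
split=> [k||k].
- by rewrite mxE mulr_ge0.
- by under eq_bigr do rewrite mxE; rewrite -mulr_sumr mulVf ?gt_eqF.
- have -> : mv A ((\row_k ((nrm x)^-1 * x k)) 0) k = mv A (fun k => (nrm x)^-1 * x k) k.
    by apply: eq_bigr => l _; rewrite mxE.
  by rewrite mxE mvZ mulrCA ler_wpM2l.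
Qed.

Let E0 : E 0.
Proof.
apply: (@CW_of 0 (fun=> 1)) => // [|k].
  by rewrite /nrm sumr_const card_ord -[_ *+ d]/(d%:R) ltr0n.
by rewrite mul0r mv_ge0.
Qed.

Let Esup : has_sup E.
Proof.
split; first by exists 0; exact: E0.
exists (\sum_k \sum_l A k l) => la [x [x0 x1 hx]].
have x1' k : x 0 k <= 1 by rewrite -x1 (bigD1 k) //= lerDl sumr_ge0.
rewrite -[la]mulr1 -x1 mulr_sumr; apply: ler_sum => k _; apply: le_trans (hx k) _.
by apply: ler_sum => l _; rewrite ler_piMr.
Qed.

Let CW_anti (la la' : R) : la <= la' -> CW la' `<=` CW la.
Proof.
move=> ll x [x0 x1 hx]; split=> // k; apply: le_trans (hx k).
by rewrite ler_wpM2r.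
Qed.

(** The sets [CW la] decrease in [la], so those with [la] below the supremum generate a filter on
    the compact cube. A cluster point satisfies every inequality up to an arbitrarily small error,
    hence the one at the supremum. *)
Let attained : exists2 x, forall k, 0 <= x k & nrm x = 1 /\ forall k, sup E * x k <= mv A x k.
Proof.
pose D := [set la | la < sup E].
have FF : ProperFilter (filter_from D CW).
  apply: filter_from_proper.
    apply: filter_from_filter; first by exists (sup E - 1); rewrite /D /= ltrBlDr ltrDl.
    move=> i j Di Dj; exists (Num.max i j); first by rewrite /D /= gt_max Di.
    by move=> x hx; split; apply: CW_anti hx; rewrite le_max lexx ?orbT.
  move=> la /= laE; have [la' [x hx] /ltW ll] := sup_gt (ex_intro _ 0 E0) laE.
  by exists x; exact: CW_anti hx.
pose K : set 'rV[R]_d := [set v : 'rV[R]_d | forall i, `[0, 1]%classic (v ord0 i)].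
have Kc : compact K by apply: (@rV_compact R d (fun=> `[0, 1]%classic)) => i; exact: segment_compact.
have [|p [_ clp]] := Kc _ FF.
  exists (sup E - 1); first by rewrite /D /= ltrBlDr ltrDl.
  move=> x [x0 x1 _] i; rewrite /= in_itv /= x0 /= -x1 (bigD1 i) //= lerDl.
  by rewrite sumr_ge0.
have near la (e : R) : la < sup E -> 0 < e -> exists2 x, CW la x & forall k, `|p 0 k - x 0 k| < e.
  move=> laE e0; have [x [hx bx]] := clp (CW la) (ball p e) (ex_intro2 _ _ la laE (fun _ h => h)) (nbhsx_ballx _ _ e0).
  by exists x => // k; case: bx => _ bx; exact: (bx 0 k).
have sE1 : sup E - 1 < sup E by rewrite ltrBlDr ltrDl.
have p0 k : 0 <= p 0 k.
  apply/ler_addgt0Pr => e e0; have [x [x0 _ _] /(_ k)] := near _ _ sE1 e0.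
  by rewrite ltr_distl => /andP[+ _]; have := x0 k; lra.
have dp : (0 : R) < d%:R by rewrite ltr0n.
have close x y (e : R) : (forall k, `|x k - y k| < e) -> `|nrm x - nrm y| <= d%:R * e.
  move=> xy; rewrite /nrm -sumrB (le_trans (ler_norm_sum _ _ _)) //.
  rewrite mulr_natl -[d in leRHS]card_ord -sumr_const; apply: ler_sum => k _; exact: ltW.
exists (p 0) => //; split.
  apply/eqP; rewrite -subr_eq0 -normr_le0; apply/ler_addgt0Pr => e e0; rewrite add0r.
  have [|x [_ x1 _] /close] := near _ (e / d%:R) sE1; first by rewrite divr_gt0.
  by rewrite [nrm (x 0)]x1 mulrC divfK // gt_eqF.
move=> k; have [->|pk] := eqVneq (p 0 k) 0; first by rewrite mulr0 mv_ge0.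
have pkp : 0 < p 0 k by rewrite lt0r pk p0.
rewrite -ler_pdivlMr //; apply/ler_addgt0Pl => e e0.
rewrite -lerBlDl; set la := sup E - e.
have laE : la < sup E by rewrite /la ltrBlDr ltrDl.
rewrite ler_pdivlMr //.
pose S := \sum_l A k l.
have S0 : 0 <= S by apply: sumr_ge0.
have C0 : 0 < `|la| + S + 1 by rewrite ltr_wpDl // addr_ge0.
apply/ler_addgt0Pr => e' e'0.
have e''0 : 0 < e' / (`|la| + S + 1) by rewrite divr_gt0.
have [x [_ _ /(_ k) hx] px] := near _ _ laE e''0.
set e'' := e' / _ in e''0 px.
have h1 : la * p 0 k <= la * x 0 k + `|la| * e''.
  rewrite -lerBlDl -mulrBr (le_trans (ler_norm _)) // normrM ler_wpM2l //.
  exact: ltW.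
have h2 : mv A (x 0) k <= mv A (p 0) k + S * e''.
  rewrite /S mulr_suml -big_split; apply: ler_sum => l _ /=; rewrite -mulrDr ler_wpM2l //.
  by have := px l; rewrite ltr_distlC => /andP[_ /ltW].
have : (`|la| + S) * e'' <= e'.
  by rewrite /e'' mulrCA ler_piMr ?(ltW e'0) // ler_pdivrMr // mul1r lerDl.
by rewrite mulrDl; lra.
Qed.

Let mvU_ge x k : (forall k, 0 <= x k) -> al * nrm x <= mv (A ^+ U) x k.
Proof. by move=> x0; rewrite mulr_sumr; apply: ler_sum => l _; rewrite ler_wpM2r. Qed.

(** If z = A x - r x were nonzero, A^U z would be positive in every coordinate, and A^U x would
    witness a value larger than the supremum r. Positivity of x then follows from that of A^U x =
    r^U x. *)
Lemma perron_right : exists (r : R) x, [/\ 0 < r, forall k, 0 < x k & forall k, mv A x k = r * x k].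
Proof.
have [x x0 [x1 hx]] := attained; set r := sup E in hx.
have r0 : 0 <= r by apply: sup_upper_bound E0.
pose z k := mv A x k - r * x k.
have z0 k : 0 <= z k by rewrite subr_ge0.
pose y := mv (A ^+ U) x.
have yp k : 0 < y k by rewrite (lt_le_trans _ (mvU_ge k x0)) // x1 mulr1.
have ny : 0 < nrm y.
  by rewrite /nrm (bigD1 k0) //= ltr_wpDr // sumr_ge0 // => k _; exact: ltW.
have Ay k : mv A y k = r * y k + mv (A ^+ U) z k.
  by rewrite /y -mvS mvSr /z mvB mvZ addrC subrK.
have nz : nrm z = 0.
  apply/eqP; rewrite eq_le nrm_ge0 // andbT leNgt; apply/negP => nz.
  pose e := al * nrm z / nrm y.
  have e0 : 0 < e by rewrite divr_gt0 ?mulr_gt0.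
  suff : r + e <= r by rewrite gerDl leNgt e0.
  apply: sup_upper_bound => //; apply: (@CW_of _ y) => // [k|k]; first exact: ltW.
  rewrite Ay mulrDl lerD2l; apply: le_trans (mvU_ge k z0).
  rewrite /e mulrAC ler_pdivrMr //; apply: ler_wpM2l; first by rewrite ltW // mulr_gt0.
  by apply: nrm_ge => l; exact: ltW.
have zk k : z k = 0.
  by apply/eqP; rewrite eq_le z0 andbT -nz nrm_ge.
have eig k : mv A x k = r * x k by apply/eqP; rewrite -subr_eq0 -/(z k) zk.
have yE k : y k = r ^+ U * x k by exact: mv_eig.
have rU : 0 < r.
  rewrite lt0r r0 andbT; apply: contraTneq (yp k0) => r0'.
  by rewrite yE r0' expr0n (gtn_eqF U1) mul0r ltxx.
exists r, x; split=> // k; rewrite lt0r x0 andbT; apply: contraTneq (yp k) => xk.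
by rewrite yE xk mulr0 ltxx.
Qed.
End Existence.

(** The left eigenvector comes from the transpose; pairing the two positive eigenvectors forces the
    two eigenvalues to agree. *)
Lemma perron_exists A U (al : R) : (1 <= d)%N -> 0 < al -> (1 <= U)%N ->
  (forall k l, 0 <= A k l) -> (forall k l, al <= (A ^+ U) k l) ->
  exists (r : R) (u v : 'cV[R]_d), perron_triple A r u v.
Proof.
move=> d1 al0 U1 A0 AU.
have k0 : 'I_d by case: d d1 => // d' _; exact: ord0.
have [r [u [r0 u0 Au]]] := perron_right d1 al0 U1 A0 AU.
have [||r' [v [r'0 v0 Av]]] := @perron_right A^T U al d1 al0 U1.
- by move=> k l; rewrite mxE.
- by move=> k l; rewrite trmx_exp mxE.
have nu : 0 < nrm u by rewrite /nrm (bigD1 k0) //= ltr_wpDr // sumr_ge0 // => k _; exact: ltW.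
have vA : vm v A = fun k => r' * v k by apply/funext => k; rewrite -mv_tr Av.
have vu : 0 < dot v u.
  rewrite /dot (bigD1 k0) //= ltr_wpDr ?mulr_gt0 // sumr_ge0 // => k _.
  by rewrite mulr_ge0 ?ltW.
have rr : r = r'.
  apply: (mulIf (x := dot v u)); first by rewrite gt_eqF.
  rewrite -dotZ -[RHS]dotZ; transitivity (dot v (mv A u)); first by apply: eq_bigr => k _; rewrite Au.
  by rewrite dot_mv vA dotC [RHS]dotC; apply: eq_bigr => k _; ring.
exists r, (\col_k ((nrm u)^-1 * u k)), (\col_k ((nrm u / dot v u) * v k)).
split; [|split; [|split; [|split; [|split]]]].
- by move=> k; rewrite mxE mulr_gt0 ?invr_gt0.
- by move=> k; rewrite mxE mulr_gt0 ?divr_gt0.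
- apply/matrixP => k j; rewrite !mxE mulrCA -Au -mvZ; apply: eq_bigr => l _.
  by rewrite mxE.
- apply/matrixP => j k; rewrite !mxE mulrCA rr -Av /mv mulr_sumr; apply: eq_bigr => l _.
  by rewrite !mxE; ring.
- by under eq_bigr do rewrite mxE; rewrite -mulr_sumr mulVf ?gt_eqF.
- transitivity ((dot v u)^-1 * dot v u); last by rewrite mulVf ?gt_eqF.
  rewrite /dot mulr_sumr; apply: eq_bigr => k _; rewrite !mxE -/(dot v u).
  by field; rewrite !gt_eqF.
Qed.

End PerronFrobenius.

Lemma pow_near1 (R : realType) m (e : R) : 0 < e ->
  exists2 dl : R, 0 < dl & forall r : R, `|r - 1| <= dl -> `|r ^+ m - 1| <= e.
Proof.
move=> e0; have : (fun r : R => r ^+ m) @ (1 : R) --> (1 : R) ^+ m by exact: exprn_continuous.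
rewrite expr1n => /cvgrPdist_le /(_ e e0) /nbhs_ballP [dl /= dl0 h].
exists (dl / 2); first by rewrite divr_gt0.
move=> r rd; rewrite distrC; apply: h; rewrite /ball /= distrC (le_lt_trans rd) //.
by rewrite ltr_pdivrMr // ltr_pMr // ltr1n.
Qed.

Lemma geo_small (R : realType) (th c e : R) : 0 <= th -> th < 1 -> 0 <= c -> 0 < e ->
  exists j, c * th ^+ j <= e.
Proof.
move=> t0 t1 c0 e0.
have : (fun n => th ^+ n) @ \oo --> (0 : R) by apply: cvg_expr; rewrite ger0_norm.
move=> /cvgrPdist_le /(_ (e / (c + 1))) []; first by rewrite divr_gt0 // ltr_wpDl.
move=> j _ /(_ j (leqnn j)); rewrite sub0r normrN ger0_norm ?exprn_ge0 // => h.
exists j; apply: le_trans (ler_wpM2l c0 h) _.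
rewrite mulrCA ler_piMr ?(ltW e0) // ler_pdivrMr ?ltr_wpDl // mul1r lerDl //.
Qed.

(** * Uniform convergence to the Perron direction *)

Section UniformPerron.
Variables (R : realType) (d : nat).
Local Notation vec := ('I_d -> R).
Implicit Types (A : 'M[R]_d) (x y z u v : vec) (n : nat) (k l : 'I_d) (r : R).

Definition ptrip A r u v := [/\ forall k, 0 < u k, forall k, 0 < v k, forall k, mv A u k = r * u k,
  forall k, vm v A k = r * v k & nrm u = 1 /\ dot v u = 1].

Lemma perron_ptrip A r (x y : 'cV[R]_d) : perron_triple A r x y ->
  ptrip A r (fun k => x k 0) (fun k => y k 0).
Proof.
move=> [u0 [v0 [Au [vA [u1 uv]]]]]; split=> //.
- by move=> k; have /matrixP/(_ k 0) := Au; rewrite !mxE.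
- move=> k; have /matrixP/(_ 0 k) := vA; rewrite !mxE => <-.
  by apply: eq_bigr => l _; rewrite mxE.
- by split=> //; rewrite dotC.
Qed.

Definition pu A k := perron_u A k 0.
Definition pv A k := perron_v A k 0.

Lemma perron_spec A : (exists (r : R) (x y : 'cV[R]_d), perron_triple A r x y) ->
  ptrip A (perron_root A) (pu A) (pv A).
Proof.
move=> [r [u [v h]]]; apply: perron_ptrip.
rewrite /perron_root /perron_u /perron_v /perron; case: xgetP => [t -> //|].
by move=> /(_ (r, u, v)).
Qed.

(** [perron] defaults to the zero triple, so a nonzero root certifies a genuine one. For
    near-critical laws this replaces an existence proof, as [rho] is close to 1. *)
Lemma perron_root_neq0 A : perron_root A != 0 -> ptrip A (perron_root A) (pu A) (pv A).
Proof.
move=> h; apply: perron_spec; move: h.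
rewrite /perron_root /perron; case: xgetP => [[[r u] v] _ /= ht _|_]; last by rewrite eqxx.
by exists r, u, v.
Qed.

Lemma dot_deltaE (l : 'I_d) x : dot x (fun k => (k == l)%:R) = x l.
Proof.
rewrite /dot (bigD1 l) //= eqxx mulr1 big1 ?addr0 // => k /negbTE ->.
by rewrite mulr0.
Qed.

Lemma norm_dot x y : `|dot x y| <= \sum_k `|x k| * `|y k|.
Proof. by rewrite (le_trans (ler_norm_sum _ _ _)) // ler_sum // => k _; rewrite normrM. Qed.

Variables (U : nat) (al be : R).
Hypotheses (al0 : 0 < al) (be0 : 0 <= be).

(* uniformly primitive nonnegative matrices with Perron root at most 2 *)
Definition primitive_class A r u v := [/\ forall k l, 0 <= A k l <= be, forall k l, al <= (A ^+ U) k l,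
  ptrip A r u v & r <= 2].

(** Common lower bound for the entries of u and v: r^U u = A^U u >= al because u sums to 1, while
    r^U <= 2^U; similarly for v, whose sum is at least u.v = 1. The cap at 1 makes [kap^-1] at least
    1. *)
Definition kap : R := Num.min 1 (al / 2 ^+ U).

Lemma kap_gt0 : 0 < kap.
Proof. by rewrite lt_min ltr01 divr_gt0 // exprn_gt0. Qed.

Section Bounds.
Variables (A : 'M[R]_d) (r : R) (u v : vec).
Hypothesis hA : primitive_class A r u v.
Let A0 k l : 0 <= A k l. Proof. by have [/(_ k l)/andP[]] := hA. Qed.
Let AU k l : al <= (A ^+ U) k l. Proof. by have [_] := hA. Qed.
Let hp : ptrip A r u v. Proof. by have [] := hA. Qed.

Lemma u_le1 k : u k <= 1.
Proof.
by have [u0 _ _ _ [<- _]] := hp; apply: nrm_ge => l; exact: ltW.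
Qed.

Lemma root_ge0 : 0 <= r.
Proof.
have [u0 _ Au _ [u1 _]] := hp.
case: (pickP (fun _ : 'I_d => true)) => [k _|none]; last first.
  by have := oner_neq0 R; rewrite -u1 /nrm big1 ?eqxx // => l; have := none l.
rewrite -(pmulr_lge0 r (u0 k)) -Au; apply: mv_ge0 => // l; exact: ltW.
Qed.

Lemma rU_le : r ^+ U <= 2 ^+ U.
Proof. by have [_ _ _ r2] := hA; rewrite lerXn2r ?nnegrE ?root_ge0. Qed.

Let kapU : kap * 2 ^+ U <= al.
Proof. by rewrite -ler_pdivlMr ?exprn_gt0 // ge_min lexx orbT. Qed.

Lemma u_ge k : kap <= u k.
Proof.
have [u0 _ Au _ [u1 _]] := hp.
have h : al <= r ^+ U * u k.
  rewrite -(mv_eig _ _ Au) -[al]mulr1 -u1 mulr_sumr; apply: ler_sum => l _.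
  by rewrite ler_wpM2r // ltW.
rewrite -(ler_pM2r (exprn_gt0 U (ltr0n R 2))) (le_trans kapU) // (le_trans h) //.
by rewrite mulrC ler_wpM2l ?rU_le // ltW.
Qed.

Lemma v_ge k : kap <= v k.
Proof.
have [u0 v0 _ vA [_ uv]] := hp.
have vA' l : mv A^T v l = r * v l by rewrite mv_tr vA.
have h : al <= r ^+ U * v k.
  rewrite -(mv_eig _ _ vA') trmx_exp -[al]mulr1 -uv mulr_sumr; apply: ler_sum => l _.
  rewrite mxE ler_pM ?(ltW al0) ?mulr_ge0 ?(ltW (u0 _)) ?(ltW (v0 _)) //.
  by rewrite ler_piMr ?u_le1 // ltW.
rewrite -(ler_pM2r (exprn_gt0 U (ltr0n R 2))) (le_trans kapU) // (le_trans h) //.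
by rewrite mulrC ler_wpM2l ?rU_le // ltW.
Qed.

Lemma v_le k : v k <= kap^-1.
Proof.
have [u0 v0 _ _ [_ uv]] := hp.
have h : v k * u k <= 1.
  by rewrite -uv /dot (bigD1 k) //= lerDl sumr_ge0 // => l _; rewrite mulr_ge0 ?ltW.
rewrite -[leRHS]mul1r ler_pdivlMr ?kap_gt0 // (le_trans _ h) //.
by rewrite ler_wpM2l ?u_ge // ltW.
Qed.

Lemma nrm_le_dot x : (forall k, 0 <= x k) -> nrm x <= kap^-1 * dot v x.
Proof.
move=> x0; rewrite ler_pdivlMl ?kap_gt0 // mulr_sumr; apply: ler_sum => k _.
by rewrite ler_wpM2r // v_ge.
Qed.

Lemma dot_le_nrm x : (forall k, 0 <= x k) -> dot v x <= kap^-1 * nrm x.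
Proof.
move=> x0; rewrite mulr_sumr; apply: ler_sum => k _.
by rewrite ler_wpM2r // v_le.
Qed.

Lemma norm_dot_le x (e : R) : (forall k, `|x k| <= e) -> `|dot v x| <= kap^-1 * d%:R * e.
Proof.
move=> xe; apply: le_trans (norm_dot _ _) _.
rewrite -mulrA mulr_natl -[d in leRHS]card_ord -sumr_const mulr_sumr; apply: ler_sum => k _.
have [_ v0 _ _ _] := hp.
by rewrite ler_pM // gtr0_norm // v_le.
Qed.
End Bounds.

(** Doeblin's argument: A^U dominates a rank-one matrix tau u v', and what remains contracts vectors
    annihilated by v. The unit vectors minus their Perron parts are such vectors, so the powers
    approach u v' at a rate that depends only on the class. *)
Lemma decay (e : R) : 0 < e -> exists m, exists2 dl : R, 0 < dl & forall A r u v, primitive_class A r u v ->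
  `|r - 1| <= dl -> forall k l, `|(A ^+ m) k l - u k * v l| <= e.
Proof.
move=> e0; have k0 := kap_gt0.
have kV : 0 < kap^-1 by rewrite invr_gt0.
(* As u <= 1 and v <= kap^-1, this makes tau u v' at most al, hence at most A^U entrywise. The rate
   [th] dominates r^U - tau once r^U <= 1 + tau/2. *)
pose tau := Num.min 1 (al * kap).
have t0 : 0 < tau by rewrite lt_min ltr01 mulr_gt0.
have t1 : tau <= 1 by rewrite ge_min lexx.
pose th := 1 - tau / 2.
have th0 : 0 <= th by rewrite /th; lra.
have th1 : th < 1 by rewrite /th; lra.
pose c := (1 + kap^-1) * kap^-1.
have c0 : 0 <= c by rewrite mulr_ge0 ?addr_ge0 ?ltW.
have [j hj] := geo_small th0 th1 c0 (divr_gt0 e0 (ltr0n R 2)).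
have tau2 : 0 < tau / 2 by rewrite divr_gt0.
have [d1 d10 hd1] := pow_near1 U tau2.
have ek : 0 < e / 2 * kap by rewrite mulr_gt0 ?divr_gt0.
have [d2 d20 hd2] := pow_near1 (U * j) ek.
exists (U * j)%N; exists (Num.min d1 d2); first by rewrite lt_min d10.
move=> A r u v hA; rewrite le_min => /andP[/hd1 r1 /hd2 r2] k l.
have [A0 AU hp _] := hA; have [u0 v0 Au vA [u1 uv]] := hp.
set P := A ^+ U in AU.
have Pu k' : mv P u k' = r ^+ U * u k' by exact: mv_eig.
have vP x : dot v (mv P x) = r ^+ U * dot v x.
  rewrite dot_mv (_ : vm v P = fun k => r ^+ U * v k) ?dotZl //.
  apply/funext => k'; rewrite -mv_tr -trmx_exp; apply: mv_eig => k''.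
  by rewrite mv_tr vA.
have rU : r ^+ U - tau <= th.
  by move: r1; rewrite ler_norml /th => /andP[_]; lra.
have P' k' l' : tau * u k' * v l' <= P k' l'.
  apply: le_trans (AU k' l'); apply: (@le_trans _ _ (al * kap * kap^-1)); last by rewrite mulfK ?gt_eqF.
  rewrite ler_pM ?mulr_ge0 ?(ltW t0) ?(ltW (u0 _)) ?(ltW (v0 _)) ?(v_le hA) //.
  rewrite -[leRHS]mulr1 ler_pM ?(ltW t0) ?(ltW (u0 _)) ?(u_le1 hA) //.
  by rewrite ge_min lexx orbT.
have rt0 : 0 <= r ^+ U - tau.
  rewrite -(pmulr_lge0 _ (u0 k)) mulrBl -Pu subr_ge0 -[tau * _]mulr1 -uv mulr_sumr.
  by apply: ler_sum => l' _; rewrite mulrA ler_wpM2r ?(ltW (u0 _)).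
(* On the kernel of v, P may be replaced by P - tau u v', which is nonnegative and has eigenvector u
   with eigenvalue r^U - tau; hence bounds by multiples of u shrink. *)
have contr z (C : R) : dot v z = 0 -> (forall k, `|z k| <= C * u k) ->
    forall k, `|mv P z k| <= C * th * u k.
  move=> vz zC k'; have C0 : 0 <= C.
    by rewrite -(pmulr_lge0 _ (u0 k')) (le_trans _ (zC k')).
  have -> : mv P z k' = \sum_l' (P k' l' - tau * u k' * v l') * z l'.
    transitivity (mv P z k' - tau * u k' * dot v z); first by rewrite vz mulr0 subr0.
    rewrite /mv /dot mulr_sumr -sumrB.
    by apply: eq_bigr => l' _; ring.
  apply: le_trans (ler_norm_sum _ _ _) _.
  apply: (@le_trans _ _ (\sum_l' (P k' l' - tau * u k' * v l') * (C * u l'))).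
    apply: ler_sum => l' _; rewrite normrM ger0_norm ?subr_ge0 // ler_wpM2l ?subr_ge0 //.
  have -> : \sum_l' (P k' l' - tau * u k' * v l') * (C * u l') = C * (r ^+ U - tau) * u k'.
    transitivity (C * (mv P u k' - tau * u k' * dot v u)); last by rewrite Pu uv; ring.
    rewrite /mv /dot mulr_sumr -sumrB mulr_sumr; apply: eq_bigr => l' _; ring.
  by rewrite ler_wpM2r ?(ltW (u0 _)) // ler_wpM2l.
pose el : vec := fun k => (k == l)%:R.
pose z : vec := fun k => el k - v l * u k.
have vz : dot v z = 0 by rewrite dotB dotZ uv dot_deltaE mulr1 subrr.
have zC k' : `|z k'| <= c * u k'.
  rewrite /c -mulrA (le_trans (ler_normB _ _)) //.
  have h1 : 1 <= kap^-1 * u k' by rewrite ler_pdivlMl // mulr1 (u_ge hA).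
  apply: (@le_trans _ _ ((1 + kap^-1) * 1)); last by rewrite ler_wpM2l // addr_ge0 // ltW.
  rewrite mulr1 lerD //; first by rewrite /el; case: eqP; rewrite ?normr1 ?normr0.
  rewrite gtr0_norm ?mulr_gt0 // -[leRHS]mulr1 ler_pM ?(ltW (u0 _)) ?(ltW (v0 _)) ?(v_le hA) //.
  exact: (u_le1 hA).
have iterP i : dot v (mv (P ^+ i) z) = 0 /\ forall k, `|mv (P ^+ i) z k| <= c * th ^+ i * u k.
  elim: i => [|i [IH1 IH2]].
    by split=> [|k']; [rewrite -[RHS]vz; apply: eq_bigr => k' _; rewrite expr0 mv1
                      | rewrite !expr0 mv1 mulr1].
  have E : mv (P ^+ i.+1) z = mv P (mv (P ^+ i) z) by apply/funext => k'; rewrite mvS.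
  rewrite E vP IH1 mulr0; split=> // k'.
  by rewrite exprSr mulrA; apply: contr.
have -> : (A ^+ (U * j)) k l = mv (P ^+ j) z k + v l * (r ^+ (U * j) * u k).
  by rewrite mvB mvZ (mv_eig _ _ Pu) !exprM subrK -/P -[LHS](dot_deltaE l).
have -> : mv (P ^+ j) z k + v l * (r ^+ (U * j) * u k) - u k * v l =
  mv (P ^+ j) z k + u k * v l * (r ^+ (U * j) - 1) by ring.
apply: le_trans (ler_normD _ _) _; rewrite (splitr e) lerD //.
  apply: le_trans ((iterP j).2 k) _; apply: le_trans hj.
  by rewrite ler_piMr ?(u_le1 hA) // (mulr_ge0 c0 (exprn_ge0 _ th0)).
rewrite normrM gtr0_norm ?mulr_gt0 // -[leRHS](mulfK (x := kap)) ?gt_eqF // mulrC.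
rewrite ler_pM ?mulr_ge0 ?(ltW (u0 _)) ?(ltW (v0 _)) //.
by rewrite -[leRHS]mul1r ler_pM ?(ltW (u0 _)) ?(ltW (v0 _)) ?(u_le1 hA) ?(v_le hA).
Qed.

Lemma nrm_const_le x (e : R) : (forall k, `|x k| <= e) -> `|nrm x| <= d%:R * e.
Proof.
move=> xe; rewrite (le_trans (ler_norm_sum _ _ _)) //.
by rewrite mulr_natl -[d in leRHS]card_ord -sumr_const ler_sum.
Qed.

Lemma mv_norm A x (e : R) k : (forall k l, 0 <= A k l <= be) -> (forall l, `|x l| <= e) ->
  `|mv A x k| <= d%:R * (be * e).
Proof.
move=> Ab xe; rewrite (le_trans (ler_norm_sum _ _ _)) //.
rewrite mulr_natl -[d in leRHS]card_ord -sumr_const ler_sum // => l _.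
by have /andP[a b] := Ab k l; rewrite normrM ger0_norm // ler_pM.
Qed.

(** One step multiplies norms by at most d(be + 1) and adds a relative error dl, so over a fixed
    number m of steps the accumulated error stays linear in dl. *)
Lemma almost_iterate A (dl : R) m (z : nat -> vec) : (forall k l, 0 <= A k l <= be) ->
  0 <= dl <= 1 -> (1 <= d)%N -> (forall n k, 0 <= z n k) ->
  (forall n, (n < m)%N -> forall k, `|z n.+1 k - mv A (z n) k| <= dl * nrm (z n)) ->
  forall k, `|z m k - mv (A ^+ m) (z 0%N) k| <= m%:R * (d%:R * (be + 1)) ^+ m * dl * nrm (z 0%N).
Proof.
move=> Ab /andP[dl0 dl1] d1 z0 hz; set G := d%:R * (be + 1).
have dR : (1 : R) <= d%:R by rewrite ler1n.
have G1 : 1 <= G by rewrite -[1]mulr1 ler_pM // lerDr.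
have A0 k l : 0 <= A k l by have /andP[] := Ab k l.
set N0 := nrm (z 0%N); have N00 : 0 <= N0 by exact: nrm_ge0.
have zn n : (n <= m)%N -> nrm (z n) <= G ^+ n * N0.
  elim: n => [|n IH] nm; first by rewrite expr0 mul1r.
  apply: (@le_trans _ _ (G * nrm (z n))); last first.
    by rewrite exprS -mulrA ler_wpM2l ?IH ?(ltnW nm) // (le_trans ler01).
  have h k : `|z n.+1 k| <= (be + 1) * nrm (z n).
    have := hz n nm k; have hd : dl * nrm (z n) <= nrm (z n) by rewrite ler_piMl // nrm_ge0.
    have : `|mv A (z n) k| <= be * nrm (z n).
      rewrite ger0_norm ?mv_ge0 // mulr_sumr ler_sum // => l _.
      by rewrite ler_wpM2r //; have /andP[] := Ab k l.
    have := ler_normD (z n.+1 k - mv A (z n) k) (mv A (z n) k); rewrite subrK.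
    lra.
  by have := nrm_const_le h; rewrite ger0_norm ?nrm_ge0 // /G mulrA.
suff H n : (n <= m)%N -> forall k, `|z n k - mv (A ^+ n) (z 0%N) k| <= n%:R * G ^+ n * dl * N0.
  by apply: H.
elim: n => [|n IH] nm k; first by rewrite expr0 mv1 subrr normr0 !mul0r.
have wn := IH (ltnW nm); pose w : vec := fun k => z n k - mv (A ^+ n) (z 0%N) k.
have -> : z n.+1 k - mv (A ^+ n.+1) (z 0%N) k = (z n.+1 k - mv A (z n) k) + mv A w k.
  by rewrite mvB mvS; ring.
apply: le_trans (ler_normD _ _) _.
have h1 := hz n nm k.
have h2 : dl * nrm (z n) <= G ^+ n.+1 * dl * N0.
  rewrite [G ^+ _ * _]mulrC -mulrA ler_wpM2l // (le_trans (zn n (ltnW nm))) //.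
  by rewrite ler_wpM2r // ler_weXn2l.
have h3 : `|mv A w k| <= _ := mv_norm k Ab wn.
have h4 : d%:R * (be * (n%:R * G ^+ n * dl * N0)) <= n%:R * G ^+ n.+1 * dl * N0.
  have -> : n%:R * G ^+ n.+1 * dl * N0 = G * (n%:R * G ^+ n * dl * N0) by rewrite exprS; ring.
  rewrite mulrA ler_wpM2r ?mulr_ge0 ?exprn_ge0 ?(le_trans ler01 G1) //.
  by rewrite /G ler_wpM2l // lerDl.
have -> : n.+1%:R * G ^+ n.+1 * dl * N0 = n%:R * G ^+ n.+1 * dl * N0 + G ^+ n.+1 * dl * N0.
  by rewrite -natr1; ring.
lra.
Qed.

(** Combines [decay] with [almost_iterate]. The number m of steps depends only on e and the class,
    so alignment at time m needs no information on [z 0]. The lemma is applied to nonlinear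
    iterations and, with constant sequences, to approximate eigenvectors. *)
Lemma direction (e : R) : (1 <= d)%N -> 0 < e -> exists m, exists2 dl : R, 0 < dl &
  forall A r u v, primitive_class A r u v -> `|r - 1| <= dl ->
  forall z : nat -> vec, (forall n k, 0 <= z n k) ->
  (forall n, (n < m)%N -> forall k, `|z n.+1 k - mv A (z n) k| <= dl * nrm (z n)) ->
  forall k, `|z m k - dot v (z m) * u k| <= e * dot v (z m).
Proof.
move=> d1 e0; have k0 := kap_gt0.
have kV : 0 < kap^-1 by rewrite invr_gt0.
have dR : (0 : R) < d%:R by rewrite ltr0n.
pose a := kap^-1 * kap^-1 * d%:R.
have a0 : 0 < a by rewrite !mulr_gt0.
(* The first bound yields S <= 2 v.(z m), so that errors relative to the initial coordinate become
   errors relative to the final one; the second makes their total at most e. *)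
pose et := Num.min (2^-1 / a) (e / (2 * (kap^-1 + a))).
have et0 : 0 < et by rewrite lt_min !divr_gt0 ?mulr_gt0 ?addr_gt0.
have et1 : a * et <= 2^-1 by rewrite mulrC -ler_pdivlMr // ge_min lexx.
have et2 : et * (2 * (kap^-1 + a)) <= e.
  by rewrite -ler_pdivlMr ?mulr_gt0 ?addr_gt0 // ge_min lexx orbT.
have [m [d1' d10 hm]] := decay (divr_gt0 et0 (ltr0n R 2)).
pose G := m%:R * (d%:R * (be + 1)) ^+ m.
have G0 : 0 <= G by rewrite mulr_ge0 ?exprn_ge0 ?mulr_ge0 ?addr_ge0.
pose dl := Num.min (Num.min 1 d1') (et / 2 / (G + 1)).
have dl0 : 0 < dl by rewrite !lt_min ltr01 d10 !divr_gt0 // ltr_wpDl.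
have dl1 : dl <= 1 by rewrite !ge_min lexx.
have dld : dl <= d1' by rewrite !ge_min lexx orbT.
have Gdl : G * dl <= et / 2.
  apply: (@le_trans _ _ ((G + 1) * dl)); first by rewrite ler_wpM2r ?(ltW dl0) // lerDl.
  by rewrite mulrC -ler_pdivlMr ?ltr_wpDl // ge_min lexx orbT.
exists m, dl => // A r u v hA r1 z z0 hz.
have Ab : forall k l, 0 <= A k l <= be by have [] := hA.
have hit := almost_iterate Ab (introT andP (conj (ltW dl0) dl1)) d1 z0 hz.
have hd := hm A r u v hA (le_trans r1 dld).
have [_ _ [u0 v0 _ _ [u1 uv]] _] := hA.
set N0 := nrm (z 0%N) in hit; set S := dot v (z 0%N).
have N00 : 0 <= N0 by exact: nrm_ge0.
have S0 : 0 <= S by apply: dot_ge0 => // k; exact: ltW.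
have NS : N0 <= kap^-1 * S by exact: (nrm_le_dot hA).
have h1 k : `|mv (A ^+ m) (z 0%N) k - S * u k| <= et / 2 * N0.
  have -> : mv (A ^+ m) (z 0%N) k - S * u k = \sum_l ((A ^+ m) k l - u k * v l) * z 0%N l.
    by rewrite /mv /S /dot mulr_suml -sumrB; apply: eq_bigr => l _; ring.
  rewrite (le_trans (ler_norm_sum _ _ _)) // /N0 /nrm mulr_sumr ler_sum // => l _.
  by rewrite normrM [`|z _ _|]ger0_norm // ler_wpM2r.
have h2 k : `|z m k - S * u k| <= et * N0.
  have -> : z m k - S * u k = (z m k - mv (A ^+ m) (z 0%N) k) +
     (mv (A ^+ m) (z 0%N) k - S * u k) by ring.
  rewrite (le_trans (ler_normD _ _)) // (splitr et) mulrDl lerD //.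
  by rewrite (le_trans (hit k)) // ler_wpM2r.
have h3 : `|dot v (z m) - S| <= a * et * S.
  have -> : dot v (z m) - S = dot v (fun k => z m k - S * u k) by rewrite dotB dotZ uv mulr1.
  apply: le_trans (norm_dot_le hA h2) _.
  have -> : a * et * S = kap^-1 * d%:R * (et * (kap^-1 * S)) by rewrite /a; ring.
  by rewrite !ler_wpM2l ?mulr_ge0 ?(ltW kV) ?(ltW et0).
have h4 : S <= 2 * dot v (z m).
  have : a * et * S <= 2^-1 * S by rewrite ler_wpM2r.
  by move: h3; rewrite ler_norml => /andP[]; lra.
move=> k.
have -> : z m k - dot v (z m) * u k = (z m k - S * u k) - (dot v (z m) - S) * u k by ring.
apply: le_trans (ler_normB _ _) _.
have h5 : `|(dot v (z m) - S) * u k| <= a * et * S.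
  by rewrite normrM (gtr0_norm (u0 k)) -[leRHS]mulr1 ler_pM ?(ltW (u0 k)) // (u_le1 hA).
have h6 : et * N0 <= et * kap^-1 * S by rewrite -mulrA ler_wpM2l ?(ltW et0).
have h7 : et * (kap^-1 + a) * S <= et * (kap^-1 + a) * (2 * dot v (z m)).
  by rewrite ler_wpM2l // mulr_ge0 ?addr_ge0 ?ltW.
have h8 : et * (2 * (kap^-1 + a)) * dot v (z m) <= e * dot v (z m).
  by rewrite ler_wpM2r //; lra.
have := h2 k; lra.
Qed.

End UniformPerron.

(** * Extinction defects and fixed points near criticality *)

Section NearCritical.
Variables (R : realType) (d : nat) (a b c : R) (U : nat).
Hypotheses (d1 : (1 <= d)%N) (a0 : 0 < a) (b0 : 0 < b) (c0 : 0 < c) (U1 : (1 <= U)%N).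
Local Notation vec := ('I_d -> R).
Implicit Types (p : offspring R d) (x y z s q u v : vec) (n m : nat) (k l : 'I_d) (e : R).
Local Notation K3 := (remainder_const c).
Local Notation inK := (inK a b c U).
Local Notation kap := (kap U a).

Definition one : vec := fun=> 1.
Definition defect s : vec := fun k => 1 - s k.

Let k0 : 0 < kap. Proof. exact: kap_gt0. Qed.
Let kV : 0 < kap^-1. Proof. by rewrite invr_gt0. Qed.
Let dR : 1 <= d%:R :> R. Proof. by rewrite ler1n. Qed.
Let K30 : 1 <= K3. Proof. by rewrite /remainder_const; have := c0; lra. Qed.

Lemma cube_one : cube one. Proof. exact: cube1. Qed.

Lemma Mmat_primitive p : inK p -> `|rho p - 1| <= 2^-1 ->
  primitive_class U a K3 (Mmat p) (rho p) (uvec p) (vvec p).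
Proof.
move=> hK r1; have [hp [hU _]] := hK; split=> //.
- by move=> k l; have [] := pex_dmon hp hK k l cube_one.
- apply: perron_root_neq0; move: r1; rewrite -/(rho p); apply: contraTneq => ->.
  by rewrite sub0r normrN normr1 -ltNge; lra.
- by move: r1; rewrite ler_norml => /andP[_]; lra.
Qed.

(** Almost excessive vectors: the inequality is iterated with the monotonicity of A, the error
    growing by a fixed factor at each of the n steps. *)
Lemma sub_iterate (A : 'M[R]_d) (be e : R) x n k : (forall k l, 0 <= A k l <= be) -> 0 <= be -> 0 <= e ->
  (forall k, mv A x k <= x k + e) ->
  mv (A ^+ n) x k <= x k + n%:R * (d%:R * (be + 1)) ^+ n * e.
Proof.
move=> Ab be0 e0 h; set G := d%:R * (be + 1).
have G1 : 1 <= G by rewrite -[1]mulr1 ler_pM // lerDr.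
have A0 k' l : 0 <= A k' l by have /andP[] := Ab k' l.
elim: n k => [|n IH] k; first by rewrite expr0 mv1 !mul0r addr0.
set w := n%:R * G ^+ n * e in IH.
have w0 : 0 <= w by rewrite !mulr_ge0 ?exprn_ge0 ?(le_trans ler01 G1).
rewrite mvS; apply: le_trans (mv_le k A0 IH) _.
rewrite mvD.
have h1 : mv A (fun=> w) k <= d%:R * (be * w).
  have wn l : `|w| <= w by rewrite ger0_norm.
  by have := mv_norm k Ab wn; apply: le_trans; rewrite ler_norm.
have h2 : d%:R * (be * w) + e <= n.+1%:R * G ^+ n.+1 * e.
  have -> : n.+1%:R * G ^+ n.+1 * e = G * w + G ^+ n.+1 * e by rewrite /w -natr1 exprS; ring.
  rewrite lerD //; last by rewrite ler_peMl // exprn_ege1.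
  by rewrite mulrA ler_wpM2r // /G ler_wpM2l // lerDl.
have := h k; lra.
Qed.

Section FixedLaw.
Variables (p : offspring R d) (s : vec).
Hypotheses (hK : inK p) (r1 : `|rho p - 1| <= 2^-1) (cs : cube s).
Let hp : is_offspring p. Proof. by have [] := hK. Qed.
Let hM : primitive_class U a K3 (Mmat p) (rho p) (uvec p) (vvec p). Proof. exact: Mmat_primitive. Qed.
Let v := vvec p.
Let u := uvec p.
Let M := Mmat p.
Let v0 k : 0 < v k. Proof. by have [_ _ [_ ? _ _ _] _] := hM. Qed.
Let Mb k l : 0 <= M k l <= K3. Proof. by have [] := hM. Qed.

Definition xn n : vec := defect (hn p n s).

Lemma defect_cube y : cube y -> cube (defect y).
Proof. by move=> cy k; have /andP[? ?] := cy k; rewrite /defect; apply/andP; split; lra. Qed.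

Lemma defectK y : defect (defect y) = y.
Proof. by apply/funext => k; rewrite /defect; ring. Qed.

Lemma pgf_one k : pgf p k one = 1.
Proof.
have [h _] := hsum_pgf hp k cube_one; apply: hsum_uniq h _.
by apply: hsum_eq (hsum_p hp k) => i; rewrite mon1 mulr1.
Qed.

(* convexity defect of the generating function at the fixed point [one] *)
Definition phi x k : R := mv M x k - (1 - pgf p k (defect x)).

(** The derivative of [phi] at x is M(1) - M(1 - x), which is nonnegative; the tangent bound
    [pgf_concave] gives the integrated statement. *)
Lemma phi_mono x y k : cube x -> cube y -> (forall l, x l <= y l) -> phi x k <= phi y k.
Proof.
move=> cx cy xy.
have q0 l : 0 <= y l - x l by rewrite subr_ge0.
have qy l : y l - x l <= defect x l by have /andP[_] := cy l; rewrite /defect; lra.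
have := pgf_concave hp hK k (defect_cube cx) q0 qy.
have -> : (fun l => defect x l - (y l - x l)) = defect y by apply/funext => l; rewrite /defect; ring.
have : Mv p (defect x) (fun l => y l - x l) k <= mv M (fun l => y l - x l) k.
  apply: ler_sum => l _; rewrite ler_wpM2r //.
  have := @Ms_mono _ _ p hp _ _ _ _ hK one x k cube_one _ _ l.
  apply; first by move=> l'; have /andP[] := cx l'.
  by move=> l'; have /andP[] := cx l'.
rewrite mvB /phi; lra.
Qed.

Lemma phi_ge0 x k : cube x -> 0 <= phi x k.
Proof.
move=> cx; rewrite -[0](_ : phi (fun=> 0) k = 0).
  by apply: phi_mono => // l; [rewrite lexx ler01|have /andP[] := cx l].
rewrite /phi /mv big1 ?sub0r; last by move=> l _; rewrite mulr0.
have -> : defect (fun=> 0) = one by apply/funext => l; rewrite /defect subr0.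
by rewrite pgf_one subrr oppr0.
Qed.

Lemma phi_quad x k : cube x -> 2^-1 * Bq p x x k - K3 * nrm x ^+ 3 <= phi x k.
Proof.
move=> cx.
have x0 l : 0 <= x l by have /andP[] := cx l.
have x1 l : x l <= one l by have /andP[] := cx l.
have := pgf_taylor hp hK k cube_one x0 x1.
have -> : (fun l => one l - x l) = defect x by [].
have -> : nrm (fun l => 1 - defect x l) = nrm x by apply: eq_bigr => l _; rewrite /defect; ring.
rewrite pgf_one ler_norml => /andP[_].
rewrite /phi; have -> : Mv p one x k = mv M x k by [].
have -> : K3 * nrm x * nrm x ^+ 2 = K3 * nrm x ^+ 3 by ring.
lra.
Qed.

Lemma xn_cube n : cube (xn n).
Proof. by apply: defect_cube; exact: hn_cube. Qed.

Lemma xn_anti n m k : (n <= m)%N -> xn m k <= xn n k.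
Proof.
move=> /subnK <-; elim: (m - n)%N => [|j IH] //; apply: le_trans IH.
by rewrite /xn /defect lerD2l lerN2; exact: hn_leS.
Qed.

Lemma xn_step n k : xn n.+1 k = defect s k * pgf p k (hn p n s) + mv M (xn n) k - phi (xn n) k.
Proof. by rewrite /phi /xn defectK /defect /=; ring. Qed.

Lemma dot_vM x : dot v (mv M x) = rho p * dot v x.
Proof.
have [_ _ [_ _ _ vM _] _] := hM.
by rewrite dot_mv (_ : vm v M = fun k => rho p * v k) ?dotZl //; apply/funext.
Qed.

(** The smallness parameter: distance from criticality, distance of s from 1, and the 1/n produced
    by averaging over n generations. *)
Definition eta n : R := `|rho p - 1| + nrm (defect s) + n%:R^-1.

Let defect_ge0 k : 0 <= defect s k.
Proof. by have /andP[] := defect_cube cs k. Qed.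

(** Pairing [xn_step] with v and summing over n steps telescopes, so the sum of v.phi(x_i) is at
    most v.x_0 plus n small errors. As x_i decreases and [phi] is monotone, the last term is at most
    the average. *)
Lemma dot_phi n : (0 < n)%N -> dot v (phi (xn n)) <= kap^-1 * d%:R * eta n.
Proof.
move=> n0; pose D := kap^-1 * d%:R * (`|rho p - 1| + nrm (defect s)).
have T m : dot v (xn m) + \sum_(i < m) dot v (phi (xn i)) <= dot v (xn 0%N) + m%:R * D.
  elim: m => [|m IH]; first by rewrite big_ord0 mul0r.
  rewrite big_ord_recr /=.
  have -> : dot v (xn m.+1) = dot v (fun k => defect s k * pgf p k (hn p m s)) +
      rho p * dot v (xn m) - dot v (phi (xn m)).
    by rewrite -dot_vM -dotD -dotB; apply: eq_bigr => k _; rewrite xn_step.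
  have h1 : dot v (fun k => defect s k * pgf p k (hn p m s)) <= kap^-1 * d%:R * nrm (defect s).
    apply: (@le_trans _ _ (dot v (defect s))).
      apply: dot_le => [k|k]; first exact: ltW.
      by rewrite ler_piMr // pgf_le1 //; exact: hn_cube.
    apply: le_trans (dot_le_nrm a0 hM defect_ge0) _.
    by rewrite ler_wpM2r ?nrm_ge0 // ler_peMr // ltW.
  have x0 k : 0 <= xn m k by have /andP[] := xn_cube m k.
  have x1 k : xn m k <= 1 by have /andP[] := xn_cube m k.
  have h2 : (rho p - 1) * dot v (xn m) <= kap^-1 * d%:R * `|rho p - 1|.
    apply: (@le_trans _ _ (`|rho p - 1| * dot v (xn m))).
      by rewrite ler_wpM2r ?ler_norm // dot_ge0 // => k; exact: ltW.
    rewrite mulrC ler_wpM2r //; apply: le_trans (dot_le_nrm a0 hM x0) _.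
    rewrite ler_wpM2l ?(ltW kV) // -[leRHS]mulr1.
    have := @nrm_const_le R d (xn m) 1; rewrite ger0_norm ?nrm_ge0 //; apply => k.
    by rewrite ger0_norm.
  move: IH; rewrite /D -[m.+1%:R]natr1; lra.
have mono : n%:R * dot v (phi (xn n)) <= \sum_(i < n) dot v (phi (xn i)).
  have -> : n%:R * dot v (phi (xn n)) = \sum_(i < n) dot v (phi (xn n)).
    by rewrite sumr_const card_ord mulr_natl.
  apply: ler_sum => i _; apply: dot_le => k; first exact: ltW.
  apply: phi_mono => [||l]; [exact: xn_cube | exact: xn_cube |].
  by apply: xn_anti; exact: (ltnW (ltn_ord i)).
have x00 : dot v (xn 0%N) <= kap^-1 * d%:R.
  have := dot_le_nrm a0 hM (x := xn 0%N).
  have -> : nrm (xn 0%N) = d%:R.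
    rewrite /nrm -[d in RHS]card_ord -[RHS]mulr1 -sumr_const mulr_suml.
    by apply: eq_bigr => k _; rewrite /xn /defect /= subr0 mulr1.
  by apply=> k; have /andP[] := xn_cube 0%N k.
have xn0 : 0 <= dot v (xn n).
  by apply: dot_ge0 => k; [exact: ltW | have /andP[] := xn_cube n k].
have nR : (0 : R) < n%:R by rewrite ltr0n.
rewrite -(ler_pM2l nR) /eta mulrDr mulrDr.
have -> : n%:R * (kap^-1 * d%:R / n%:R) = kap^-1 * d%:R by field; rewrite !gt_eqF.
have := T n; rewrite /D; lra.
Qed.

Let x0 n k : 0 <= xn n k. Proof. by have /andP[] := xn_cube n k. Qed.
Let x1 n k : xn n k <= 1. Proof. by have /andP[] := xn_cube n k. Qed.

Lemma eta_ge0 n : 0 <= eta n.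
Proof. by rewrite /eta !addr_ge0 ?nrm_ge0 ?invr_ge0. Qed.

Let C2 := kap^-1 * (kap^-1 * d%:R).
Let C3 := U%:R * (d%:R * (K3 + 1)) ^+ U * C2.

Lemma phi_xn_le n k : (0 < n)%N -> phi (xn n) k <= C2 * eta n.
Proof.
move=> n0; have p0 l : 0 <= phi (xn n) l by exact: phi_ge0 (xn_cube n).
apply: le_trans (nrm_ge k p0) _; apply: le_trans (nrm_le_dot a0 hM p0) _.
by rewrite -mulrA ler_wpM2l ?(ltW kV) // dot_phi.
Qed.

(** Since x_n decreases, M x_n <= x_n + phi(x_n), and phi(x_n) is of order [eta]. Iterating U times
    and using M^U >= a spreads the norm of x_n over all coordinates. *)
Lemma xn_lower n k : (0 < n)%N -> a * nrm (xn n) - C3 * eta n <= xn n k.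
Proof.
move=> n0; have K30' : 0 <= K3 by apply: le_trans K30.
have C20 : 0 <= C2 by rewrite !mulr_ge0 ?(ltW kV).
have h l : mv M (xn n) l <= xn n l + C2 * eta n.
  have := phi_xn_le l n0; have := xn_anti l (leqnSn n); rewrite xn_step.
  have : 0 <= defect s l * pgf p l (hn p n s) by rewrite mulr_ge0 ?pgf_ge0 //; exact: hn_cube.
  lra.
have := sub_iterate U k Mb K30' (mulr_ge0 C20 (eta_ge0 n)) h.
have : a * nrm (xn n) <= mv (M ^+ U) (xn n) k.
  rewrite mulr_sumr ler_sum // => l _; rewrite ler_wpM2r //.
  by have [_ [hU _]] := hK; exact: hU.
rewrite /C3 -!mulrA; lra.
Qed.

(** Scale at which the quadratic part of [phi] beats its cubic remainder: applied to tau x with x of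
    norm at most d, the remainder is at most half of the quadratic lower bound. *)
Definition tau : R := Num.min 1 (b * a ^+ 2 / (16 * d%:R ^+ 2 * K3)).
Definition Csmall : R := 2 * d%:R * C3 / a + 16 * d%:R * C2 / (tau ^+ 2 * b * a ^+ 2).

Lemma Bq_ge x e : 0 <= e -> (forall k, e <= x k) -> b * e ^+ 2 <= \sum_k Bq p x x k.
Proof.
move=> e0 xe; apply: le_trans (ler_wpM2r (sqr_ge0 e) (hess_sum hp hK)) _.
rewrite mulr_suml ler_sum // => k _; rewrite mulr_suml ler_sum // => l _.
rewrite mulr_suml ler_sum // => m _; rewrite expr2 mulrA.
have [_ /andP[h0 _]] := pex_fac2 hp hK k l m.
by rewrite ler_pM ?mulr_ge0 // ler_wpM2l.
Qed.

Lemma tau_gt0 : 0 < tau.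
Proof.
have K3p := lt_le_trans ltr01 K30; have dp := lt_le_trans ltr01 dR.
by rewrite lt_min ltr01 divr_gt0 ?mulr_gt0 ?exprn_gt0.
Qed.

(** Either the norm is already of order [eta], or by [xn_lower] all coordinates are comparable to
    it. In the second case phi(tau x_n) <= phi(x_n) = O(eta), while the Hessian mass b makes phi(tau
    x_n) at least quadratic in the norm. The two summands of [Csmall] serve the two cases. *)
Lemma small_xn n : (0 < n)%N -> nrm (xn n) ^+ 2 <= Csmall * eta n.
Proof.
move=> n0; set X := nrm (xn n); have e0 := eta_ge0 n.
have X0 : 0 <= X by exact: nrm_ge0.
have Xd : X <= d%:R.
  have := @nrm_const_le R d (xn n) 1; rewrite ger0_norm // mulr1; apply => k.
  by rewrite ger0_norm.
have dp : 0 < d%:R :> R by apply: lt_le_trans dR.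
have K3p : 0 < K3 by apply: lt_le_trans K30.
have C20 : 0 <= C2 by rewrite !mulr_ge0 ?(ltW kV).
have G0 : 0 <= (d%:R * (K3 + 1)) ^+ U by exact: exprn_ge0 _ (mulr_ge0 (ler0n _ _) (addr_ge0 (ltW K3p) ler01)).
have C30 : 0 <= C3 by exact: mulr_ge0 (mulr_ge0 (ler0n _ U) G0) C20.
have t0 := tau_gt0.
have t1 : tau <= 1 by rewrite ge_min lexx.
have tE : d%:R ^+ 2 * K3 * tau <= b * a ^+ 2 / 16.
  have : tau <= b * a ^+ 2 / (16 * d%:R ^+ 2 * K3) by rewrite ge_min lexx orbT.
  rewrite ler_pdivlMr ?mulr_gt0 ?exprn_gt0 //; lra.
have q1 : 0 <= 16 * d%:R * C2 / (tau ^+ 2 * b * a ^+ 2) by rewrite divr_ge0 ?mulr_ge0 ?exprn_ge0 // ltW.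
have q2 : 0 <= 2 * d%:R * C3 / a by rewrite divr_ge0 ?mulr_ge0 // ltW.
rewrite /Csmall mulrDl.
have [hX|hX] := leP (a * X) (2 * C3 * eta n).
  apply: (@le_trans _ _ (2 * d%:R * C3 / a * eta n)); last by rewrite lerDl mulr_ge0.
  rewrite mulrAC ler_pdivlMr //.
  have : X * (a * X) <= d%:R * (a * X) by rewrite ler_wpM2r // mulr_ge0 // ltW.
  have : d%:R * (a * X) <= d%:R * (2 * C3 * eta n) by rewrite ler_wpM2l // ltW.
  lra.
apply: (@le_trans _ _ (16 * d%:R * C2 / (tau ^+ 2 * b * a ^+ 2) * eta n)); last first.
  by rewrite lerDr mulr_ge0.
have xk k : a * X / 2 <= xn n k by have := xn_lower k n0; rewrite -/X; lra.
have ct : cube (fun l => tau * xn n l).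
  by move=> l; rewrite mulr_ge0 ?(ltW t0) //= mulr_ile1 // ltW.
have h1 k : 2^-1 * Bq p (fun l => tau * xn n l) (fun l => tau * xn n l) k
     - K3 * (tau * X) ^+ 3 <= C2 * eta n.
  have -> : tau * X = nrm (fun l => tau * xn n l) by rewrite /X /nrm mulr_sumr.
  apply: le_trans (phi_quad k ct) _; apply: le_trans (phi_xn_le k n0).
  apply: phi_mono => // [|l]; first exact: xn_cube.
  by rewrite ler_piMl.
have h2 : \sum_k (2^-1 * Bq p (fun l => tau * xn n l) (fun l => tau * xn n l) k
     - K3 * (tau * X) ^+ 3) <= d%:R * (C2 * eta n).
  by rewrite mulr_natl -[d in leRHS]card_ord -sumr_const ler_sum.
rewrite sumrB -mulr_sumr sumr_const card_ord -[_ *+ d]mulr_natl in h2.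
have h3 : b * (tau * (a * X / 2)) ^+ 2 <=
   \sum_k Bq p (fun l => tau * xn n l) (fun l => tau * xn n l) k.
  apply: Bq_ge => [|k]; first by rewrite !mulr_ge0 // ltW.
  by rewrite ler_wpM2l // ltW.
rewrite mulrAC ler_pdivlMr ?mulr_gt0 ?exprn_gt0 //.
have h4 : d%:R * (K3 * (tau * X) ^+ 3) <= (tau ^+ 2 * X ^+ 2) * (b * a ^+ 2 / 16).
  apply: (@le_trans _ _ ((tau ^+ 2 * X ^+ 2) * (d%:R ^+ 2 * K3 * tau))); last first.
    by rewrite ler_wpM2l // mulr_ge0 ?exprn_ge0 // ltW.
  have -> : d%:R * (K3 * (tau * X) ^+ 3) = (tau ^+ 2 * X ^+ 2) * (d%:R * K3 * tau) * X by ring.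
  have -> : (tau ^+ 2 * X ^+ 2) * (d%:R ^+ 2 * K3 * tau) =
    (tau ^+ 2 * X ^+ 2) * (d%:R * K3 * tau) * d%:R by ring.
  by rewrite ler_wpM2l // !mulr_ge0 ?exprn_ge0 // ltW.
lra.
Qed.

End FixedLaw.
End NearCritical.

Lemma cvg_sumr (R : realType) (T : Type) (F : set_system T) {FF : Filter F} (I : finType)
    (f : I -> T -> R) (l : I -> R) : (forall i, f i @ F --> l i) ->
  (fun x => \sum_i f i x) @ F --> \sum_i l i.
Proof.
move=> h; elim: (index_enum I) => [|i r IH].
  by rewrite big_nil; under eq_fun do rewrite big_nil; exact: cvg_cst.
by rewrite big_cons; under eq_fun do rewrite big_cons; exact: cvgD.
Qed.

Lemma sum_const_ord (R : realType) (d : nat) (x : R) : \sum_(l < d) x = d%:R * x.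
Proof. by rewrite sumr_const card_ord mulr_natl. Qed.

(** * The minimal fixed point of h = s f(h) *)

Section FixedPoints.
Variables (R : realType) (d : nat) (p : offspring R d).
Hypothesis hp : is_offspring p.
Local Notation vec := ('I_d -> R).
Implicit Types (s t y : vec) (n : nat) (k l : 'I_d).

Lemma hn_mono_n n m s k : cube s -> (n <= m)%N -> hn p n s k <= hn p m s k.
Proof.
move=> cs /subnK <-; elim: (m - n)%N => [|j IH] //; apply: le_trans IH _.
exact: hn_leS.
Qed.

Lemma hn_mono_s n s t k : cube s -> cube t -> (forall l, s l <= t l) -> hn p n s k <= hn p n t k.
Proof.
move=> cs ct st; elim: n k => [|n IH] k //=.
have /andP[s0 _] := cs k.
have hs := hn_cube hp n cs; have ht := hn_cube hp n ct.
by rewrite ler_pM ?pgf_ge0 ?st // pgf_mono.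
Qed.

Lemma hn_cvg s k : cube s -> (fun n => hn p n s k) @ \oo --> hstar p s k.
Proof.
move=> cs; apply: nondecreasing_is_cvgn.
  by move=> n m nm; exact: hn_mono_n.
by exists 1 => _ [n _ <-]; have /andP[] := hn_cube hp n cs k.
Qed.

Lemma hn_le_hstar n s k : cube s -> hn p n s k <= hstar p s k.
Proof.
move=> cs; apply: (cvgr_to_ge (hn_cvg cs)); near=> m.
by apply: hn_mono_n => //; near: m; exact: nbhs_infty_ge.
Unshelve. all: by end_near. Qed.

Lemma hstar_cube s : cube s -> cube (hstar p s).
Proof.
move=> cs k; rewrite (le_trans _ (hn_le_hstar 0%N k cs)) //=.
by apply: (cvgr_to_le (hn_cvg cs)); near=> m; have /andP[] := hn_cube hp m cs k.
Unshelve. all: by end_near. Qed.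

Lemma hstar_mono s t k : cube s -> cube t -> (forall l, s l <= t l) -> hstar p s k <= hstar p t k.
Proof.
move=> cs ct st; apply: ler_cvg_to (hn_cvg cs) (hn_cvg ct) _.
by near=> n; exact: hn_mono_s.
Unshelve. all: by end_near. Qed.

Variables (a b c : R) (U : nat).
Hypothesis hK : inK a b c U p.

Lemma hstar_gap s k : cube s ->
  (fun n => hstar p s k - hn p n s k) @ \oo --> (0 : R).
Proof.
move=> cs; rewrite -(subrr (hstar p s k)); apply: cvgB (hn_cvg cs); exact: cvg_cst.
Qed.

(** One inequality is monotonicity. For the other, the tangent bound [pgf_concave] at the limit
    point compares f there with f(h_n) up to a linear term tending to 0, in place of a continuity
    statement for the series. *)
Lemma hstar_fix s k : cube s -> hstar p s k = s k * pgf p k (hstar p s).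
Proof.
move=> cs; have ch := hstar_cube cs; have /andP[s0 s1] := cs k.
apply/eqP; rewrite eq_le; apply/andP; split.
  apply: (cvgr_to_le (hn_cvg (k := k) cs)); near=> n.
  have n0 : (0 < n)%N by near: n; exact: nbhs_infty_ge.
  rewrite -(prednK n0) /= ler_wpM2l // pgf_mono //; first exact: hn_cube.
  by move=> l; exact: hn_le_hstar.
pose g n := \sum_l Ms p (hstar p s) k l * (hstar p s l - hn p n s l).
have g0 : g @ \oo --> (0 : R).
  have -> : (0 : R) = \sum_l Ms p (hstar p s) k l * 0 by rewrite big1 // => l _; rewrite mulr0.
  apply: cvg_sumr => l; apply: cvgM; [exact: cvg_cst | exact: hstar_gap].
rewrite -subr_le0; apply: (cvgr_to_ge g0); near=> n.
apply: le_trans (pgf_concave (q := fun l => hstar p s l - hn p n s l) hp hK k ch _ _); last 2 first.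
- by move=> l; rewrite subr_ge0 hn_le_hstar.
- by move=> l; have /andP[h _] := hn_cube hp n cs l; lra.
have -> : (fun l => hstar p s l - (hstar p s l - hn p n s l)) = hn p n s.
  by apply/funext => l; rewrite subKr.
have h1 : s k * pgf p k (hn p n s) <= hstar p s k by exact: (hn_le_hstar n.+1).
have f1 := pgf_ge0 hp k ch; have f0 := pgf_ge0 hp k (hn_cube hp n cs).
have f01 : pgf p k (hn p n s) <= pgf p k (hstar p s).
  by apply: pgf_mono => //; [exact: hn_cube | move=> l; exact: hn_le_hstar].
have : s k * (pgf p k (hstar p s) - pgf p k (hn p n s)) <= pgf p k (hstar p s) - pgf p k (hn p n s).
  by rewrite ler_piMl // subr_ge0.
lra.
Unshelve. all: by end_near. Qed.

End FixedPoints.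

(** * Quantitative linearization near the point 1 *)

Section Estimates.
Variables (R : realType) (d : nat) (p : offspring R d) (a b c : R) (U : nat).
Hypotheses (hK : inK a b c U p) (c0 : 0 < c).
Local Notation vec := ('I_d -> R).
Local Notation K3 := (remainder_const c).
Implicit Types (s t x y z q w : vec) (n : nat) (k l m : 'I_d) (e : R).
Let hp : is_offspring p. Proof. by have [] := hK. Qed.
Let K30 : 1 <= K3. Proof. by rewrite /remainder_const; have := c0; lra. Qed.
Let K30' : 0 <= K3. Proof. exact: le_trans K30. Qed.
Let dR : 0 <= d%:R :> R. Proof. exact: ler0n. Qed.

Lemma nrm_le_d x : (forall k, 0 <= x k <= 1) -> nrm x <= d%:R.
Proof.
move=> hx; have x0 k : 0 <= x k by have /andP[] := hx k.
have := @nrm_const_le R d x 1; rewrite ger0_norm ?nrm_ge0 // mulr1; apply => k.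
by rewrite ger0_norm //; have /andP[] := hx k.
Qed.

Lemma Bq_bound x z (X Z : R) k : (forall k, `|x k| <= X) -> (forall k, `|z k| <= Z) ->
  `|Bq p x z k| <= d%:R ^+ 2 * K3 * (X * Z).
Proof.
move=> hx hz.
have -> : d%:R ^+ 2 * K3 * (X * Z) = \sum_(l < d) \sum_(m < d) K3 * (X * Z).
  by rewrite !sum_const_ord; ring.
rewrite (le_trans (ler_norm_sum _ _ _)) // ler_sum // => l _.
rewrite (le_trans (ler_norm_sum _ _ _)) // ler_sum // => m _.
have [_ /andP[h0 h1]] := pex_fac2 hp hK k l m.
by rewrite -mulrA normrM (ger0_norm h0) ler_pM // normrM ler_pM.
Qed.

Definition hess_form w x z : R := dot w (Bq p x z).

(** The form is trilinear, so its arguments are replaced one at a time. Errors in x and z are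
    relative to the scales X and Z, as alignment provides them. *)
Lemma T3_close w w' x x' z z' (e W X Z : R) :
  0 <= e -> (forall k, `|w k - w' k| <= e) -> (forall k, `|w' k| <= W) ->
  (forall k, `|x k - x' k| <= e * X) -> (forall k, `|x k| <= 2 * X) -> (forall k, `|x' k| <= 2 * X) ->
  (forall k, `|z k - z' k| <= e * Z) -> (forall k, `|z k| <= 2 * Z) ->
  `|hess_form w x z - hess_form w' x' z'| <= d%:R ^+ 3 * K3 * (4 + 4 * W) * (e * (X * Z)).
Proof.
move=> e0 hw hW hx hX hX' hz hZ.
have -> : d%:R ^+ 3 * K3 * (4 + 4 * W) * (e * (X * Z)) =
   \sum_(k < d) d%:R ^+ 2 * K3 * ((4 + 4 * W) * (e * (X * Z))).
  by rewrite sum_const_ord; ring.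
rewrite /hess_form /dot -sumrB (le_trans (ler_norm_sum _ _ _)) // ler_sum // => k _.
have -> : w k * Bq p x z k - w' k * Bq p x' z' k = (w k - w' k) * Bq p x z k
   + w' k * (Bq p (fun l => x l - x' l) z k + Bq p x' (fun l => z l - z' l) k).
  have -> : Bq p (fun l => x l - x' l) z k = Bq p x z k - Bq p x' z k.
    rewrite /Bq -sumrB; apply: eq_bigr => l _; rewrite -sumrB; apply: eq_bigr => m _; ring.
  have -> : Bq p x' (fun l => z l - z' l) k = Bq p x' z k - Bq p x' z' k.
    rewrite /Bq -sumrB; apply: eq_bigr => l _; rewrite -sumrB; apply: eq_bigr => m _; ring.
  by ring.
have b1 := Bq_bound k hX hZ.
have b2 := Bq_bound k hx hZ.
have b3 := Bq_bound k hX' hz.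
have D0 : 0 <= d%:R ^+ 2 * K3 by rewrite mulr_ge0 ?exprn_ge0.
rewrite (le_trans (ler_normD _ _)) // !normrM.
have h1 := ler_pM (normr_ge0 _) (normr_ge0 _) (hw k) b1.
have h2 := ler_pM (normr_ge0 _) (normr_ge0 _) (hW k)
   (le_trans (ler_normD _ _) (lerD b2 b3)).
apply: le_trans (lerD h1 h2) _.
by rewrite le_eqVlt; apply/orP; left; apply/eqP; ring.
Qed.

Section Pair.
Variables (y q : vec).
Hypotheses (cy : cube y) (q0 : forall l, 0 <= q l) (qy : forall l, q l <= y l).
Local Notation h := (fun l => y l - q l).
Local Notation w := (nrm (defect h)).

Lemma defect_nrm_ge0 : 0 <= w.
Proof.
apply: nrm_ge0 => l; rewrite /defect; have /andP[_] := cy l; have := q0 l; lra.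
Qed.

Lemma nrm_q_le : nrm q <= w.
Proof. by apply: ler_sum => l _; rewrite /defect; have /andP[_] := cy l; lra. Qed.

Lemma defect_y_le : nrm (defect y) <= w.
Proof. by apply: ler_sum => l _; rewrite /defect; have := q0 l; lra. Qed.

Lemma defect_le_d : w <= d%:R.
Proof.
apply: nrm_le_d => l; rewrite /defect; have /andP[_] := cy l; have := q0 l; have := qy l.
by move=> *; apply/andP; split; lra.
Qed.

Let Q0 : 0 <= nrm q. Proof. exact: nrm_ge0. Qed.
Let qn l : `|q l| <= nrm q. Proof. by rewrite ger0_norm // nrm_ge. Qed.

Lemma Mv_le k : Mv p y q k <= K3 * nrm q.
Proof.
rewrite mulr_sumr ler_sum // => l _.
by have [_ /andP[_ ?]] := pex_dmon hp hK k l cy; rewrite ler_wpM2r.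
Qed.

Lemma pgf_taylor1 k : `|pgf p k y - pgf p k h - Mv p y q k| <= K3 * (d%:R ^+ 2 + d%:R) * w * nrm q.
Proof.
have h1 := pgf_taylor hp hK k cy q0 qy.
have h2 := Bq_bound k qn qn.
have h3 := nrm_q_le; have h4 := defect_le_d; have w0 := defect_nrm_ge0.
have h5 : d%:R ^+ 2 * K3 * (nrm q * nrm q) <= d%:R ^+ 2 * K3 * (w * nrm q).
  by rewrite !ler_wpM2l ?mulr_ge0 ?exprn_ge0 // ler_wpM2r.
have h6 : K3 * w * nrm q ^+ 2 <= K3 * w * (d%:R * nrm q).
  by rewrite ler_wpM2l ?mulr_ge0 // expr2 ler_wpM2r // (le_trans h3).
have -> : pgf p k y - pgf p k h - Mv p y q k =
  (pgf p k y - pgf p k h - Mv p y q k + 2^-1 * Bq p q q k) - 2^-1 * Bq p q q k by ring.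
rewrite (le_trans (ler_normB _ _)) // normrM ger0_norm //.
have h1' : `|pgf p k y - pgf p k h - Mv p y q k + 2^-1 * Bq p q q k| <= K3 * w * nrm q ^+ 2 by [].
have : 2^-1 * `|Bq p q q k| <= `|Bq p q q k| by rewrite ler_piMl // invf_le1 // ler1n.
lra.
Qed.
End Pair.

Lemma Ms_close y k l : cube y -> `|Ms p y k l - Mmat p k l| <= K3 * (1 + d%:R) * nrm (defect y).
Proof.
move=> cy; have cdy := defect_cube cy.
have q0 m : 0 <= defect y m by have /andP[] := cdy m.
have q1 m : defect y m <= one R (d:=d) m by have /andP[] := cdy m.
have := Ms_taylor hp hK k (@cube_one R d) q0 q1 l.
have -> : (fun m => one R m - defect y m) = y by apply/funext => m; rewrite /defect /one; ring.
have -> : (fun m => 1 - (one R m - defect y m)) = defect y by apply/funext => m; rewrite /defect /one; ring.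
move=> h1'.
have h1 : `|Mmat p k l - Ms p y k l - \sum_m hess p k l m * defect y m| <=
   K3 * nrm (defect y) * nrm (defect y) by [].
have Q0 : 0 <= nrm (defect y) by exact: nrm_ge0.
have h2 : `|\sum_m hess p k l m * defect y m| <= K3 * nrm (defect y).
  rewrite (le_trans (ler_norm_sum _ _ _)) // mulr_sumr ler_sum // => m _.
  have [_ /andP[g0 g1]] := pex_fac2 hp hK k l m.
  by rewrite normrM (ger0_norm g0) (ger0_norm (q0 m)) ler_wpM2r.
have h3 : K3 * nrm (defect y) * nrm (defect y) <= K3 * d%:R * nrm (defect y).
  by rewrite ler_wpM2r // ler_wpM2l // nrm_le_d.
have -> : Ms p y k l - Mmat p k l = - (\sum_m hess p k l m * defect y m)
  - (Mmat p k l - Ms p y k l - \sum_m hess p k l m * defect y m) by ring.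
rewrite (le_trans (ler_normB _ _)) // normrN.
by lra.
Qed.

Definition C4 : R := K3 * (d%:R ^+ 2 + 2 * d%:R + 2).

(** The relative error vanishes with 1 - s and with the distance of the lower point from 1. This is
    the form in which [direction] accepts the nonlinear iteration. *)
Lemma step_close s y q k : cube s -> cube y -> (forall l, 0 <= q l) -> (forall l, q l <= y l) ->
  `|s k * (pgf p k y - pgf p k (fun l => y l - q l)) - mv (Mmat p) q k| <=
    C4 * (nrm (defect (fun l => y l - q l)) + nrm (defect s)) * nrm q.
Proof.
move=> cs cy q0 qy; set w := nrm (defect _).
have w0 : 0 <= w by exact: defect_nrm_ge0 cy q0.
have Q0 : 0 <= nrm q by exact: nrm_ge0.
have ds0 l : 0 <= defect s l by have /andP[] := defect_cube cs l.
have h1 := pgf_taylor1 cy q0 qy k; rewrite -/w in h1.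
have h2 : `|Mv p y q k - mv (Mmat p) q k| <= K3 * (1 + d%:R) * w * nrm q.
  rewrite /Mv /mv -sumrB (le_trans (ler_norm_sum _ _ _)) // mulr_sumr ler_sum // => l _.
  rewrite -mulrBl normrM (ger0_norm (q0 l)) ler_wpM2r // (le_trans (Ms_close k l cy)) //.
  by apply: ler_wpM2l; [exact: mulr_ge0 K30' (addr_ge0 ler01 dR) | exact: defect_y_le].
set F := pgf p k y - _ in h1 *.
have F0 : 0 <= F.
  rewrite subr_ge0 pgf_mono // => [l|l]; last by have := q0 l; lra.
  by have := q0 l; have := qy l; have /andP[] := cy l => *; apply/andP; split; lra.
have F1 : F <= K3 * nrm q by exact: le_trans (pgf_concave hp hK k cy q0 qy) (Mv_le cy q0 k).
have h3 : `|defect s k * F| <= nrm (defect s) * (K3 * nrm q).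
  by rewrite ger0_norm ?mulr_ge0 // ler_pM // nrm_ge.
have -> : s k * F - mv (Mmat p) q k = (F - Mv p y q k) + (Mv p y q k - mv (Mmat p) q k) - defect s k * F.
  by rewrite /defect; ring.
rewrite (le_trans (ler_normB _ _)) // (le_trans (lerD (ler_normD _ _) (lexx _))) //.
have s0 : 0 <= nrm (defect s) by exact: nrm_ge0.
have e1 : 0 <= K3 * w * nrm q by rewrite !mulr_ge0.
have e2 : 0 <= K3 * d%:R * nrm (defect s) * nrm q by rewrite !mulr_ge0.
have e3 : 0 <= K3 * d%:R ^+ 2 * nrm (defect s) * nrm q by rewrite !mulr_ge0 ?exprn_ge0.
have e4 : 0 <= K3 * nrm (defect s) * nrm q by rewrite !mulr_ge0.
rewrite /C4; lra.
Qed.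

End Estimates.

(** * Perturbation of Perron roots and eigenvectors *)

Section Perturbation.
Variables (R : realType) (d U : nat) (al be : R).
Local Notation vec := ('I_d -> R).
Implicit Types (A M : 'M[R]_d) (x y z u v : vec) (r : R).
Hypotheses (al0 : 0 < al) (be0 : 0 <= be) (d1 : (1 <= d)%N).
Local Notation kap := (kap U al).
Let k0 : 0 < kap. Proof. exact: kap_gt0. Qed.
Let kV : 0 < kap^-1. Proof. by rewrite invr_gt0. Qed.
Let dR : 1 <= d%:R :> R. Proof. by rewrite ler1n. Qed.

Ltac prune := clear -be0 d1 k0 kV dR.

(** Exchanging the two eigenvectors breaks the normalization sum u = 1; rescaling by the norm of v
    restores it without changing u.v = 1. *)
Lemma primitive_class_tr M r u v : primitive_class U al be M r u v ->
  primitive_class U al be M^T r (fun k => v k / nrm v) (fun k => nrm v * u k).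
Proof.
move=> hM; have [Mb MU [u0 v0 Mu vM [u1 uv]] r2] := hM.
have nv : 0 < nrm v.
  have k : 'I_d by case: (d) d1 => // d' _; exact: ord0.
  by apply: lt_le_trans (v0 k) _; apply: nrm_ge => l; exact: ltW.
split=> //.
- by move=> k l; rewrite mxE.
- by move=> k l; rewrite trmx_exp mxE.
- split.
  + by move=> k; rewrite divr_gt0.
  + by move=> k; rewrite mulr_gt0.
  + move=> k; transitivity (mv M^T v k / nrm v); first by rewrite /mv mulr_suml; apply: eq_bigr => l _; ring.
    by rewrite mv_tr vM mulrA.
  + move=> k; transitivity (nrm v * mv M u k); last by rewrite Mu; ring.
    by rewrite /vm /mv mulr_sumr; apply: eq_bigr => l _; rewrite mxE; ring.
  + split; first by rewrite /nrm -mulr_suml -/(nrm v) mulfV ?gt_eqF.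
    rewrite -[RHS]uv; apply: eq_bigr => k _; field; exact: lt0r_neq0.
Qed.

(** The roots are compared by pairing A u' = r' u' with v. For the eigenvectors, u' and v' are
    almost invariant under M and its transpose, so [direction] aligns them with u and v; the
    normalizations then fix the scalar factors. *)
Lemma perron_perturb (e : R) : 0 < e -> exists2 dl : R, 0 < dl &
  forall M r u v A r' u' v', primitive_class U al be M r u v -> (forall k l, 0 <= A k l <= be) ->
  (forall k l, al <= (A ^+ U) k l) -> ptrip A r' u' v' -> `|r - 1| <= dl ->
  (forall k l, `|A k l - M k l| <= dl) ->
  [/\ primitive_class U al be A r' u' v', `|r' - 1| <= e, forall k, `|u' k - u k| <= e &
    forall k, `|v' k - v k| <= e].
Proof.
move=> e0.
have dp : (0 : R) < d%:R by apply: lt_le_trans dR.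
(* Collects the coefficients of [e1] in the final bounds for u' - u and v' - v. *)
pose C := (1 + d%:R) * kap^-1 + 2 * d%:R * kap^-1 * kap^-1 + (1 + d%:R) * d%:R * kap^-1 * kap^-1 * kap^-1.
have C0 : 0 < C by rewrite /C !addr_gt0 ?mulr_gt0 ?addr_gt0.
pose e1 := Num.min (e / C) (kap * kap / ((1 + d%:R) * d%:R)).
have e10 : 0 < e1.
  by rewrite lt_min (divr_gt0 e0 C0) divr_gt0 ?mulr_gt0 ?addr_gt0.
have e1C : e1 * C <= e by rewrite -ler_pdivlMr // ge_min lexx.
have e1k : e1 * ((1 + d%:R) * d%:R) <= kap * kap.
  by rewrite -ler_pdivlMr ?mulr_gt0 ?addr_gt0 // ge_min lexx orbT.
have [m [d2 d20 hdir]] := direction U al0 be0 d1 e10.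
pose G := kap^-1 * kap^-1 * d%:R + 1.
have G0 : 0 < G by rewrite /G addr_gt0 ?mulr_gt0.
pose dl := Num.min (Num.min 2^-1 e) d2 / (2 * (G + 1)).
have m0 : 0 < Num.min (Num.min 2^-1 e) d2 by rewrite !lt_min e0 d20 invr_gt0 ltr0n.
have dl0 : 0 < dl by rewrite divr_gt0 // mulr_gt0 // addr_gt0.
have hdl : dl * (2 * (G + 1)) = Num.min (Num.min 2^-1 e) d2.
  by rewrite divfK // gt_eqF // mulr_gt0 // addr_gt0.
have [g1 g2 g3] : [/\ dl * (2 * (G + 1)) <= 2^-1, dl * (2 * (G + 1)) <= e & dl * (2 * (G + 1)) <= d2].
  by rewrite hdl !ge_min !lexx ?orbT; split=> //; rewrite orbT.
have Gdl : 0 <= G * dl by rewrite mulr_ge0 ?ltW.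
exists dl => // M r u v A r' u' v' hM Ab AU hA r1 AM.
have [Mb MU [u0 v0 Mu vM [u1 uv]] r2] := hM.
have [u'0 v'0 Au' vA' [u'1 uv']] := hA.
have u'1' k : u' k <= 1 by rewrite -u'1; apply: nrm_ge => l; exact: ltW.
have dA k : `|mv A u' k - mv M u' k| <= dl.
  rewrite /mv -sumrB (le_trans (ler_norm_sum _ _ _)) // -[leRHS]mulr1 -u'1 mulr_sumr.
  apply: ler_sum => l _; rewrite -mulrBl normrM (gtr0_norm (u'0 l)) ler_wpM2r ?(ltW (u'0 l)) //.
have vu'k : kap <= dot v u'.
  have := nrm_le_dot al0 hM (fun k => ltW (u'0 k)).
  by rewrite u'1 -ler_pdivrMl ?mulr1 ?invrK.
have hr : `|r' - r| <= kap^-1 * kap^-1 * d%:R * dl.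
  have E : (r' - r) * dot v u' = dot v (fun k => mv A u' k - mv M u' k).
    rewrite dotB dot_mv [dot v (mv M u')]dot_mv.
    have -> : vm v M = fun k => r * v k by apply/funext.
    rewrite dotZl -dot_mv (_ : mv A u' = fun k => r' * u' k) ?dotZ ?mulrBl //.
    by apply/funext.
  have := norm_dot_le al0 hM dA; rewrite -E normrM (ger0_norm (le_trans (ltW k0) vu'k)) => h.
  have : `|r' - r| * kap <= kap^-1 * d%:R * dl by apply: le_trans h; rewrite ler_wpM2l.
  by rewrite -ler_pdivlMr // => /le_trans -> //; rewrite le_eqVlt; apply/orP; left; apply/eqP; ring.
have hr1 : `|r' - 1| <= G * dl.
  have -> : r' - 1 = (r' - r) + (r - 1) by ring.
  rewrite (le_trans (ler_normD _ _)) // (le_trans (lerD hr r1)) //.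
  by rewrite /G mulrDl mul1r.
have r'2 : r' <= 2 by move: hr1; rewrite ler_norml => /andP[_]; lra.
have hAc : primitive_class U al be A r' u' v' by split.
have Gd2 : G * dl + dl <= d2 by lra.
have rd2 : `|r - 1| <= d2 by lra.
(* The constant sequence u' plays the role of an almost linear iteration. *)
have hu k : `|u' k - dot v u' * u k| <= e1 * dot v u'.
  apply: (hdir M r u v hM rd2 (fun=> u')) => [n l|n _ l]; first exact: ltW.
  have -> : u' l - mv M u' l = (mv A u' l - mv M u' l) - (r' - 1) * u' l by rewrite Au'; ring.
  rewrite u'1 mulr1 (le_trans (ler_normB _ _)) // (le_trans _ Gd2) // addrC lerD //.
  by rewrite normrM (gtr0_norm (u'0 l)) (le_trans _ hr1) // ler_piMr.
pose e2 := (1 + d%:R) * e1 * kap^-1.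
have D1 : dot v u' <= kap^-1.
  by have := dot_le_nrm al0 hM (fun k => ltW (u'0 k)); rewrite u'1 mulr1.
have eD : e1 * dot v u' <= e1 * kap^-1 by rewrite ler_wpM2l // ltW.
have hD : `|1 - dot v u'| <= d%:R * (e1 * kap^-1).
  have := nrm_const_le (fun k => le_trans (hu k) eD).
  by rewrite /nrm sumrB -mulr_sumr -/(nrm u') -/(nrm u) u'1 u1 mulr1.
have hu2 k : `|u' k - u k| <= e2.
  have -> : u' k - u k = (u' k - dot v u' * u k) - (1 - dot v u') * u k by ring.
  rewrite (le_trans (ler_normB _ _)) // normrM (gtr0_norm (u0 k)).
  have : `|1 - dot v u'| * u k <= d%:R * (e1 * kap^-1).
    by rewrite (le_trans _ hD) // ler_piMr // (u_le1 hM).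
  move: (hu k) eD; rewrite /e2; prune; lra.
have e1' : 0 <= e1 by exact: ltW.
have kV' : 0 <= kap^-1 by exact: ltW.
have nonneg : [/\ 0 <= (1 + d%:R) * kap^-1, 0 <= 2 * d%:R * kap^-1 * kap^-1 &
   0 <= (1 + d%:R) * d%:R * kap^-1 * kap^-1 * kap^-1].
  have dp1 : 0 <= 1 + d%:R :> R by rewrite addr_ge0.
  have q : 0 <= 2 * d%:R :> R by rewrite mulr_ge0.
  have q' : 0 <= (1 + d%:R) * d%:R :> R by rewrite mulr_ge0.
  by split; [exact: mulr_ge0 | exact: mulr_ge0 (mulr_ge0 _ _) _ |
             exact: mulr_ge0 (mulr_ge0 (mulr_ge0 _ _) _) _].
case: nonneg => n1 n2 n3.
have E1 := mulr_ge0 e1' n1; have E2 := mulr_ge0 e1' n2; have E3 := mulr_ge0 e1' n3.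
have Ce : e1 * ((1 + d%:R) * kap^-1) + e1 * (2 * d%:R * kap^-1 * kap^-1) +
   e1 * ((1 + d%:R) * d%:R * kap^-1 * kap^-1 * kap^-1) <= e.
  by rewrite -!mulrDr.
split=> //.
- by move: (ltW dl0) hr1 g2 Gdl; prune; lra.
- by move=> k; apply: le_trans (hu2 k) _; move: E2 E3 Ce; rewrite /e2; prune; lra.
move=> k; set N := nrm v'.
have v'le l : v' l <= kap^-1 by exact: (v_le al0 hAc).
have nv' : N <= d%:R * kap^-1.
  have := @nrm_const_le R d v' kap^-1; rewrite ger0_norm ?nrm_ge0 // => [|l]; last exact: ltW.
  by apply=> l; rewrite gtr0_norm.
have nvM : nrm v <= d%:R * kap^-1.
  have := @nrm_const_le R d v kap^-1; rewrite ger0_norm ?nrm_ge0 // => [|l]; last exact: ltW.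
  by apply=> l; rewrite gtr0_norm // (v_le al0 hM).
have hMT := primitive_class_tr hM.
have hv : `|v' k - dot (fun k => nrm v * u k) v' * (v k / nrm v)| <= e1 * dot (fun k => nrm v * u k) v'.
  apply: (hdir _ _ _ _ hMT rd2 (fun=> v')) => [n l|n _ l]; first exact: ltW.
  have -> : v' l - mv M^T v' l = \sum_k v' k * (A k l - M k l) - (r' - 1) * v' l.
    rewrite mv_tr mulrBl -vA' /vm mul1r.
    under [X in _ = X - _]eq_bigr do rewrite mulrBr.
    by rewrite sumrB; ring.
  rewrite (le_trans (ler_normB _ _)) //.
  apply: (@le_trans _ _ (dl * N + G * dl * N)); last first.
    by rewrite -mulrDl addrC ler_wpM2r // nrm_ge0 // => l'; exact: ltW.
  rewrite lerD //.
    rewrite (le_trans (ler_norm_sum _ _ _)) // mulr_sumr ler_sum // => k' _.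
    by rewrite normrM (gtr0_norm (v'0 k')) mulrC ler_wpM2r // ltW.
  rewrite normrM (gtr0_norm (v'0 l)) ler_pM // ?(ltW (v'0 l)) //.
  by apply: nrm_ge => l'; exact: ltW.
have nv0 : 0 < nrm v by apply: lt_le_trans (v0 k) _; apply: nrm_ge => l; exact: ltW.
rewrite dotZl in hv.
have hD' : `|dot u v' - 1| <= e2 * (d%:R * kap^-1).
  have -> : dot u v' - 1 = dot v' (fun k => u k - u' k) by rewrite dotB uv' dotC.
  rewrite (le_trans (norm_dot _ _)) //.
  apply: (@le_trans _ _ (e2 * N)); last first.
    by rewrite ler_wpM2l // /e2 !mulr_ge0 ?addr_ge0 ?(ltW dp).
  rewrite mulr_sumr ler_sum // => k' _.
  by rewrite (gtr0_norm (v'0 k')) mulrC ler_wpM2r ?(ltW (v'0 k')) // distrC.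
have E2' : e2 * (d%:R * kap^-1) <= 1.
  have -> : e2 * (d%:R * kap^-1) = e1 * ((1 + d%:R) * d%:R) * (kap^-1 * kap^-1) by rewrite /e2; ring.
  apply: le_trans (ler_wpM2r (mulr_ge0 kV' kV') e1k) _.
  by rewrite mulrACA mulfV ?gt_eqF // mulr1.
have D2 : dot u v' <= 2 by move: hD' E2'; prune; rewrite ler_norml => /andP[_]; lra.
have hv' : `|v' k - dot u v' * v k| <= e1 * (2 * (d%:R * kap^-1)).
  have -> : dot u v' * v k = nrm v * dot u v' * (v k / nrm v) by field; rewrite gt_eqF.
  apply: le_trans hv _; rewrite ler_wpM2l //.
  rewrite mulrC ler_pM //; last exact: ltW.
  by apply: dot_ge0 => l; exact: ltW.
have kap1 : 1 <= kap^-1 by rewrite invf_ge1 // ge_min lexx.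
have -> : v' k - v k = (v' k - dot u v' * v k) + (dot u v' - 1) * v k by ring.
rewrite (le_trans (ler_normD _ _)) // normrM (gtr0_norm (v0 k)).
have hl : `|dot u v' - 1| * v k <= e2 * (d%:R * kap^-1) * kap^-1.
  by rewrite ler_pM ?(ltW (v0 k)) // (v_le al0 hM).
have hl2 : e1 * (2 * (d%:R * kap^-1)) <= e1 * (2 * d%:R * kap^-1 * kap^-1).
  rewrite ler_wpM2l // mulrA ler_peMr //.
  by rewrite !mulr_ge0 // ltW.
have hl3 : e2 * (d%:R * kap^-1) * kap^-1 = e1 * ((1 + d%:R) * d%:R * kap^-1 * kap^-1 * kap^-1).
  by rewrite /e2; ring.
move: hv' hl hl2 hl3 Ce E1; prune; lra.
Qed.

End Perturbation.

(** * Uniform estimates near criticality *)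

Section NearCriticalFilter.
Variables (R : realType) (d : nat) (a b c : R) (U : nat).
Hypotheses (d1 : (1 <= d)%N) (a0 : 0 < a) (b0 : 0 < b) (c0 : 0 < c) (U1 : (1 <= U)%N).
Local Notation vec := ('I_d -> R).
Local Notation inK := (inK a b c U).
Local Notation K3 := (remainder_const c).
Local Notation al := (a / 2).
Local Notation kap := (kap U al).
Implicit Types (p : offspring R d) (s t x y z q w u v : vec) (n m N : nat) (k l : 'I_d) (e : R).

(* All estimates are uniform: they hold along the filter of pairs (f, s) with f in the class,
   rho f -> 1 and s -> 1. *)
Definition crit e (ps : offspring R d * vec) :=
  [/\ inK ps.1, `|rho ps.1 - 1| <= e, cube ps.2 & nrm (defect ps.2) <= e].

Definition near_critical : set_system (offspring R d * vec) :=
  [set P | exists2 e, 0 < e & forall ps, crit e ps -> P ps].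

Lemma crit_le e e' ps : e <= e' -> crit e ps -> crit e' ps.
Proof. by move=> ee [? h1 ? h2]; split=> //; [exact: le_trans h1 ee | exact: le_trans h2 ee]. Qed.

#[global] Instance near_critical_filter : Filter near_critical.
Proof.
split.
- by exists 1.
- move=> P Q [e e0 hP] [e' e'0 hQ]; exists (Num.min e e'); first by rewrite lt_min e0.
  move=> ps h; split; [apply: hP | apply: hQ]; apply: crit_le h; first by rewrite ge_min lexx.
  by rewrite ge_min lexx orbT.
- by move=> P Q PQ [e e0 hP]; exists e => // ps /hP /PQ.
Qed.

Lemma near_crit e : 0 < e -> \forall ps \near near_critical, crit e ps.
Proof. by move=> e0; exists e. Qed.

Let al0 : 0 < al. Proof. by rewrite divr_gt0. Qed.
Let K30 : 1 <= K3. Proof. by rewrite /remainder_const; have := c0; lra. Qed.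
Let K30' : 0 <= K3. Proof. exact: le_trans K30. Qed.
Let half0 : 0 < 2^-1 :> R. Proof. by rewrite invr_gt0. Qed.

Lemma near_small e : 0 < e ->
  exists N, \forall ps \near near_critical, forall n, (N <= n)%N -> nrm (xn ps.1 ps.2 n) <= e.
Proof.
move=> e0; set C := Csmall d a b c U; pose C' : R := `|C| + 1.
have C'0 : 0 < C' by rewrite ltr_wpDl.
(* [eta] has three summands, each of which is made at most [dl]. *)
pose dl := e ^+ 2 / (3 * C').
have dl0 : 0 < dl by rewrite divr_gt0 ?exprn_gt0 ?mulr_gt0.
have [N _ hN] : \forall N \near \oo, (N%:R : R)^-1 <= dl.
  near=> N; rewrite invf_ple ?posrE //; last by rewrite ltr0n; near: N; exact: nbhs_infty_gt.
  by near: N; exact: nbhs_infty_ger.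
exists N.+1; near=> ps => n nN.
have [hK r1 cs sd] : crit (Num.min 2^-1 dl) ps.
  by near: ps; apply: near_crit; rewrite lt_min half0.
have n0 : (0 < n)%N by apply: leq_ltn_trans nN.
have r2 : `|rho ps.1 - 1| <= 2^-1 by apply: le_trans r1 _; rewrite ge_min lexx.
have dlm : Num.min 2^-1 dl <= dl by rewrite ge_min lexx orbT.
have h := small_xn d1 a0 b0 c0 hK r2 cs n0.
have x0 : 0 <= nrm (xn ps.1 ps.2 n).
  by apply: nrm_ge0 => k; have /andP[] := xn_cube hK cs n k.
rewrite -(ler_pXn2r (n := 2)) ?nnegrE ?(ltW e0) // (le_trans h) // -/C.
have eta3 : eta ps.1 ps.2 n <= 3 * dl.
  have hn : n%:R^-1 <= dl by apply: hN; rewrite /= ltnW.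
  rewrite /eta; have := le_trans r1 dlm; have := le_trans sd dlm; lra.
have eta0 : 0 <= eta ps.1 ps.2 n by exact: eta_ge0.
apply: (@le_trans _ _ (C' * (3 * dl))); last first.
  by rewrite le_eqVlt; apply/orP; left; apply/eqP; rewrite /dl; field; rewrite gt_eqF.
rewrite (le_trans (ler_wpM2r eta0 (_ : _ <= C'))) // ?ler_wpM2l ?(ltW C'0) //.
by rewrite /C' (le_trans (ler_norm _)) // lerDl.
Unshelve. all: by end_near. Qed.

Lemma near_hstar e : 0 < e ->
  \forall ps \near near_critical, nrm (defect (hstar ps.1 ps.2)) <= e.
Proof.
move=> e0; have [N hN] := near_small e0; near=> ps.
have [hK _ cs _] : crit 1 ps by near: ps; exact: near_crit.
have [hp _] := hK.
apply: (@le_trans _ _ (nrm (xn ps.1 ps.2 N))); last first.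
  by have /(_ N (leqnn N)) : forall n, (N <= n)%N -> nrm (xn ps.1 ps.2 n) <= e by near: ps.
by apply: ler_sum => k _; rewrite /xn /defect lerD2l lerN2; exact: hn_le_hstar.
Unshelve. all: by end_near. Qed.

(** The bound a is weakened to a/2 so that M and its perturbation [jac] belong to one and the same
    class. *)
Lemma Mmat_primitive_half p : inK p -> `|rho p - 1| <= 2^-1 ->
  primitive_class U al K3 (Mmat p) (rho p) (uvec p) (vvec p).
Proof.
move=> hK r1; have [h1 h2 h3 h4] := Mmat_primitive hK r1; split=> // k l.
by apply: le_trans (h2 k l); rewrite ler_pdivrMr // ler_peMr ?(ltW a0) // ler1n.
Qed.

(* Jacobian at its fixed point [hstar p s] of the map [h |-> s f(h)] iterated by [hn]. *)
Definition jac p s : 'M[R]_d := \matrix_(k, l) (s k * Ms p (hstar p s) k l).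
Definition jac_root p s := perron_root (jac p s).
Definition jac_u p s := pu (jac p s).
Definition jac_v p s := pv (jac p s).

Lemma As_ge0 p s k l : inK p -> cube s -> 0 <= jac p s k l <= K3.
Proof.
move=> hK cs; have [hp _] := hK; rewrite mxE; have /andP[s0 s1] := cs k.
have [_ /andP[m0 m1]] := pex_dmon hp hK k l (hstar_cube hp cs).
by rewrite mulr_ge0 //= (le_trans _ m1) // ler_piMl.
Qed.

Lemma near_As_close e : 0 < e ->
  \forall ps \near near_critical, forall k l, `|jac ps.1 ps.2 k l - Mmat ps.1 k l| <= e.
Proof.
move=> e0; pose D := K3 * (1 + d%:R) + K3.
have D0 : 0 < D.
  have : 0 <= K3 * (1 + d%:R) by exact: mulr_ge0 K30' (addr_ge0 ler01 (ler0n _ _)).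
  by rewrite /D; have := K30; lra.
have eD : 0 < e / D by rewrite divr_gt0.
near=> ps => k l.
have [hK _ cs sd] : crit (e / D) ps by near: ps; exact: near_crit.
have hh : nrm (defect (hstar ps.1 ps.2)) <= e / D by near: ps; exact: near_hstar.
have [hp _] := hK; have ch := hstar_cube hp cs.
have h1 := Ms_close hK c0 k l ch.
have [_ /andP[m0 m1]] := pex_dmon hp hK k l ch.
have ds0 l' : 0 <= defect ps.2 l' by have /andP[] := defect_cube cs l'.
have h2 : `|defect ps.2 k * Ms ps.1 (hstar ps.1 ps.2) k l| <= e / D * K3.
  rewrite normrM (ger0_norm m0) ger0_norm // ler_pM //.
  by apply: le_trans sd; exact: nrm_ge.
rewrite mxE.
have -> : ps.2 k * Ms ps.1 (hstar ps.1 ps.2) k l - Mmat ps.1 k l =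
  (Ms ps.1 (hstar ps.1 ps.2) k l - Mmat ps.1 k l) - defect ps.2 k * Ms ps.1 (hstar ps.1 ps.2) k l.
  by rewrite /defect; ring.
rewrite (le_trans (ler_normB _ _)) //.
have h3 : K3 * (1 + d%:R) * nrm (defect (hstar ps.1 ps.2)) <= K3 * (1 + d%:R) * (e / D).
  by apply: ler_wpM2l => //; exact: mulr_ge0 K30' (addr_ge0 ler01 (ler0n _ _)).
have -> : e = K3 * (1 + d%:R) * (e / D) + e / D * K3.
  by rewrite /D; field; rewrite gt_eqF.
by rewrite lerD // (le_trans h1).
Unshelve. all: by end_near. Qed.

(** The columns of the powers of [jac] are almost iterates of M, so after U steps they are within
    a/2 of those of M^U, whose entries are at least a. *)
Lemma near_jac_pow : \forall ps \near near_critical, forall k l, al <= (jac ps.1 ps.2 ^+ U) k l.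
Proof.
pose G := U%:R * (d%:R * (K3 + 1)) ^+ U.
have G0 : 0 <= G.
  by exact: mulr_ge0 (ler0n _ _) (exprn_ge0 _ (mulr_ge0 (ler0n _ _) (addr_ge0 K30' ler01))).
pose dl := Num.min 1 (al / (G + 1)).
have G1 : 0 < G + 1 by rewrite ltr_wpDl.
have dl0 : 0 < dl by rewrite lt_min ltr01 divr_gt0.
have dl1 : dl <= 1 by rewrite ge_min lexx.
have Gdl : G * dl <= al.
  apply: (@le_trans _ _ ((G + 1) * dl)); first by rewrite ler_wpM2r ?(ltW dl0) // lerDl.
  by rewrite mulrC -ler_pdivlMr // ge_min lexx orbT.
near=> ps => k l.
have [hK r1 cs _] : crit 2^-1 ps by near: ps; exact: near_crit.
have hA : forall k l, `|jac ps.1 ps.2 k l - Mmat ps.1 k l| <= dl by near: ps; exact: near_As_close.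
have [Mb _ _ _] := Mmat_primitive hK r1.
have Ab k' l' := As_ge0 k' l' hK cs.
set A := jac ps.1 ps.2 in hA Ab *.
pose z n : vec := fun k => (A ^+ n) k l.
have z0 n k' : 0 <= z n k' by apply: exp_mx_ge0 => i j; have /andP[] := Ab i j.
have zS n k' : z n.+1 k' = mv A (z n) k' by rewrite /z exprS -mulmxE mxE.
have hz n k' : `|z n.+1 k' - mv (Mmat ps.1) (z n) k'| <= dl * nrm (z n).
  rewrite zS /mv -sumrB (le_trans (ler_norm_sum _ _ _)) // mulr_sumr ler_sum // => m _.
  by rewrite -mulrBl normrM (ger0_norm (z0 _ _)) ler_wpM2r.
have := almost_iterate K30' Mb (introT andP (conj (ltW dl0) dl1)) d1 z0 (m := U) (fun n _ k' => hz n k') k.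
have zE : z 0%N = fun k => (k == l)%:R by apply/funext => k'; rewrite /z expr0 mxE.
have -> : nrm (z 0%N) = 1.
  by rewrite zE /nrm (bigD1 l) //= eqxx big1 ?addr0 // => k' /negbTE ->.
have -> : mv (Mmat ps.1 ^+ U) (z 0%N) k = (Mmat ps.1 ^+ U) k l.
  by rewrite zE; exact: (dot_deltaE l).
have [_ [/(_ k l) hU _]] := hK.
rewrite mulr1 ler_norml => /andP[h _].
have : - al <= z U k - (Mmat ps.1 ^+ U) k l by apply: le_trans h; rewrite lerN2.
rewrite /z; lra.
Unshelve. all: by end_near. Qed.

Lemma near_triple e : 0 < e -> \forall ps \near near_critical,
  [/\ primitive_class U al K3 (jac ps.1 ps.2) (jac_root ps.1 ps.2) (jac_u ps.1 ps.2) (jac_v ps.1 ps.2),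
    `|jac_root ps.1 ps.2 - 1| <= e, forall k, `|jac_u ps.1 ps.2 k - uvec ps.1 k| <= e &
    forall k, `|jac_v ps.1 ps.2 k - vvec ps.1 k| <= e].
Proof.
move=> e0; have [dl dl0 hdl] := perron_perturb U al0 K30' d1 e0.
near=> ps.
have [hK r1 cs _] : crit (Num.min 2^-1 dl) ps.
  by near: ps; apply: near_crit; rewrite lt_min half0.
have r2 : `|rho ps.1 - 1| <= 2^-1 by apply: le_trans r1 _; rewrite ge_min lexx.
have r3 : `|rho ps.1 - 1| <= dl by apply: le_trans r1 _; rewrite ge_min lexx orbT.
have AU : forall k l, al <= (jac ps.1 ps.2 ^+ U) k l by near: ps; exact: near_jac_pow.
have Ab k l := As_ge0 k l hK cs.
have hA : ptrip (jac ps.1 ps.2) (jac_root ps.1 ps.2) (jac_u ps.1 ps.2) (jac_v ps.1 ps.2).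
  apply: perron_spec; apply: (perron_exists d1 al0 U1 _ AU) => k l; by have /andP[] := Ab k l.
apply: (hdl _ _ _ _ _ _ _ _ (Mmat_primitive_half hK r2) Ab AU hA r3 _).
by near: ps; exact: near_As_close.
Unshelve. all: by end_near. Qed.

(** The index is shifted: [Dn p s n] is the transform on the event N = n + 1. *)
Definition Dn p s n : vec := fun k => hn p n.+1 s k - hn p n s k.
Definition qn p s n : vec := fun k => hstar p s k - hn p n s k.

Definition aligned e p z := forall k, `|z k - dot (vvec p) z * uvec p k| <= e * dot (vvec p) z.

(** Both sequences obey z_(n+1) = s (f(y) - f(y - z_n)), with y = h_(n+1) for increments and y =
    [hstar] for gaps, and y - z_n = h_n in both cases. [step_close] and [direction] thus treat them
    together, the last m steps before n being used. *)
Lemma near_aligned e : 0 < e -> exists N, \forall ps \near near_critical, forall n, (N <= n)%N ->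
  aligned e ps.1 (Dn ps.1 ps.2 n) /\ aligned e ps.1 (qn ps.1 ps.2 n).
Proof.
move=> e0; have [m [dl dl0 hdir]] := direction U al0 K30' d1 e0.
have C40 : 0 < C4 d c.
  rewrite /C4; have K3p : 0 < K3 by apply: lt_le_trans K30.
  by apply: (mulr_gt0 K3p); rewrite ltr_wpDl // addr_ge0 ?exprn_ge0 ?mulr_ge0.
pose e1 := dl / (2 * C4 d c).
have e10 : 0 < e1 by rewrite divr_gt0 // mulr_gt0.
have [N hN] := near_small e10.
exists (N + m)%N; near=> ps => n Nn.
have [hK r1 cs sd] : crit (Num.min 2^-1 (Num.min dl e1)) ps.
  by near: ps; apply: near_crit; rewrite !lt_min half0 dl0.
have r2 : `|rho ps.1 - 1| <= 2^-1 by apply: le_trans r1 _; rewrite ge_min lexx.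
have r3 : `|rho ps.1 - 1| <= dl by apply: le_trans r1 _; rewrite !ge_min lexx orbT.
have sd1 : nrm (defect ps.2) <= e1 by apply: le_trans sd _; rewrite !ge_min lexx !orbT.
have sm : forall n, (N <= n)%N -> nrm (xn ps.1 ps.2 n) <= e1 by near: ps.
have [hp _] := hK.
set p := ps.1 in sm r1 r2 r3 hK hp *; set s := ps.2 in cs sd sd1 sm *.
have step y q k n' : cube y -> (forall l, 0 <= q l) -> (forall l, q l <= y l) ->
    (fun l => y l - q l) = hn p n' s -> (N <= n')%N ->
    `|s k * (pgf p k y - pgf p k (hn p n' s)) - mv (Mmat p) q k| <= dl * nrm q.
  move=> cy q0 qy yq Nn'; have := step_close hK c0 k cs cy q0 qy; rewrite yq => /le_trans -> //.
  apply: ler_wpM2r; first exact: nrm_ge0.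
  apply: (@le_trans _ _ (C4 d c * (e1 + e1))).
    by apply: ler_wpM2l; [exact: ltW | apply: lerD; [exact: sm | exact: sd1]].
  by rewrite le_eqVlt; apply/orP; left; apply/eqP; rewrite /e1; field; rewrite gt_eqF.
have Nnm i : (N <= n - m + i)%N by rewrite (leq_trans _ (leq_addr _ _)) // leq_subRL ?(leq_trans _ Nn) ?leq_addl // addnC.
have nmm : (n - m + m)%N = n by rewrite subnK // (leq_trans _ Nn) // leq_addl.
have hM := Mmat_primitive_half hK r2.
have hnc i := hn_cube hp i cs.
have D0 i k : 0 <= Dn p s i k by rewrite subr_ge0 hn_leS.
have q0 i k : 0 <= qn p s i k by rewrite subr_ge0 hn_le_hstar.
split=> k.
- have := hdir _ _ _ _ hM r3 (fun i => Dn p s (n - m + i)) (fun i => D0 _) _ k.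
  rewrite nmm; apply => i _ k'; rewrite addnS.
  have -> : Dn p s (n - m + i).+1 k' =
      s k' * (pgf p k' (hn p (n - m + i).+1 s) - pgf p k' (hn p (n - m + i) s)).
    by rewrite mulrBr.
  apply: (step (hn p (n - m + i).+1 s) (Dn p s (n - m + i)) k' (n - m + i)%N (hnc _) (D0 _) _ _ (Nnm i)).
    by move=> l; rewrite /Dn lerBlDr lerDl; have /andP[] := hnc (n - m + i)%N l.
  by apply/funext => l; rewrite /Dn subKr.
- have := hdir _ _ _ _ hM r3 (fun i => qn p s (n - m + i)) (fun i => q0 _) _ k.
  rewrite nmm; apply => i _ k'; rewrite addnS.
  have -> : qn p s (n - m + i).+1 k' =
      s k' * (pgf p k' (hstar p s) - pgf p k' (hn p (n - m + i) s)).
    by rewrite mulrBr -(hstar_fix hp hK).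
  apply: (step (hstar p s) (qn p s (n - m + i)) k' (n - m + i)%N (hstar_cube hp cs) (q0 _) _ _ (Nnm i)).
    by move=> l; rewrite /qn lerBlDr lerDl; have /andP[] := hnc (n - m + i)%N l.
  by apply/funext => l; rewrite /qn subKr.
Unshelve. all: by end_near. Qed.

End NearCriticalFilter.

(** * The quadratic recursion for the distance to the fixed point *)

Section Recursion.
Variables (R : realType) (d : nat) (a b c : R) (U : nat).
Hypotheses (d1 : (1 <= d)%N) (a0 : 0 < a) (b0 : 0 < b) (c0 : 0 < c) (U1 : (1 <= U)%N).
Local Notation vec := ('I_d -> R).
Local Notation inK := (inK a b c U).
Local Notation K3 := (remainder_const c).
Local Notation al := (a / 2).
Local Notation kap := (kap U al).
Local Notation near_critical := (near_critical (d := d) a b c U).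
Local Notation crit := (crit a b c U).
Implicit Types (p : offspring R d) (s t x y z q w u v : vec) (n m N : nat) (k l : 'I_d) (e : R).

Let al0 : 0 < al. Proof. by rewrite divr_gt0. Qed.
Let k0 : 0 < kap. Proof. exact: kap_gt0. Qed.
Let kV : 0 < kap^-1. Proof. by rewrite invr_gt0. Qed.
Let dR : 1 <= d%:R :> R. Proof. by rewrite ler1n. Qed.
Let dp : 0 < d%:R :> R. Proof. exact: lt_le_trans dR. Qed.
Let K30 : 1 <= K3. Proof. by rewrite /remainder_const; have := c0; lra. Qed.
Let K3p : 0 < K3. Proof. exact: lt_le_trans K30. Qed.
Let half0 : 0 < 2^-1 :> R. Proof. by rewrite invr_gt0. Qed.

Lemma QcE p : Qc p = 2^-1 * hess_form p (vvec p) (uvec p) (uvec p).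
Proof. by []. Qed.

Lemma T3Z p w x z (X Z : R) : hess_form p w (fun l => X * x l) (fun l => Z * z l) = X * Z * hess_form p w x z.
Proof.
rewrite /hess_form /dot mulr_sumr; apply: eq_bigr => k _; rewrite mulrCA; congr (_ * _).
rewrite /Bq mulr_sumr; apply: eq_bigr => l _; rewrite mulr_sumr; apply: eq_bigr => m _; ring.
Qed.

(** Bounds for Q over the class: entries of u and v lie between [kap] and 1, respectively [kap] and
    [kap^-1], the Hessian entries sum to at least b, and each is at most [remainder_const]. *)
Definition Q0 : R := 2^-1 * (kap * (b * kap ^+ 2)).
Definition Q1 : R := d%:R ^+ 3 * K3 * kap^-1.

Lemma Q0_gt0 : 0 < Q0.
Proof. by rewrite !mulr_gt0 ?exprn_gt0. Qed.

Lemma Qc_bounds p : inK p -> `|rho p - 1| <= 2^-1 -> Q0 <= Qc p <= Q1.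
Proof.
move=> hK r1; have hM := Mmat_primitive_half a0 hK r1; have [hp _] := hK.
have [_ _ [u0 v0 _ _ _] _] := hM.
have B0 k : 0 <= Bq p (uvec p) (uvec p) k.
  apply: sumr_ge0 => l _; apply: sumr_ge0 => m _.
  by have [_ /andP[h _]] := pex_fac2 hp hK k l m; rewrite !mulr_ge0 // ltW.
rewrite QcE; apply/andP; split.
  rewrite ler_wpM2l ?(ltW half0) //.
  have hB := Bq_ge hK (ltW k0) (u_ge hM).
  apply: le_trans (ler_wpM2l (ltW k0) hB) _.
  by rewrite mulr_sumr; apply: ler_sum => k _; rewrite ler_wpM2r // (v_ge al0 hM).
have u1 k : `|uvec p k| <= 1 by rewrite gtr0_norm // (u_le1 hM).
have Bb k : `|Bq p (uvec p) (uvec p) k| <= d%:R ^+ 2 * K3.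
  by rewrite (le_trans (Bq_bound hK k u1 u1)) // !mulr1.
apply: (@le_trans _ _ (hess_form p (vvec p) (uvec p) (uvec p))).
  by rewrite ler_piMl ?invf_le1 ?ler1n //; apply: dot_ge0 => // k; exact: ltW.
apply: le_trans (ler_norm _) _.
apply: le_trans (norm_dot_le al0 hM Bb) _.
by rewrite le_eqVlt; apply/orP; left; apply/eqP; rewrite /Q1; ring.
Qed.

Lemma Qc_gt0 p : inK p -> `|rho p - 1| <= 2^-1 -> 0 < Qc p.
Proof. by move=> hK r1; have /andP[h _] := Qc_bounds hK r1; apply: lt_le_trans Q0_gt0 h. Qed.

(** When w is close to v and x, z are aligned with u, the form sees only their scalar sizes, and its
    value at (v, u, u) is 2 Q by definition. *)
Lemma T3_approx e : 0 < e -> exists2 dl : R, 0 < dl & forall p w x z (X Z : R),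
  inK p -> `|rho p - 1| <= 2^-1 -> (forall k, `|w k - vvec p k| <= dl) -> 0 <= X -> 0 <= Z ->
  (forall k, `|x k - X * uvec p k| <= dl * X) -> (forall k, `|z k - Z * uvec p k| <= dl * Z) ->
  `|hess_form p w x z - 2 * Qc p * (X * Z)| <= e * (X * Z).
Proof.
move=> e0; pose C := d%:R ^+ 3 * K3 * (4 + 4 * kap^-1).
have C0 : 0 < C by rewrite /C !mulr_gt0 ?exprn_gt0 // addr_gt0 // mulr_gt0.
exists (Num.min 1 (e / C)); first by rewrite lt_min ltr01 divr_gt0.
set dl := Num.min _ _ => p w x z X Z hK r1 hw X0 Z0 hx hz.
have dl0 : 0 <= dl by rewrite le_min ler01 divr_ge0 // ltW.
have dl1 : dl <= 1 by rewrite ge_min lexx.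
have dle : dl * C <= e by rewrite -ler_pdivlMr // ge_min lexx orbT.
have hM := Mmat_primitive_half a0 hK r1.
have [_ _ [u0 v0 _ _ _] _] := hM.
have uX (Y : R) k : 0 <= Y -> `|Y * uvec p k| <= Y.
  by move=> Y0; rewrite ger0_norm ?mulr_ge0 ?(ltW (u0 k)) // ler_piMr // (u_le1 hM).
have le2 (Y : R) y : 0 <= Y -> (forall k, `|y k - Y * uvec p k| <= dl * Y) -> forall k, `|y k| <= 2 * Y.
  move=> Y0 hy k; have := ler_normD (y k - Y * uvec p k) (Y * uvec p k); rewrite subrK.
  have := hy k; have := uX Y k Y0; have : dl * Y <= Y by rewrite ler_piMl.
  lra.
have X2 k : `|X * uvec p k| <= 2 * X by have := uX X k X0; lra.
have Wb k : `|vvec p k| <= kap^-1 by rewrite gtr0_norm // (v_le al0 hM).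
have := T3_close hK c0 dl0 hw Wb hx (le2 _ _ X0 hx) X2 hz (le2 _ _ Z0 hz).
rewrite T3Z QcE -/C.
have -> : 2 * (2^-1 * hess_form p (vvec p) (uvec p) (uvec p)) * (X * Z) =
   X * Z * hess_form p (vvec p) (uvec p) (uvec p) by field.
move=> /le_trans -> //; rewrite mulrA ler_wpM2r ?mulr_ge0 // mulrC //.
Qed.

(** Replacing v by a nearby functional changes the coordinate of an aligned vector only by a
    relative amount, because the norm of z is at most kap^-1 v.z. *)
Lemma realign e : 0 < e -> exists2 dl : R, 0 < dl & forall p v' z,
  inK p -> `|rho p - 1| <= 2^-1 -> (forall k, 0 <= z k) -> (forall k, `|v' k - vvec p k| <= dl) ->
  aligned dl p z -> 0 <= dot v' z /\ (forall k, `|z k - dot v' z * uvec p k| <= e * dot v' z).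
Proof.
move=> e0; pose C := 2 * (1 + kap^-1).
have C0 : 0 < C by rewrite mulr_gt0 // addr_gt0.
exists (Num.min (kap / 2) (e / C)); first by rewrite lt_min !divr_gt0.
set dl := Num.min _ _ => p v' z hK r1 z0 hv hz.
have dl0 : 0 <= dl by rewrite le_min !divr_ge0 // ltW.
have dl1 : dl * kap^-1 <= 2^-1.
  by rewrite ler_pdivrMr // mulrC -[X in X <= _]mul1r; rewrite mul1r ge_min lexx.
have dle : dl * C <= e by rewrite -ler_pdivlMr // ge_min lexx orbT.
have hM := Mmat_primitive_half a0 hK r1.
have [_ _ [u0 v0 _ _ _] _] := hM.
set S := dot (vvec p) z in hz *; set Y := dot v' z.
have S0 : 0 <= S by apply: dot_ge0 => // k; exact: ltW.
have NS : nrm z <= kap^-1 * S by exact: (nrm_le_dot al0 hM).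
have YS : `|Y - S| <= dl * (kap^-1 * S).
  have -> : Y - S = dot z (fun k => v' k - vvec p k) by rewrite dotB /Y /S dotC [dot (vvec p) _]dotC.
  apply: (@le_trans _ _ (dl * nrm z)); last by rewrite ler_wpM2l.
  rewrite (le_trans (norm_dot _ _)) // mulr_sumr ler_sum // => k _.
  by rewrite (ger0_norm (z0 k)) mulrC ler_wpM2r.
have YS' : dl * (kap^-1 * S) <= 2^-1 * S by rewrite mulrA ler_wpM2r.
have SY : S <= 2 * Y by move: YS; rewrite ler_norml => /andP[]; lra.
split=> [|k]; first by lra.
have -> : z k - Y * uvec p k = (z k - S * uvec p k) - (Y - S) * uvec p k by ring.
rewrite (le_trans (ler_normB _ _)) // normrM (gtr0_norm (u0 k)).
have h1 : `|Y - S| * uvec p k <= dl * (kap^-1 * S).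
  by rewrite (le_trans _ YS) // ler_piMr // (u_le1 hM).
have h2 : dl * (1 + kap^-1) * S <= dl * (1 + kap^-1) * (2 * Y).
  by rewrite ler_wpM2l // mulr_ge0 // addr_ge0 // ltW.
have Y0 : 0 <= Y by lra.
have h3 : dl * C * Y <= e * Y by rewrite ler_wpM2r.
have hzk : `|z k - S * uvec p k| <= dl * S := hz k.
by rewrite /C in h3; lra.
Qed.

(** The left eigenvector of the Jacobian at the fixed point is used instead of [vvec]: the linear
    term of the recursion is then exactly [jac_root] times the coordinate. *)
Definition yn p s n : R := dot (jac_v p s) (qn p s n).

Lemma yn_step p s n : inK p -> cube s ->
  yn p s n.+1 = \sum_k jac_v p s k * (s k * (pgf p k (hstar p s) - pgf p k (hn p n s))).
Proof.
move=> hK cs; have [hp _] := hK; apply: eq_bigr => k _; congr (_ * _).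
by rewrite /qn mulrBr -(hstar_fix hp hK).
Qed.

(** Taylor's formula at [hstar], paired with the left eigenvector of [jac]. The Hessian term becomes
    Q y^2 because the gap is aligned with u, and the cubic remainder carries the factor 1 - h_n,
    uniformly small for large n. *)
Lemma near_rec e : 0 < e -> exists N, \forall ps \near near_critical, forall n, (N <= n)%N ->
  `|yn ps.1 ps.2 n.+1 - jac_root ps.1 ps.2 * yn ps.1 ps.2 n + Qc ps.1 * yn ps.1 ps.2 n ^+ 2|
    <= e * yn ps.1 ps.2 n ^+ 2.
Proof.
move=> e0.
have [d2 d20 hT] := T3_approx e0.
have [d3 d30 hR] := realign d20.
pose e1 := Num.min (Num.min 2^-1 (d2 / 2)) (Num.min d3 (d2 / 2 * kap)).
have e10 : 0 < e1 by rewrite /e1 !lt_min half0 d30 !divr_gt0 // mulr_gt0 // divr_gt0.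
pose C := kap^-1 * d%:R * K3 * (kap^-1 * kap^-1).
have C0 : 0 < C by rewrite /C !mulr_gt0.
have [N1 hN1] := near_small U d1 a0 b0 c0 (divr_gt0 (mulr_gt0 half0 e0) C0).
have [N2 hN2] := near_aligned U d1 a0 b0 c0 e10.
exists (maxn N1 N2); near=> ps => n Nn; set y := yn ps.1 ps.2.
have [n1 n2] : (N1 <= n)%N /\ (N2 <= n)%N by apply/andP; rewrite -geq_max.
have [hK r1 cs sd] : crit e1 ps by near: ps; exact: near_crit.
have [ee1 ee2 ee3 ee4] : [/\ e1 <= 2^-1, e1 <= d2 / 2, e1 <= d3 & e1 <= d2 / 2 * kap].
  by rewrite /e1 !ge_min !lexx ?orbT.
have r2 := le_trans r1 ee1.
have [hA ra ua va] : [/\ primitive_class U al K3 (jac ps.1 ps.2) (jac_root ps.1 ps.2) (jac_u ps.1 ps.2) (jac_v ps.1 ps.2),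
    `|jac_root ps.1 ps.2 - 1| <= e1, forall k, `|jac_u ps.1 ps.2 k - uvec ps.1 k| <= e1 &
    forall k, `|jac_v ps.1 ps.2 k - vvec ps.1 k| <= e1] by near: ps; exact: near_triple.
have [_ hq] : aligned e1 ps.1 (Dn ps.1 ps.2 n) /\ aligned e1 ps.1 (qn ps.1 ps.2 n).
  by move: n n2 {n1 Nn}; near: ps.
have hx : nrm (xn ps.1 ps.2 n) <= 2^-1 * e / C by move: n n1 {n2 hq Nn}; near: ps.
have [hp _] := hK.
set p := ps.1 in hK r1 r2 hA ra ua va hq hx hp y *; set s := ps.2 in cs sd hA ra ua va hq hx y *.
have [_ _ [u0 v0 uA vA [u1 uv]] _] := hA.
have chs := hstar_cube hp cs; have chn := hn_cube hp n cs.
have q0 k : 0 <= qn p s n k by rewrite subr_ge0 hn_le_hstar.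
have qh k : qn p s n k <= hstar p s k by rewrite /qn lerBlDr lerDl; have /andP[] := chn k.
have yq : (fun l => hstar p s l - qn p s n l) = hn p n s by apply/funext => l; rewrite /qn subKr.
have ds0 k : 0 <= defect s k by have /andP[] := defect_cube cs k.
have S0 : 0 <= dot (vvec p) (qn p s n).
  by have [_ _ [_ v0' _ _ _] _] := Mmat_primitive_half a0 hK r2; apply: dot_ge0 => // k; exact: ltW.
have al3 : aligned d3 p (qn p s n) by move=> k; rewrite (le_trans (hq k)) // ler_wpM2r.
have [y0 yu] := hR p (jac_v p s) _ hK r2 q0 (fun k => le_trans (va k) ee3) al3.
(* The iterated map is s f, so the expansion of f is paired with the eigenvector weighted by s. *)
pose w : vec := fun k => jac_v p s k * s k.
have vle k : jac_v p s k <= kap^-1 by exact: (v_le al0 hA).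
have hw k : `|w k - vvec p k| <= d2.
  have -> : w k - vvec p k = (jac_v p s k - vvec p k) - jac_v p s k * defect s k by rewrite /w /defect; ring.
  rewrite (le_trans (ler_normB _ _)) // (splitr d2) lerD // ?(le_trans (va k)) //.
  rewrite ger0_norm ?mulr_ge0 ?(ltW (v0 k)) //.
  apply: (@le_trans _ _ (kap^-1 * e1)); last by rewrite ler_pdivrMl // mulrC.
  by rewrite ler_pM ?(ltW (v0 k)) // (le_trans _ sd) // nrm_ge.
have h3 := hT p w _ _ _ _ hK r2 hw y0 y0 yu yu.
have err k : `|pgf p k (hstar p s) - pgf p k (hn p n s) - Mv p (hstar p s) (qn p s n) k
     + 2^-1 * Bq p (qn p s n) (qn p s n) k| <= K3 * nrm (xn p s n) * nrm (qn p s n) ^+ 2.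
  have := pgf_taylor hp hK k chs q0 qh; rewrite yq.
  have -> // : (fun l => 1 - (hstar p s l - qn p s n l)) = xn p s n.
  by apply/funext => l; rewrite /qn subKr.
set E : vec := fun k => pgf p k (hstar p s) - pgf p k (hn p n s) - Mv p (hstar p s) (qn p s n) k
     + 2^-1 * Bq p (qn p s n) (qn p s n) k.
have yS : y n.+1 = dot w E + jac_root p s * y n - 2^-1 * hess_form p w (qn p s n) (qn p s n).
  rewrite /y (yn_step _ hK cs).
  have -> : jac_root p s * yn p s n = dot w (Mv p (hstar p s) (qn p s n)).
    have -> : jac_root p s * yn p s n = dot (jac_v p s) (mv (jac p s) (qn p s n)).
      by rewrite dot_mv (_ : vm (jac_v p s) (jac p s) = fun k => jac_root p s * jac_v p s k) ?dotZl //; apply/funext.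
    apply: eq_bigr => k _; rewrite /w -mulrA; congr (_ * _).
    by rewrite /mv /Mv mulr_sumr; apply: eq_bigr => l _; rewrite mxE mulrA.
  rewrite /hess_form -dotZ -dotD -dotB; apply: eq_bigr => k _; rewrite /w /E; ring.
have Qy : nrm (qn p s n) <= kap^-1 * y n by exact: (nrm_le_dot al0 hA).
have Q0' : 0 <= nrm (qn p s n) by exact: nrm_ge0.
have X0 : 0 <= nrm (xn p s n) by apply: nrm_ge0 => k; have /andP[] := xn_cube hK cs n k.
have wE : `|dot w E| <= 2^-1 * e * y n ^+ 2.
  apply: (@le_trans _ _ (C * nrm (xn p s n) * y n ^+ 2)); last first.
    by rewrite ler_wpM2r ?exprn_ge0 // mulrC -ler_pdivlMr.
  apply: (@le_trans _ _ (d%:R * (kap^-1 * (K3 * nrm (xn p s n) * nrm (qn p s n) ^+ 2)))).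
    rewrite (le_trans (norm_dot _ _)) // -sum_const_ord ler_sum // => k _.
    rewrite ler_pM // ?err // /w; have /andP[s0 s1] := cs k.
    by rewrite ger0_norm ?mulr_ge0 ?(ltW (v0 k)) // (le_trans _ (vle k)) // ler_piMr // ltW.
  have -> : C * nrm (xn p s n) * y n ^+ 2 =
      d%:R * (kap^-1 * (K3 * nrm (xn p s n) * (kap^-1 * y n) ^+ 2)) by rewrite /C; ring.
  rewrite !ler_wpM2l ?(ltW dp) ?(ltW kV) ?(mulr_ge0 (ltW K3p) X0) //.
  by rewrite lerXn2r ?nnegrE // mulr_ge0 // ltW.
have -> : y n.+1 - jac_root p s * y n + Qc p * y n ^+ 2 =
   dot w E - 2^-1 * (hess_form p w (qn p s n) (qn p s n) - 2 * Qc p * (y n * y n)) by rewrite yS; field.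
rewrite (le_trans (ler_normB _ _)) // normrM (ger0_norm (ltW half0)).
have h4 : `|hess_form p w (qn p s n) (qn p s n) - 2 * Qc p * (y n * y n)| <= e * (y n * y n) := h3.
move: wE h4; rewrite expr2; lra.
Unshelve. all: by end_near. Qed.

End Recursion.

(** The form of (1 - r^n)/(1 - r) that keeps its meaning at r = 1. *)
Definition gsum (R : realType) (r : R) (n : nat) : R := \sum_(i < n) r ^+ i.

(** * Solution of a perturbed scalar quadratic recursion *)

Section Scalar.
Variable R : realType.
Implicit Types (r Q K : R) (y : nat -> R) (n m N : nat).

Lemma gsumS r n : gsum r n.+1 = gsum r n + r ^+ n.
Proof. by rewrite /gsum big_ord_recr. Qed.

Lemma gsum_geo r n : (1 - r) * gsum r n = 1 - r ^+ n.
Proof.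
elim: n => [|n IH]; first by rewrite /gsum big_ord0 expr0 mulr0 subrr.
by rewrite gsumS mulrDr IH exprS; ring.
Qed.

Lemma gsum_le r n m : 0 <= r -> (n <= m)%N -> gsum r n <= gsum r m.
Proof.
move=> r0 /subnK <-; elim: (m - n)%N => [|j IH] //.
by rewrite addSn gsumS (le_trans IH) // lerDl exprn_ge0.
Qed.

Lemma gsum_ub r n : 0 <= r -> r <= 1 -> gsum r n <= n%:R.
Proof.
move=> r0 r1; rewrite -[leRHS]mulr1 -sum_const_ord; apply: ler_sum => i _.
exact: exprn_ile1.
Qed.

Lemma gsum_lb r n : 0 <= r -> r <= 1 -> n%:R * r ^+ n <= gsum r n.
Proof.
move=> r0 r1; rewrite -sum_const_ord; apply: ler_sum => i _.
by rewrite ler_wiXn2l // ltnW.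
Qed.

Lemma inv_close (om g : R) : g <= 2^-1 -> `|om - 1| <= g -> 0 < om /\ `|om^-1 - 1| <= 2 * g.
Proof.
move=> g2 h; have om2 : 2^-1 <= om by move: h; rewrite ler_norml => /andP[]; lra.
have om0 : 0 < om by apply: lt_le_trans om2; rewrite invr_gt0.
split=> //; have -> : om^-1 - 1 = (1 - om) * om^-1 by field; rewrite gt_eqF.
rewrite normrM distrC [2 * g]mulrC ler_pM // gtr0_norm ?invr_gt0 // invf_ple ?posrE //.
Qed.

(* With w n = r ^ n / y n the quadratic recursion becomes w (n+1) - w n = Q r ^ n (1 + o(1)). *)
Lemma scalar_asym (Q0 Q1 e : R) : 0 < Q0 -> 0 <= Q1 -> 0 < e -> exists2 e' : R, 0 < e' &
  forall N0 K, 0 <= K -> exists N1, exists2 dl : R, 0 < dl & forall y r Q,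
  Q0 <= Q <= Q1 -> (forall n, 0 < y n) -> (forall n, y n.+1 <= y n) -> r <= 1 -> `|r - 1| <= dl -> (y N0)^-1 <= K ->
  (forall n, (N0 <= n)%N -> y n <= e') ->
  (forall n, (N0 <= n)%N -> `|y n.+1 - r * y n + Q * y n ^+ 2| <= e' * y n ^+ 2) ->
  forall n, (N1 <= n)%N -> 0 < gsum r n /\
    `|(y n - y n.+1) * (Q * gsum r n ^+ 2 / r ^+ n) - 1| <= e.
Proof.
move=> Q00 Q10 e0.
pose B := 2 + 2 * (Q1 + 2) ^+ 2.
have B0 : 0 < B by rewrite /B ltr_wpDr // mulr_ge0 // exprn_ge0 // addr_ge0.
pose H := (6 * (B + 1) + 4) / Q0.
have B1 : 0 < B + 1 by lra.
have H0 : 0 < H by rewrite /H divr_gt0 //; lra.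
pose e' := Num.min (Num.min 1 (2^-1 / (Q1 + 2))) (Num.min (e / H) (2^-1 / ((B + 1) / Q0))).
have q2 : 0 < Q1 + 2 by lra.
have e'0 : 0 < e'.
  have h20 : (0 : R) < 2^-1 by rewrite invr_gt0.
  have p1 : 0 < 2^-1 / (Q1 + 2) by exact: divr_gt0.
  have p2 : 0 < e / H by exact: divr_gt0.
  have p3 : 0 < 2^-1 / ((B + 1) / Q0) by exact: divr_gt0 _ (divr_gt0 _ _).
  by rewrite /e' !lt_min ltr01 p1 p2 p3.
have [f1 f2 f3 f4] : [/\ e' <= 1, e' * (Q1 + 2) <= 2^-1, e' * H <= e & e' * ((B + 1) / Q0) <= 2^-1].
  have p0 : 0 < (B + 1) / Q0 by exact: divr_gt0.
  by split; rewrite -?ler_pdivlMr // /e' !ge_min !lexx ?orbT.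
clearbody e'; exists e' => // N0 K K0.
(* Once the geometric sum exceeds L, the initial terms w(N0) <= K and Q gsum(N0) <= Q1 N0 are at
   most e' times it. The condition r^m >= 1/2 with m >= 2L ensures this for all n >= m. *)
pose L := (K + Q1 * N0%:R) / e'.
have L0 : 0 <= L by rewrite /L divr_ge0 ?addr_ge0 ?mulr_ge0 // ltW.
pose m := (Num.Def.archi_bound (2 * L)).
have mL : 2 * L <= m%:R by apply/ltW/archi_boundP; rewrite mulr_ge0.
have [dl1 dl10 hdl1] := @pow_near1 R m 2^-1 ltac:(by rewrite invr_gt0).
exists (maxn (maxn N0 m) 1); exists (Num.min dl1 (Num.min e' 2^-1)).
  by rewrite !lt_min dl10 e'0 invr_gt0 ltr0n.
move=> y r Q /andP[hQ0 hQ1] y0 yd r1; rewrite !le_min => /and3P[rd1 rd2 rd3] yK ye hy n.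
rewrite !geq_max => /andP[/andP[nN0 nm] n1].
have r2 : 2^-1 <= r by move: rd3; rewrite ler_norml => /andP[]; lra.
have r0 : 0 < r by lra.
have Qp : 0 < Q by lra.
pose w i := r ^+ i / y i.
have w0 i : 0 < w i by rewrite divr_gt0 ?exprn_gt0.
pose de i := (r * y i - y i.+1) / y i ^+ 2 - Q.
have yne i : y i != 0 by rewrite gt_eqF.
have hde i : (N0 <= i)%N -> `|de i| <= e'.
  move=> Ni; have -> : de i = - (y i.+1 - r * y i + Q * y i ^+ 2) / y i ^+ 2.
    by rewrite /de; field.
  rewrite mulNr normrN normrM normfV (ger0_norm (sqr_ge0 _)) ler_pdivrMr ?exprn_gt0 //.
  exact: hy.
have hS i : y i.+1 = y i * (r - (Q + de i) * y i) by rewrite /de; field.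
(* With a = y(i+1)/y(i), which lies within (Q1 + 2) e' of 1, the increment of w equals r^i (Q +
   de)/a. *)
have hw i : (N0 <= i)%N -> `|w i.+1 - w i - Q * r ^+ i| <= B * e' * r ^+ i.
  move=> Ni; have hd := hde _ Ni; have hye := ye _ Ni.
  set a := r - (Q + de i) * y i.
  have aE : y i.+1 = y i * a := hS i.
  have a0 : 0 < a by rewrite -(pmulr_rgt0 _ (y0 i)) -aE.
  have hdd : - e' <= de i <= e' by rewrite -ler_norml.
  have h1 : (Q + de i) * y i <= (Q1 + 1) * e'.
    apply: (@le_trans _ _ ((Q1 + 1) * y i)); first by rewrite ler_wpM2r ?(ltW (y0 i)) //; move: hdd hQ1 f1; clear => /andP[]; lra.
    by rewrite ler_wpM2l //; move: Q10; clear; lra.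
  have ai : 1 - (Q1 + 2) * e' <= a.
    by move: rd2 h1; rewrite /a ler_norml => /andP[]; clear; lra.
  have a2 : 2^-1 <= a by move: ai f2; clear; lra.
  have ainv : a^-1 <= 1 + 2 * ((Q1 + 2) * e').
    rewrite -[a^-1]mul1r ler_pdivrMr //.
    have : 0 <= (Q1 + 2) * e' by rewrite mulr_ge0 // ltW.
    move: (_ * e') ai f2 a2 ; clear => t ai f2 a2 t0; nra.
  have a1 : a <= 1 by rewrite -(ler_pM2l (y0 i)) mulr1 -aE.
  have ainv1 : 1 <= a^-1 by rewrite invf_ge1.
  have ainv2 : a^-1 <= 2 by rewrite invf_ple ?posrE.
  have -> : w i.+1 - w i - Q * r ^+ i = r ^+ i * ((Q + de i) / a - Q).
    rewrite /w aE exprS /a; field.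
    by rewrite yne -/a gt_eqF.
  rewrite normrM (gtr0_norm (exprn_gt0 _ r0)) mulrC ler_wpM2r ?exprn_ge0 ?(ltW r0) //.
  have -> : (Q + de i) / a - Q = de i * a^-1 + Q * (a^-1 - 1) by ring.
  rewrite (le_trans (ler_normD _ _)) // !normrM (gtr0_norm Qp) (ger0_norm (_ : 0 <= a^-1 - 1)) ?subr_ge0 //.
  have h2 : `|de i| * `|a^-1| <= e' * 2.
    by rewrite ler_pM // ger0_norm // (le_trans ler01).
  have h3 : Q * (a^-1 - 1) <= (Q1 + 2) * (2 * ((Q1 + 2) * e')) by rewrite ler_pM ?(ltW Qp) ?subr_ge0 //; [move: hQ1 | move: ainv]; clear; lra.
  by move: h2 h3; rewrite /B; clear; lra.
have wsum i : (N0 <= i)%N -> `|w i - w N0 - Q * (gsum r i - gsum r N0)| <= B * e' * (gsum r i - gsum r N0).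
  move=> /subnK <-; elim: (i - N0)%N => [|j IH]; first by rewrite add0n !subrr !mulr0 subr0 normr0.
  rewrite addSn gsumS; have := hw (j + N0)%N (leq_addl _ _).
  have -> : w (j + N0).+1 - w N0 - Q * (gsum r (j + N0) + r ^+ (j + N0) - gsum r N0) =
    (w (j + N0) - w N0 - Q * (gsum r (j + N0) - gsum r N0)) +
    (w (j + N0).+1 - w (j + N0) - Q * r ^+ (j + N0)) by ring.
  by move=> h; rewrite (le_trans (ler_normD _ _)) // (le_trans (lerD IH h)) //; clear; lra.
set S := gsum r n.
have SN0 : gsum r N0 <= N0%:R by exact: gsum_ub (ltW r0) r1.
have SN00 : 0 <= gsum r N0 by apply: sumr_ge0 => i _; rewrite exprn_ge0 // ltW.
have SL : L <= S.
  apply: le_trans (gsum_le (ltW r0) nm); apply: le_trans (gsum_lb m (ltW r0) r1).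
  have hm : 2^-1 <= r ^+ m by have := hdl1 r rd1; clear; rewrite ler_norml => /andP[]; lra.
  apply: (@le_trans _ _ (m%:R * 2^-1)); last by rewrite ler_wpM2l.
  by move: mL; clear; rewrite ler_pdivlMr //; lra.
have S1 : 1 <= S.
  by apply: le_trans (gsum_le (ltW r0) n1); rewrite /gsum big_ord1 expr0.
have Sp : 0 < S by exact: lt_le_trans S1.
have LS : K + Q1 * N0%:R <= e' * S.
  by move: SL; rewrite /L ler_pdivrMr // [S * _]mulrC.
have wN0 : w N0 <= K.
  rewrite (le_trans _ yK) // /w ler_piMl ?invr_ge0 ?(ltW (y0 _)) //.
  by rewrite exprn_ile1 // ltW.
have QN0 : Q * gsum r N0 <= Q1 * N0%:R by rewrite ler_pM // ltW.
have QN00 : 0 <= Q * gsum r N0 by rewrite mulr_ge0 // ltW.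
have wn : `|w n - Q * S| <= (B + 1) * e' * S.
  have := wsum n nN0; rewrite -/S.
  have -> : w n - Q * S = (w n - w N0 - Q * (S - gsum r N0)) + (w N0 - Q * gsum r N0) by ring.
  move=> h; rewrite (le_trans (ler_normD _ _)) // .
  have h2 : `|w N0 - Q * gsum r N0| <= e' * S.
    by rewrite ler_norml; apply/andP; split; move: (w0 N0) wN0 QN0 QN00 LS K0; clear; lra.
  have h3 : B * e' * (S - gsum r N0) <= B * e' * S by rewrite ler_wpM2l ?mulr_ge0 ?(ltW B0) ?(ltW e'0) // lerBlDr lerDl.
  move: h h2 h3; clear; lra.
pose om := w n / (Q * S).
have QS0 : 0 < Q * S by rewrite mulr_gt0.
have omc : `|om - 1| <= e' * ((B + 1) / Q0).
  have -> : om - 1 = (w n - Q * S) / (Q * S) by rewrite /om; field; rewrite !gt_eqF.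
  rewrite normrM normfV (gtr0_norm QS0) ler_pdivrMr //; apply: le_trans wn _.
  have -> : (B + 1) * e' * S = e' * ((B + 1) / Q0) * (Q0 * S) by field; rewrite gt_eqF.
  apply: ler_wpM2l; last by rewrite ler_pM2r.
  by apply: mulr_ge0; [exact: ltW | exact/ltW/divr_gt0].
have [om0 omi] := inv_close f4 omc.
set g := e' * ((B + 1) / Q0) in f4 omc omi.
split=> //.
have rn0 : 0 < r ^+ n by rewrite exprn_gt0.
have rn1 : r ^+ n <= 1 by rewrite exprn_ile1 // ltW.
have hdn := hde n nN0.
pose X := r ^+ n * ((1 + de n / Q) * om^-1 - 1).
(* Writing y_n = r^n/(om Q S), the identity (1 - r) S + r^n = 1 merges the linear and quadratic
   parts of the increment. This is why no distinction on the size of n(1 - r) is required. *)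
have -> : (y n - y n.+1) * (Q * S ^+ 2 / r ^+ n) - 1 = (om^-1 - 1) + om^-1 * X.
  have yE : y n = r ^+ n / (om * (Q * S)).
    rewrite /om /w; field; rewrite yne !gt_eqF //.
  have geo : r ^+ n = 1 - (1 - r) * S by rewrite gsum_geo; ring.
  have E : y n - y n.+1 = y n * ((1 - r) + (Q + de n) * y n) by rewrite hS; ring.
  rewrite E yE /X.
  have -> : om^-1 - 1 + om^-1 * (r ^+ n * ((1 + de n / Q) * om^-1 - 1)) =
    om^-1 * ((1 - r ^+ n) + r ^+ n * (1 + de n / Q) * om^-1) - 1 by ring.
  rewrite -gsum_geo -/S; field.
  by rewrite !gt_eqF.
have hdQ : `|de n / Q| <= e' / Q0.
  rewrite normrM normfV (gtr0_norm Qp) ler_pM ?invr_ge0 ?(ltW Qp) //.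
  by rewrite lef_pV2 ?posrE.
have om2 : om^-1 <= 2 by move: omi f4; clear; rewrite ler_norml => /andP[_]; lra.
have hX : `|X| <= 2 * g + e' / Q0 * 2.
  rewrite /X normrM (gtr0_norm rn0).
  have -> : (1 + de n / Q) * om^-1 - 1 = (om^-1 - 1) + de n / Q * om^-1 by ring.
  rewrite -[leRHS]mul1r ler_pM ?(ltW rn0) //.
  rewrite (le_trans (ler_normD _ _)) // lerD // normrM ler_pM //.
  by rewrite ger0_norm // invr_ge0 ltW.
rewrite (le_trans (ler_normD _ _)) // normrM (gtr0_norm (_ : 0 < om^-1)) ?invr_gt0 //.
have hX2 : om^-1 * `|X| <= 2 * (2 * g + e' / Q0 * 2).
  by rewrite ler_pM // invr_ge0 ltW.
have hH : e' * H = 6 * g + 4 * (e' * Q0^-1) by rewrite /H /g; field; rewrite gt_eqF.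
move: hX2 hH f3 omi; clear; lra.
Qed.
End Scalar.

(** * Uniform asymptotics of the increments *)

Section Asymptotics.
Variables (R : realType) (d : nat) (a b c : R) (U : nat).
Hypotheses (d1 : (1 <= d)%N) (a0 : 0 < a) (b0 : 0 < b) (c0 : 0 < c) (U1 : (1 <= U)%N).
Local Notation vec := ('I_d -> R).
Local Notation inK := (inK a b c U).
Local Notation K3 := (remainder_const c).
Local Notation al := (a / 2).
Local Notation kap := (kap U al).
Local Notation near_critical := (near_critical (d := d) a b c U).
Local Notation crit := (crit a b c U).
Implicit Types (p : offspring R d) (s t x y z q w u v : vec) (n m N : nat) (k l : 'I_d) (e : R).

Let al0 : 0 < al. Proof. by rewrite divr_gt0. Qed.
Let k0 : 0 < kap. Proof. exact: kap_gt0. Qed.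
Let kV : 0 < kap^-1. Proof. by rewrite invr_gt0. Qed.
Let dR : 1 <= d%:R :> R. Proof. by rewrite ler1n. Qed.
Let dp : 0 < d%:R :> R. Proof. exact: lt_le_trans dR. Qed.
Let K30 : 1 <= K3. Proof. by rewrite /remainder_const; have := c0; lra. Qed.
Let K3p : 0 < K3. Proof. exact: lt_le_trans K30. Qed.
Let half0 : 0 < 2^-1 :> R. Proof. by rewrite invr_gt0. Qed.

Section Gap.
Variables (p : offspring R d) (s : vec).
Hypotheses (hK : inK p) (cs : cube s).
Let hp : is_offspring p. Proof. by have [] := hK. Qed.

Lemma qn_ge0 n k : 0 <= qn p s n k.
Proof. by rewrite subr_ge0 hn_le_hstar. Qed.

Lemma Dn_ge0 n k : 0 <= Dn p s n k.
Proof. by rewrite subr_ge0 hn_leS. Qed.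

Lemma yn_diff n : yn p s n - yn p s n.+1 = dot (jac_v p s) (Dn p s n).
Proof. by rewrite /yn -dotB; apply: eq_bigr => k _; rewrite /qn /Dn; congr (_ * _); ring. Qed.

Lemma yn_cvg0 : yn p s @ \oo --> (0 : R).
Proof.
have h k : (fun n => jac_v p s k * qn p s n k) @ \oo --> jac_v p s k * 0.
  by apply: cvgM; [exact: cvg_cst | exact: hstar_gap].
have := cvg_sumr h.
have -> : \sum_k jac_v p s k * 0 = 0 by rewrite big1 // => k _; rewrite mulr0.
exact.
Qed.

End Gap.

(** [scalar_asym] needs a uniform bound on 1/y at a fixed starting time, when y is not yet small. As
    f is monotone, f(hstar) - f(h_n) is at least the increment of f along tau times the gap, and for
    small tau the linear part of that increment dominates. *)
Lemma near_lower : exists2 k1 : R, 0 < k1 & \forall ps \near near_critical,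
  k1 <= yn ps.1 ps.2 0 /\ forall n, k1 * yn ps.1 ps.2 n <= yn ps.1 ps.2 n.+1.
Proof.
pose E := K3 * (d%:R ^+ 2 + d%:R).
have E0 : 0 < E by apply: (mulr_gt0 K3p); rewrite addr_gt0 ?exprn_gt0.
pose C := d%:R * kap^-1 * E * (d%:R * kap^-1).
have C0 : 0 < C by exact: mulr_gt0 (mulr_gt0 (mulr_gt0 dp kV) E0) (mulr_gt0 dp kV).
(* The linear part is at least tau y/2 because the root is at least 1/2; this choice keeps the
   remainder below tau y/4. *)
pose tau := Num.min 1 (4^-1 / C).
have t0 : 0 < tau by rewrite lt_min ltr01 divr_gt0 // invr_gt0.
have t1 : tau <= 1 by rewrite ge_min lexx.
have tC : tau * C <= 4^-1 by rewrite -ler_pdivlMr // ge_min lexx orbT.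
clearbody tau; exists (Num.min (tau / 4) (kap / 2)); first by rewrite lt_min !divr_gt0.
near=> ps.
have [hK r1 cs _] : crit 2^-1 ps by near: ps; exact: near_crit.
have hh : nrm (defect (hstar ps.1 ps.2)) <= 2^-1 by near: ps; exact: near_hstar.
have [hA ra _ _] : [/\ primitive_class U al K3 (jac ps.1 ps.2) (jac_root ps.1 ps.2) (jac_u ps.1 ps.2) (jac_v ps.1 ps.2),
    `|jac_root ps.1 ps.2 - 1| <= 2^-1, forall k, `|jac_u ps.1 ps.2 k - uvec ps.1 k| <= 2^-1 &
    forall k, `|jac_v ps.1 ps.2 k - vvec ps.1 k| <= 2^-1] by near: ps; exact: near_triple.
have [hp _] := hK.
set p := ps.1 in hK r1 hh hA ra hp *; set s := ps.2 in cs hh hA ra *.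
have [_ _ [u0 v0 uA vA [u1 uv]] _] := hA.
have ch := hstar_cube hp cs.
have vle k : jac_v p s k <= kap^-1 by exact: (v_le al0 hA).
have q0 n k := qn_ge0 hK cs n k.
have qh n k : qn p s n k <= hstar p s k.
  by rewrite /qn lerBlDr lerDl; have /andP[] := hn_cube hp n cs k.
split.
  have kk : 'I_d by case: (d) d1 => // d' _; exact: ord0.
  have h0 l : 0 <= hstar p s l by have /andP[] := ch l.
  have dh l : 0 <= defect (hstar p s) l by have /andP[] := defect_cube ch l.
  have h1 : 2^-1 <= nrm (hstar p s).
    apply: le_trans (nrm_ge kk h0); have := le_trans (nrm_ge kk dh) hh.
    by rewrite /defect; lra.
  have h2 : yn p s 0 = dot (jac_v p s) (hstar p s).
    by apply: eq_bigr => l _; rewrite /qn /= subr0.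
  apply: (@le_trans _ _ (kap / 2)); first by rewrite ge_min lexx orbT.
  have := nrm_le_dot al0 hA h0; rewrite -h2 -ler_pdivrMl ?invr_gt0 // invrK => h3.
  by apply: le_trans h3; rewrite ler_wpM2l // ltW.
move=> n; set y := yn p s.
have y0 : 0 <= y n by apply: dot_ge0 => // k; exact: ltW.
have Qy : nrm (qn p s n) <= kap^-1 * y n by exact: (nrm_le_dot al0 hA).
have Qd : nrm (qn p s n) <= d%:R.
  by apply: nrm_le_d => k; rewrite q0 (le_trans (qh n k)) //; have /andP[] := ch k.
have QQ0 : 0 <= nrm (qn p s n) by exact: nrm_ge0.
have QQ : nrm (qn p s n) ^+ 2 <= d%:R * kap^-1 * y n.
  by rewrite expr2 -mulrA ler_pM.
pose tq : vec := fun l => tau * qn p s n l.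
have tq0 l : 0 <= tq l by rewrite mulr_ge0 // ltW.
have tqq l : tq l <= qn p s n l by rewrite ler_piMl.
have tqh l : tq l <= hstar p s l by apply: le_trans (tqq l) (qh n l).
have ntq : nrm tq = tau * nrm (qn p s n) by rewrite /nrm mulr_sumr.
have key k : tau * Mv p (hstar p s) (qn p s n) k - E * tau ^+ 2 * nrm (qn p s n) ^+ 2 <=
    pgf p k (hstar p s) - pgf p k (hn p n s).
  have T := pgf_taylor hp hK k ch tq0 tqh.
  set h' := (fun l => hstar p s l - tq l) in T.
  have w1 : nrm (fun l => 1 - h' l) <= d%:R by exact: (defect_le_d ch tq0 tqh).
  have tn l : `|tq l| <= nrm tq by rewrite ger0_norm // nrm_ge.
  have B1 := Bq_bound hK k tn tn.
  have Me : Mv p (hstar p s) tq k = tau * Mv p (hstar p s) (qn p s n) k.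
    by rewrite /Mv mulr_sumr; apply: eq_bigr => l _; rewrite mulrCA.
  have f1 : pgf p k (hn p n s) <= pgf p k h'.
    apply: pgf_mono => //; [exact: hn_cube | | ].
      move=> l; rewrite /h' subr_ge0 tqh /=; have /andP[_ h1] := ch l.
      by rewrite lerBlDr (le_trans h1) // lerDl.
    by move=> l; rewrite /h'; have := tqq l; rewrite /qn; lra.
  have h3 : K3 * nrm (fun l => 1 - h' l) * nrm tq ^+ 2 <= K3 * d%:R * nrm tq ^+ 2.
    by rewrite ler_wpM2r ?exprn_ge0 ?nrm_ge0 // ler_wpM2l // ltW.
  have h4 : 0 <= d%:R ^+ 2 * K3 * (nrm tq * nrm tq).
    by rewrite !mulr_ge0 ?exprn_ge0 ?nrm_ge0 // ltW.
  have -> : E * tau ^+ 2 * nrm (qn p s n) ^+ 2 =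
     d%:R ^+ 2 * K3 * (nrm tq * nrm tq) + K3 * d%:R * nrm tq ^+ 2 by rewrite /E ntq; ring.
  move: T B1; rewrite Me !ler_norml => /andP[T1 _] /andP[_ B1]; lra.
have hrs : 2^-1 <= jac_root p s by move: ra; rewrite ler_norml => /andP[]; lra.
have big : tau * (jac_root p s * y n) - d%:R * (kap^-1 * (E * tau ^+ 2 * nrm (qn p s n) ^+ 2)) <= y n.+1.
  have -> : jac_root p s * y n = \sum_k jac_v p s k * (s k * Mv p (hstar p s) (qn p s n) k).
    have -> : jac_root p s * y n = dot (jac_v p s) (mv (jac p s) (qn p s n)).
      by rewrite dot_mv (_ : vm (jac_v p s) (jac p s) = fun k => jac_root p s * jac_v p s k) ?dotZl //; apply/funext.
    apply: eq_bigr => k _; congr (_ * _).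
    by rewrite /mv /Mv mulr_sumr; apply: eq_bigr => l _; rewrite mxE mulrA.
  rewrite /y (yn_step _ hK cs) mulr_sumr -sum_const_ord -sumrB; apply: ler_sum => k _.
  have /andP[s0 s1] := cs k.
  set G := E * _ * _; have G0 : 0 <= G by rewrite /G !mulr_ge0 ?exprn_ge0 // ltW.
  apply: (@le_trans _ _ (jac_v p s k * (s k * (tau * Mv p (hstar p s) (qn p s n) k - G)))); last first.
    by rewrite ler_wpM2l ?(ltW (v0 k)) // ler_wpM2l // key.
  have : jac_v p s k * s k * G <= kap^-1 * G.
    by rewrite ler_wpM2r // (le_trans _ (vle k)) // ler_piMr // ltW.
  lra.
apply: (@le_trans _ _ (tau / 4 * y n)); first by rewrite ler_wpM2r // ge_min lexx.
apply: le_trans big.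
have h5 : d%:R * (kap^-1 * (E * tau ^+ 2 * nrm (qn p s n) ^+ 2)) <= tau * (tau * C) * y n.
  have -> : tau * (tau * C) * y n = d%:R * (kap^-1 * (E * tau ^+ 2 * (d%:R * kap^-1 * y n))).
    by rewrite /C; ring.
  apply: ler_wpM2l => //; apply: ler_wpM2l; first exact: ltW.
  by apply: ler_wpM2l => //; apply: mulr_ge0; [exact: ltW | exact: exprn_ge0 (ltW _)].
have h6 : tau * (tau * C) * y n <= tau * 4^-1 * y n by rewrite ler_wpM2r // ler_wpM2l // ltW.
have h7 : tau * (2^-1 * y n) <= tau * (jac_root p s * y n).
  by rewrite ler_wpM2l ?(ltW t0) // ler_wpM2r.
lra.
Unshelve. all: by end_near. Qed.

Lemma near_yn_gt0 : \forall ps \near near_critical, forall n, 0 < yn ps.1 ps.2 n.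
Proof.
have [k1 k10 hk] := near_lower; near=> ps.
have [h0 hS] : k1 <= yn ps.1 ps.2 0 /\ forall n, k1 * yn ps.1 ps.2 n <= yn ps.1 ps.2 n.+1 by near: ps.
elim=> [|n IH]; first exact: lt_le_trans h0.
by apply: lt_le_trans (hS n); rewrite mulr_gt0.
Unshelve. all: by end_near. Qed.

(** The coordinates y_n decrease, so dividing the recursion by y_n gives r <= 1 + (Q + 1) y_n, and
    y_n tends to 0. *)
Lemma near_jac_root_le1 : \forall ps \near near_critical, 2^-1 <= jac_root ps.1 ps.2 <= 1.
Proof.
have [N hN] := near_rec d1 a0 b0 c0 U1 ltr01; near=> ps.
have [hK r1 cs _] : crit 2^-1 ps by near: ps; exact: near_crit.
have [hA ra _ _] : [/\ primitive_class U al K3 (jac ps.1 ps.2) (jac_root ps.1 ps.2) (jac_u ps.1 ps.2) (jac_v ps.1 ps.2),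
    `|jac_root ps.1 ps.2 - 1| <= 2^-1, forall k, `|jac_u ps.1 ps.2 k - uvec ps.1 k| <= 2^-1 &
    forall k, `|jac_v ps.1 ps.2 k - vvec ps.1 k| <= 2^-1] by near: ps; exact: near_triple.
have y0 : forall n, 0 < yn ps.1 ps.2 n by near: ps; exact: near_yn_gt0.
have hr : forall n, (N <= n)%N ->
  `|yn ps.1 ps.2 n.+1 - jac_root ps.1 ps.2 * yn ps.1 ps.2 n + Qc ps.1 * yn ps.1 ps.2 n ^+ 2|
    <= 1 * yn ps.1 ps.2 n ^+ 2 by near: ps.
have [_ _ [_ v0 _ _ _] _] := hA.
apply/andP; split; first by move: ra; rewrite ler_norml => /andP[]; lra.
set y := yn ps.1 ps.2 in y0 hr *.
have yd n : y n.+1 <= y n.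
  rewrite -subr_ge0 yn_diff; apply: dot_ge0 => k; first exact: ltW.
  exact: Dn_ge0.
have lim1 : (fun n => 1 + (Qc ps.1 + 1) * y n) @ \oo --> (1 : R).
  have E : 1 + (Qc ps.1 + 1) * 0 = 1 :> R by rewrite mulr0 addr0.
  rewrite -[X in _ --> X]E; apply: cvgD; first exact: cvg_cst.
  by apply: cvgM; [exact: cvg_cst | exact: (yn_cvg0 hK cs)].
apply: (cvgr_to_ge lim1); near=> n.
have Nn : (N <= n)%N by near: n; exact: nbhs_infty_ge.
have := hr n Nn; rewrite mul1r ler_norml => /andP[h1 _].
rewrite -(ler_pM2r (y0 n)); have := yd n; lra.
Unshelve. all: by end_near. Qed.

(** [scalar_asym] describes y_n - y_(n+1), which is the coordinate of [Dn]; alignment of [Dn] turns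
    it into each component through the factor u_k. *)
Lemma near_main e : 0 < e -> exists N, \forall ps \near near_critical, forall n, (N <= n)%N ->
  0 < gsum (jac_root ps.1 ps.2) n /\
  forall k, `|Dn ps.1 ps.2 n k * (Qc ps.1 * gsum (jac_root ps.1 ps.2) n ^+ 2 /
     (uvec ps.1 k * jac_root ps.1 ps.2 ^+ n)) - 1| <= e.
Proof.
move=> e0.
have e20 : 0 < e / 2 by rewrite divr_gt0.
have Q10 : 0 <= Q1 d a c U.
  by rewrite /Q1; apply: mulr_ge0; [exact: mulr_ge0 (exprn_ge0 _ _) (ltW K3p) | exact: ltW].
have [e1 e10 hsc] := scalar_asym (Q0_gt0 U a0 b0) Q10 e20.
pose e2 := kap * (e / 2) / (1 + e).
have e20' : 0 < e2 by rewrite /e2 divr_gt0 ?mulr_gt0 ?addr_gt0.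
have [d2 d20 hR] := realign d b c U a0 e20'.
have [N1 hN1] := near_rec d1 a0 b0 c0 U1 e10.
have [N2 hN2] := near_aligned U d1 a0 b0 c0 d20.
pose e3 := kap * e1.
have e30 : 0 < e3 by rewrite mulr_gt0.
have [N3 hN3] := near_small U d1 a0 b0 c0 e30.
have [k1 k10 hk] := near_lower.
pose N0 := maxn N1 N3.
(* By [near_lower], y_0 >= k1 and each step loses at most a factor k1. *)
pose K := (k1 ^+ N0.+1)^-1.
have K0 : 0 <= K by rewrite invr_ge0 exprn_ge0 // ltW.
have [N4 [dl dl0 hs]] := hsc N0 K K0.
exists (maxn N2 N4); near=> ps => n Nn.
have [n2 n4] : (N2 <= n)%N /\ (N4 <= n)%N by apply/andP; rewrite -geq_max.
have [hK r1 cs _] : crit 2^-1 ps by near: ps; exact: near_crit.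
have [hA _ _ _] : [/\ primitive_class U al K3 (jac ps.1 ps.2) (jac_root ps.1 ps.2) (jac_u ps.1 ps.2) (jac_v ps.1 ps.2),
    `|jac_root ps.1 ps.2 - 1| <= 1, forall k, `|jac_u ps.1 ps.2 k - uvec ps.1 k| <= 1 &
    forall k, `|jac_v ps.1 ps.2 k - vvec ps.1 k| <= 1] by near: ps; exact: near_triple.
have [_ ra _ _] : [/\ primitive_class U al K3 (jac ps.1 ps.2) (jac_root ps.1 ps.2) (jac_u ps.1 ps.2) (jac_v ps.1 ps.2),
    `|jac_root ps.1 ps.2 - 1| <= dl, forall k, `|jac_u ps.1 ps.2 k - uvec ps.1 k| <= dl &
    forall k, `|jac_v ps.1 ps.2 k - vvec ps.1 k| <= dl] by near: ps; exact: near_triple.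
have [_ _ _ va] : [/\ primitive_class U al K3 (jac ps.1 ps.2) (jac_root ps.1 ps.2) (jac_u ps.1 ps.2) (jac_v ps.1 ps.2),
    `|jac_root ps.1 ps.2 - 1| <= d2, forall k, `|jac_u ps.1 ps.2 k - uvec ps.1 k| <= d2 &
    forall k, `|jac_v ps.1 ps.2 k - vvec ps.1 k| <= d2] by near: ps; exact: near_triple.
have y0 : forall n, 0 < yn ps.1 ps.2 n by near: ps; exact: near_yn_gt0.
have /andP[rs2 rs1] : 2^-1 <= jac_root ps.1 ps.2 <= 1 by near: ps; exact: near_jac_root_le1.
have [yk0 ykS] : k1 <= yn ps.1 ps.2 0 /\ forall n, k1 * yn ps.1 ps.2 n <= yn ps.1 ps.2 n.+1 by near: ps.
have hr : forall n, (N1 <= n)%N ->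
  `|yn ps.1 ps.2 n.+1 - jac_root ps.1 ps.2 * yn ps.1 ps.2 n + Qc ps.1 * yn ps.1 ps.2 n ^+ 2|
    <= e1 * yn ps.1 ps.2 n ^+ 2 by near: ps.
have [hD _] : aligned d2 ps.1 (Dn ps.1 ps.2 n) /\ aligned d2 ps.1 (qn ps.1 ps.2 n).
  by move: n n2 {n4 Nn}; near: ps.
have hx : forall n, (N3 <= n)%N -> nrm (xn ps.1 ps.2 n) <= e3 by near: ps.
have [hp _] := hK.
set p := ps.1 in hK r1 hA ra va y0 rs1 rs2 yk0 ykS hr hD hx hp *.
set s := ps.2 in cs hA ra va y0 rs1 rs2 yk0 ykS hr hD hx *.
have [_ _ [u0 v0 uA vA [u1 uv]] _] := hA.
set y := yn p s in y0 yk0 ykS hr.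
have yd m : y m.+1 <= y m.
  rewrite -subr_ge0 yn_diff; apply: dot_ge0 => k; first exact: ltW.
  exact: Dn_ge0.
have ylow m : k1 ^+ m.+1 <= y m.
  elim: m => [|m IH] //; apply: le_trans (ykS m).
  by rewrite exprS ler_wpM2l // ltW.
have yK : (y N0)^-1 <= K by rewrite lef_pV2 ?posrE ?exprn_gt0.
have ye m : (N0 <= m)%N -> y m <= e1.
  rewrite geq_max => /andP[_ m3].
  have q0 k : 0 <= qn p s m k by exact: qn_ge0.
  apply: le_trans (dot_le_nrm al0 hA q0) _; rewrite ler_pdivrMl //.
  apply: le_trans (hx m m3); apply: ler_sum => k _; rewrite /qn /xn /defect lerD2r.
  by have /andP[] := hstar_cube hp cs k.
have hr' m : (N0 <= m)%N -> `|y m.+1 - jac_root p s * y m + Qc p * y m ^+ 2| <= e1 * y m ^+ 2.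
  by rewrite geq_max => /andP[m1 _]; exact: hr.
have [S0 hS] := hs y (jac_root p s) (Qc p) (Qc_bounds a0 hK r1) y0 yd rs1 ra yK ye hr' n n4.
split=> // k.
rewrite yn_diff in hS.
have D0 := Dn_ge0 hK cs n.
have [dd0 hDu] := hR p (jac_v p s) _ hK r1 D0 va hD.
set D := dot (jac_v p s) (Dn p s n) in hS dd0 hDu.
set F := Qc p * _ / _ in hS.
have hM := Mmat_primitive_half a0 hK r1.
have [_ _ [uu0 _ _ _ _] _] := hM.
have rs0 : 0 < jac_root p s by apply: lt_le_trans rs2.
have F0 : 0 <= F.
  by rewrite /F divr_ge0 ?exprn_ge0 ?(ltW rs0) // mulr_ge0 ?exprn_ge0 // ltW // (Qc_gt0 a0 b0 hK r1).
have -> : Dn p s n k * (Qc p * gsum (jac_root p s) n ^+ 2 / (uvec p k * jac_root p s ^+ n)) - 1 =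
   (D * F - 1) + (Dn p s n k - D * uvec p k) / uvec p k * F.
  by rewrite /F; field; rewrite !gt_eqF ?exprn_gt0.
clearbody F.
have DF : D * F <= 1 + e by move: hS; rewrite ler_norml => /andP[_]; lra.
rewrite (le_trans (ler_normD _ _)) // (splitr e) lerD //.
rewrite !normrM normfV (gtr0_norm (uu0 k)) (ger0_norm F0).
apply: (@le_trans _ _ (e2 * D / kap * F)).
  rewrite ler_wpM2r // ler_pM ?invr_ge0 ?(ltW (uu0 k)) //.
  by rewrite lef_pV2 ?posrE // (u_ge hM).
have -> : e2 * D / kap * F = e2 / kap * (D * F) by ring.
apply: (@le_trans _ _ (e2 / kap * (1 + e))).
  by rewrite ler_wpM2l // divr_ge0 // ltW.
by rewrite le_eqVlt; apply/orP; left; apply/eqP; rewrite /e2; field; rewrite !gt_eqF ?addr_gt0.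
Unshelve. all: by end_near. Qed.

End Asymptotics.

(** * Perron roots at the fixed points *)

Section Discriminant.
Variables (R : realType) (d : nat) (a b c : R) (U : nat).
Hypotheses (d1 : (1 <= d)%N) (a0 : 0 < a) (b0 : 0 < b) (c0 : 0 < c) (U1 : (1 <= U)%N).
Local Notation vec := ('I_d -> R).
Local Notation inK := (inK a b c U).
Local Notation K3 := (remainder_const c).
Local Notation al := (a / 2).
Local Notation kap := (kap U al).
Local Notation near_critical := (near_critical (d := d) a b c U).
Local Notation crit := (crit a b c U).
Implicit Types (p : offspring R d) (s t x y z q w u v h : vec) (n m N : nat) (k l : 'I_d) (e : R).

Let al0 : 0 < al. Proof. by rewrite divr_gt0. Qed.
Let k0 : 0 < kap. Proof. exact: kap_gt0. Qed.
Let kV : 0 < kap^-1. Proof. by rewrite invr_gt0. Qed.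
Let dR : 1 <= d%:R :> R. Proof. by rewrite ler1n. Qed.
Let dp : 0 < d%:R :> R. Proof. exact: lt_le_trans dR. Qed.
Let K30 : 1 <= K3. Proof. by rewrite /remainder_const; have := c0; lra. Qed.
Let K3p : 0 < K3. Proof. exact: lt_le_trans K30. Qed.
Let half0 : 0 < 2^-1 :> R. Proof. by rewrite invr_gt0. Qed.
(** Bounds [vy]: its distance from v is at most dl <= 1/2, and v is at most [kap^-1]. *)
Let W := kap^-1 + 1.
Let W0 : 0 < W. Proof. by rewrite addr_gt0. Qed.

Lemma dot_bound w x (Y X : R) : (forall k, `|w k| <= Y) -> (forall k, `|x k| <= X) ->
  `|dot w x| <= d%:R * (Y * X).
Proof.
move=> hw hx; rewrite (le_trans (norm_dot _ _)) // -sum_const_ord ler_sum // => k _.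
by rewrite ler_pM.
Qed.

(* [y] and [h] are fixed points of [f] and of [s f]; [ry] and [rh] are the eigenvalues of the
   derivatives of these two maps there. *)
Record fixpair (dl : R) p s y h (ry : R) (vy : vec) (rh : R) (uh : vec) : Prop := FixPair {
  fp_K : inK p; fp_half : `|rho p - 1| <= 2^-1; fp_rho : `|rho p - 1| <= dl;
  fp_s : cube s; fp_y : cube y; fp_h : cube h; fp_hy : forall k, h k <= y k;
  fp_fy : forall k, y k = pgf p k y; fp_fh : forall k, h k = s k * pgf p k h;
  fp_dh : nrm (defect h) <= dl; fp_ds : nrm (defect s) <= dl;
  fp_vy : forall l, vm vy (Ms p y) l = ry * vy l; fp_vv : forall k, `|vy k - vvec p k| <= dl;
  fp_ry : `|ry - 1| <= dl;
  fp_uh : forall k, s k * mv (Ms p h) uh k = rh * uh k; fp_uu : forall k, `|uh k - uvec p k| <= dl }.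

Lemma fixpair_le dl dl' p s y h ry vy rh uh : dl <= dl' ->
  fixpair dl p s y h ry vy rh uh -> fixpair dl' p s y h ry vy rh uh.
Proof. by move=> le [*]; split=> // *; apply: le_trans le. Qed.

Let C1 := W + d%:R ^+ 3 * W * K3 + d%:R * W * K3.
Let C2 := 4 * kap^-1 * C1.
Let C10 : 0 < C1.
Proof.
have p1 : 0 < d%:R * W * K3 by exact: mulr_gt0 (mulr_gt0 dp W0) K3p.
have p2 : 0 < d%:R ^+ 3 * W * K3 by exact: mulr_gt0 (mulr_gt0 (exprn_gt0 _ dp) W0) K3p.
by rewrite /C1; have := W0; lra.
Qed.
Let C20 : 0 < C2. Proof. exact: mulr_gt0 (mulr_gt0 _ kV) C10. Qed.

Section Basic.
Variables (dl : R) (p : offspring R d) (s y h : vec) (ry : R) (vy : vec) (rh : R) (uh : vec).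
Hypotheses (FP : fixpair dl p s y h ry vy rh uh) (dl2 : dl <= 2^-1) (dlk : dl <= kap / 2).
Let hK : inK p. Proof. exact: (fp_K FP). Qed.
Let hp : is_offspring p. Proof. by have [] := hK. Qed.
Let hM : primitive_class U al K3 (Mmat p) (rho p) (uvec p) (vvec p).
Proof. exact: (Mmat_primitive_half a0 hK (fp_half FP)). Qed.
Definition gap y h : vec := fun k => y k - h k.
Let g := gap y h.
Let G := nrm g.
Let z := dot vy g.
Let N := nrm (defect s).
Definition remainder p y h : vec :=
  fun k => pgf p k y - pgf p k h - Mv p y (gap y h) k + 2^-1 * Bq p (gap y h) (gap y h) k.
Let E := remainder p y h.

Lemma gap_ge0 k : 0 <= g k. Proof. by rewrite subr_ge0 (fp_hy FP). Qed.
Lemma gap_le k : g k <= y k.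
Proof. by rewrite lerBlDr lerDl; have /andP[] := fp_h FP k. Qed.
Lemma gapK : (fun l => y l - g l) = h.
Proof. by apply/funext => l; rewrite /g /gap subKr. Qed.
Lemma G_ge0 : 0 <= G. Proof. exact: nrm_ge0 gap_ge0. Qed.
Lemma G_le : G <= dl.
Proof.
apply: le_trans (fp_dh FP); rewrite -{1}gapK.
by apply: nrm_q_le; exact: (fp_y FP).
Qed.
Lemma dl_ge0 : 0 <= dl. Proof. exact: le_trans G_ge0 G_le. Qed.

Lemma vy_bounds k : kap / 2 <= vy k <= W.
Proof.
have := fp_vv FP k; rewrite ler_norml => /andP[h1 h2].
have := v_ge al0 hM k; have := v_le al0 hM k; rewrite /W => h3 h4.
have := dl2; have := dlk => h5 h6; apply/andP; split; lra.
Qed.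

Lemma vy_norm k : `|vy k| <= W.
Proof.
have /andP[h1 h2] := vy_bounds k; rewrite ger0_norm //.
by apply: le_trans h1; rewrite divr_ge0 // ltW.
Qed.

Lemma remainder_le k : `|E k| <= K3 * dl * G ^+ 2.
Proof.
have := pgf_taylor hp hK k (fp_y FP) gap_ge0 gap_le.
have -> : (fun l => 1 - (y l - g l)) = defect h by apply/funext => l; rewrite /g /gap subKr.
rewrite gapK => /le_trans -> //.
by rewrite ler_wpM2r ?exprn_ge0 ?G_ge0 // ler_wpM2l ?(ltW K3p) // (fp_dh FP).
Qed.

(** Expansion of f from y down to h, paired with the left eigenvector at y, so that the linear term
    is ry z. The fixed-point equations contribute the difference (1 - s) f(h). *)
Lemma gap_identity : (1 - ry) * z + 2^-1 * hess_form p vy g g - dot vy E = dot vy (fun k => defect s k * pgf p k h).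
Proof.
have hv : dot vy (Mv p y g) = ry * z.
  have -> : dot vy (Mv p y g) = dot (vm vy (Ms p y)) g by exact: (dot_mv vy (Ms p y) g).
  by rewrite (_ : vm vy (Ms p y) = fun k => ry * vy k) ?dotZl //; apply/funext => l; exact: (fp_vy FP).
have hz : z = dot vy (fun k => pgf p k y - pgf p k h + defect s k * pgf p k h).
  apply: eq_bigr => k _; congr (_ * _); rewrite /g /gap {1}(fp_fy FP k) {1}(fp_fh FP k) /defect; ring.
rewrite dotD in hz.
have hE : dot vy E = dot vy (fun k => pgf p k y - pgf p k h) - ry * z + 2^-1 * hess_form p vy g g.
  rewrite -hv /hess_form -dotZ -dotB -dotD; apply: eq_bigr => k _; congr (_ * _).
rewrite hE; lra.
Qed.

Lemma z_le : z <= W * G.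
Proof.
rewrite mulr_sumr; apply: ler_sum => k _; rewrite ler_wpM2r ?gap_ge0 //.
by have /andP[] := vy_bounds k.
Qed.

Lemma G_le_z : G <= 2 * kap^-1 * z.
Proof.
have : kap / 2 * G <= z.
  rewrite mulr_sumr; apply: ler_sum => k _; rewrite ler_wpM2r ?gap_ge0 //.
  by have /andP[] := vy_bounds k.
have -> : 2 * kap^-1 * z = (kap / 2)^-1 * z by rewrite invf_div.
by rewrite ler_pdivlMl // divr_gt0.
Qed.

Let s0 k : 0 <= defect s k.
Proof. by have /andP[] := defect_cube (fp_s FP) k. Qed.

Lemma pgf_h_bounds k : 1 - dl <= pgf p k h <= 1.
Proof.
rewrite (pgf_le1 hp) ?andbT; last exact: fp_h FP.
have /andP[_ s1] := fp_s FP k.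
have h1 : h k <= pgf p k h.
  by rewrite {1}(fp_fh FP k) ler_piMl // pgf_ge0 //; exact: fp_h FP.
have dh l : 0 <= defect h l by have /andP[] := defect_cube (fp_h FP) l.
by have := le_trans (nrm_ge k dh) (fp_dh FP); rewrite /defect; lra.
Qed.

(** In [gap_identity] every term on the left carries a factor dl G, and the right side controls 1 -
    s from below. Hence 1 - s is negligible against the gap, which therefore nearly solves M g =
    g. *)
Lemma N_le : N <= C2 * dl * G.
Proof.
have G0 := G_ge0; have G1 := G_le; have D0 := dl_ge0.
have h1 : kap / 2 * (2^-1 * N) <= dot vy (fun k => defect s k * pgf p k h).
  rewrite !mulr_sumr; apply: ler_sum => k _; have /andP[v1 _] := vy_bounds k.
  have /andP[f1 _] := pgf_h_bounds k.
  rewrite ler_pM ?(ltW (divr_gt0 k0 _)) // ?mulr_ge0 ?(ltW half0) // mulrC ler_wpM2l //.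
  by have := dl2; lra.
have h2 : `|(1 - ry) * z| <= dl * (W * G).
  rewrite normrM distrC ler_pM ?(fp_ry FP) //.
  have z0 : 0 <= z.
    by have := le_trans G0 G_le_z; rewrite pmulr_rge0 // mulr_gt0.
  by rewrite ger0_norm // z_le.
have gn k : `|g k| <= G by rewrite ger0_norm ?gap_ge0 // nrm_ge //; exact: gap_ge0.
have h3 : `|hess_form p vy g g| <= d%:R ^+ 3 * W * K3 * dl * G.
  apply: le_trans (dot_bound vy_norm (fun k => Bq_bound hK k gn gn)) _.
  have -> : d%:R * (W * (d%:R ^+ 2 * K3 * (G * G))) = d%:R ^+ 3 * W * K3 * (G * G) by ring.
  rewrite -!mulrA !ler_wpM2l ?exprn_ge0 ?(ltW W0) ?(ltW K3p) //.
  by rewrite ler_wpM2r.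
have h4 : `|dot vy E| <= d%:R * W * K3 * dl * G.
  apply: le_trans (dot_bound vy_norm remainder_le) _.
  have -> : d%:R * (W * (K3 * dl * G ^+ 2)) = d%:R * W * K3 * dl * (G * G) by ring.
  have Gle1 : G <= 1 by have := dl2; lra.
  have cc : 0 <= d%:R * W * K3 * dl by exact: mulr_ge0 (mulr_ge0 (mulr_ge0 (ltW dp) (ltW W0)) (ltW K3p)) D0.
  by rewrite ler_wpM2l // ler_piMl.
have h5 : kap / 2 * (2^-1 * N) <= C1 * dl * G.
  apply: le_trans h1 _; rewrite -gap_identity.
  move: h2 h3 h4; rewrite !ler_norml /C1 => /andP[_ h2] /andP[a3 h3] /andP[h4 _].
  have : 0 <= d%:R ^+ 3 * W * K3 * dl * G.
    exact: mulr_ge0 (mulr_ge0 (mulr_ge0 (mulr_ge0 (exprn_ge0 _ (ltW dp)) (ltW W0)) (ltW K3p)) D0) G0.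
  lra.
have -> : C2 * dl * G = (kap / 4)^-1 * (C1 * dl * G) by rewrite /C2 invf_div; ring.
by rewrite ler_pdivlMl ?divr_gt0 //; apply: le_trans h5; lra.
Qed.

End Basic.

Ltac prune := clear -d1 b0 c0 U1 al0 k0 kV dR dp K3p half0 W0 C10 C20.

(** By [N_le] the gap is almost invariant under M, so the constant sequence equal to it is
    admissible in [direction]. *)
Lemma gap_aligned e : 0 < e -> exists2 dl : R, 0 < dl & forall p s y h ry vy rh uh,
  fixpair dl p s y h ry vy rh uh -> let z := dot vy (gap y h) in
  0 <= z /\ forall k, `|gap y h k - z * uvec p k| <= e * z.
Proof.
move=> e0; have [d2 d20 hR] := realign d b c U a0 e0.
have [m [d3 d30 hdir]] := direction U al0 (ltW K3p) d1 d20.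
have C40 : 0 < C4 d c.
  rewrite /C4; apply: (mulr_gt0 K3p); rewrite ltr_wpDl // addr_ge0 ?exprn_ge0 ?mulr_ge0 //.
pose C := C4 d c + C2.
have C0 : 0 < C by rewrite addr_gt0.
pose dl := Num.min (Num.min 2^-1 (kap / 2)) (Num.min (Num.min d2 d3) (d3 / C)).
have dl0 : 0 < dl by rewrite /dl !lt_min half0 d20 d30 !divr_gt0.
have [f1 f2 f3 f4 f5] : [/\ dl <= 2^-1, dl <= kap / 2, dl <= d2, dl <= d3 & dl <= d3 / C].
  by rewrite /dl !ge_min !lexx ?orbT.
clearbody dl; exists dl => // p s y h ry vy rh uh FP z.
have hK := fp_K FP; have [hp _] := hK.
have hM := Mmat_primitive_half a0 hK (fp_half FP).
have g0 := gap_ge0 FP; have G0 := G_ge0 FP.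
apply: (hR p vy _ hK (fp_half FP) g0) => [k|].
  exact: le_trans (fp_vv FP k) f3.
have cone : cube (@one R d) by exact: cube_one.
apply: (hdir _ _ _ _ hM (le_trans (fp_rho FP) f4) (fun=> gap y h)) => [n k|n _ k]; first exact: g0.
have hs := step_close hK c0 k cone (fp_y FP) g0 (gap_le FP).
rewrite gapK mul1r in hs.
have n1 : nrm (defect (@one R d)) = 0 by rewrite /nrm big1 // => l _; rewrite /defect subrr.
rewrite n1 addr0 in hs.
have ds0 l : 0 <= defect s l by have /andP[] := defect_cube (fp_s FP) l.
have -> : gap y h k - mv (Mmat p) (gap y h) k =
   (pgf p k y - pgf p k h - mv (Mmat p) (gap y h) k) + defect s k * pgf p k h.
  by rewrite {1}/gap {1}(fp_fy FP k) {1}(fp_fh FP k) /defect; ring.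
rewrite (le_trans (ler_normD _ _)) //.
have h1 : `|defect s k * pgf p k h| <= C2 * dl * nrm (gap y h).
  apply: le_trans (N_le FP f1 f2); have /andP[_ p1] := pgf_h_bounds FP k.
  have p0 := pgf_ge0 hp k (fp_h FP).
  rewrite ger0_norm ?mulr_ge0 //; apply: le_trans (nrm_ge k ds0).
  by rewrite ler_piMr.
have h2 : C4 d c * nrm (defect h) * nrm (gap y h) <= C4 d c * dl * nrm (gap y h).
  by rewrite ler_wpM2r // ler_wpM2l ?(ltW C40) // (fp_dh FP).
have h3 : C * dl * nrm (gap y h) <= d3 * nrm (gap y h).
  by rewrite ler_wpM2r // mulrC -ler_pdivlMr.
rewrite /C in h3; lra.
Qed.

(** The first relation is [gap_identity] with its Hessian term evaluated by alignment. For the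
    second, the difference of the Jacobians at y and h is to first order the Hessian in the
    direction of the gap; it is paired with the left eigenvector at y and the right one at h. *)
Lemma pair_asym e : 0 < e -> exists2 dl : R, 0 < dl & forall p s y h ry vy rh uh,
  fixpair dl p s y h ry vy rh uh -> let z := dot vy (gap y h) in
  [/\ 0 <= z, z = 0 -> gap y h = (fun=> 0),
    `|(1 - ry) * z + Qc p * z ^+ 2 - dot (vvec p) (defect s)| <= e * (z ^+ 2 + dot (vvec p) (defect s)) &
    `|ry - rh - 2 * Qc p * z| <= e * z].
Proof.
move=> e0.
have e40 : 0 < e / 4 by rewrite divr_gt0.
have [d2 d20 hT] := T3_approx b U d1 a0 c0 e40.
have [d3 d30 hg] := gap_aligned d20.
pose B1 := d%:R * W * K3 * (2 * kap^-1) ^+ 2.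
pose B2 := (1 + kap^-1) * kap^-1.
pose B3 := d%:R * W * (d%:R * (K3 * 2)) * (1 + C2) * (2 * kap^-1).
pose B4 := 2 * d%:R * (2 + kap^-1).
pose Q1' := Q1 d a c U.
have Q10 : 0 <= Q1'.
  by rewrite /Q1'; apply: mulr_ge0; [exact: mulr_ge0 (exprn_ge0 _ _) (ltW K3p) | exact: ltW].
have kk : 0 < 2 * kap^-1 by rewrite mulr_gt0.
have B10 : 0 <= B1 by exact: mulr_ge0 (mulr_ge0 (mulr_ge0 (ltW dp) (ltW W0)) (ltW K3p)) (exprn_ge0 _ (ltW kk)).
have B20 : 0 <= B2 by exact: mulr_ge0 (addr_ge0 _ (ltW kV)) (ltW kV).
have B30 : 0 <= B3.
  have p1 : 0 <= d%:R * (K3 * 2) by exact: mulr_ge0 (ltW dp) (mulr_ge0 (ltW K3p) _).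
  exact: mulr_ge0 (mulr_ge0 (mulr_ge0 (mulr_ge0 (ltW dp) (ltW W0)) p1) (addr_ge0 _ (ltW C20))) (ltW kk).
have B40 : 0 <= B4 by exact: mulr_ge0 (mulr_ge0 _ (ltW dp)) (addr_ge0 _ (ltW kV)).
(* Adds up the error constants, so that dl S <= e/2 bounds the total error and dl S <= 1 keeps vy.uh
   at least 1/2. *)
pose S := 1 + 4 * (B1 + B2) + 8 * (B3 + Q1' * B4) + 2 * B4.
have S0 : 0 < S by have := mulr_ge0 Q10 B40; rewrite /S; lra.
pose dl := Num.min (Num.min (Num.min 2^-1 (kap / 2)) (Num.min d2 d3)) (Num.min (e / 2) 1 / S).
have m0 : 0 < Num.min (e / 2) 1 by rewrite lt_min ltr01 divr_gt0.
have dl0 : 0 < dl by rewrite /dl !lt_min half0 d20 d30 !divr_gt0.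
have [f1 f2 f3 f4 f5] : [/\ dl <= 2^-1, dl <= kap / 2, dl <= d2, dl <= d3 &
   dl <= Num.min (e / 2) 1 / S].
  by rewrite /dl !ge_min !lexx ?orbT.
have f6 : dl * S <= e / 2.
  by rewrite -ler_pdivlMr // (le_trans f5) // ler_wpM2r ?invr_ge0 ?(ltW S0) // ge_min lexx.
have f7 : dl * S <= 1.
  by rewrite -ler_pdivlMr // (le_trans f5) // ler_wpM2r ?invr_ge0 ?(ltW S0) // ge_min lexx orbT.
clearbody dl; exists dl => // p s y h ry vy rh uh FP.
have hK := fp_K FP; have [hp _] := hK.
have hM := Mmat_primitive_half a0 hK (fp_half FP).
have [_ _ [u0 v0 _ _ [u1 uv]] _] := hM.
have [z0 gz] := hg _ _ _ _ _ _ _ _ (fixpair_le f4 FP).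
set z := dot vy (gap y h) in z0 gz *.
have g0 := gap_ge0 FP; have G0 := G_ge0 FP; have Gz := G_le_z FP f1 f2; have D0 := ltW dl0.
rewrite -/z in Gz; set G := nrm (gap y h) in G0 Gz.
have vW := vy_norm FP f1 f2.
have ds0 l : 0 <= defect s l by have /andP[] := defect_cube (fp_s FP) l.
have NG := N_le FP f1 f2; rewrite -/G in NG.
set N := nrm (defect s) in NG.
have N0 : 0 <= N by exact: nrm_ge0.
set V := dot (vvec p) (defect s).
have NV : N <= kap^-1 * V by exact: (nrm_le_dot al0 hM).
have V0 : 0 <= V by apply: dot_ge0 => // k; exact: ltW.
have z20 : 0 <= z ^+ 2 by exact: sqr_ge0.
have SB : [/\ dl * B1 <= e / 8, dl * B2 <= e / 8, dl * (B3 + Q1' * B4) <= e / 16 & dl * B4 <= 2^-1].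
  have t1 := mulr_ge0 D0 B10; have t2 := mulr_ge0 D0 B20; have t3 := mulr_ge0 D0 B30.
  have t4 := mulr_ge0 D0 B40; have t5 := mulr_ge0 D0 (mulr_ge0 Q10 B40).
  by split; move: f6 f7 D0 t1 t2 t3 t4 t5; rewrite /S; prune; lra.
case: SB => SB1 SB2 SB3 SB4.
split=> //.
- move=> zz; apply/funext => k; have := gz k; rewrite zz mul0r mulr0 subr0 normr_le0.
  by move=> /eqP.
- have idn := gap_identity FP; rewrite -/z in idn.
  have hv k : `|vy k - vvec p k| <= d2 by exact: le_trans (fp_vv FP k) f3.
  have T := hT p vy _ _ z z hK (fp_half FP) hv z0 z0 gz gz.
  have hE : `|dot vy (remainder p y h)| <= e / 8 * z ^+ 2.
    apply: le_trans (dot_bound vW (remainder_le FP)) _; rewrite -/G.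
    apply: (@le_trans _ _ (dl * B1 * z ^+ 2)); last by rewrite ler_wpM2r.
    have -> : dl * B1 * z ^+ 2 = d%:R * (W * (K3 * dl * (2 * kap^-1 * z) ^+ 2)) by rewrite /B1; ring.
    rewrite !ler_wpM2l ?(ltW dp) ?(ltW W0) ?(mulr_ge0 (ltW K3p) D0) //.
    by rewrite lerXn2r ?nnegrE // mulr_ge0 // ltW.
  have hF : `|dot vy (fun k => defect s k * pgf p k h) - V| <= e / 8 * V.
    have -> : dot vy (fun k => defect s k * pgf p k h) - V =
        dot (defect s) (fun k => vy k * pgf p k h - vvec p k).
      by rewrite dotB /V [dot (vvec p) _]dotC; congr (_ - _); apply: eq_bigr => k _; ring.
    apply: (@le_trans _ _ ((1 + kap^-1) * dl * N)).
      rewrite (le_trans (norm_dot _ _)) // mulr_sumr ler_sum // => k _.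
      rewrite (ger0_norm (ds0 k)) mulrC ler_wpM2r //.
      have /andP[q1 q2] := pgf_h_bounds FP k.
      have q0 := pgf_ge0 hp k (fp_h FP).
      have -> : vy k * pgf p k h - vvec p k =
        (vy k - vvec p k) * pgf p k h - vvec p k * (1 - pgf p k h) by ring.
      have -> : (1 + kap^-1) * dl = dl + kap^-1 * dl by ring.
      rewrite (le_trans (ler_normB _ _)) // lerD //.
        rewrite normrM (ger0_norm q0) (le_trans _ (fp_vv FP k)) // ler_piMr //.
      rewrite normrM (gtr0_norm (v0 k)) ler_pM ?(ltW (v0 k)) ?(v_le al0 hM) //.
      by rewrite ger0_norm; move: q1 q2; prune; lra.
    apply: (@le_trans _ _ (dl * B2 * V)); last by rewrite ler_wpM2r.
    have -> : dl * B2 * V = (1 + kap^-1) * dl * (kap^-1 * V) by rewrite /B2; ring.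
    by rewrite ler_wpM2l // mulr_ge0 // addr_ge0 // ltW.
  have -> : (1 - ry) * z + Qc p * z ^+ 2 - V =
     - 2^-1 * (hess_form p vy (gap y h) (gap y h) - 2 * Qc p * (z * z)) + dot vy (remainder p y h)
     + (dot vy (fun k => defect s k * pgf p k h) - V).
    by rewrite -idn -/z; field.
  rewrite (le_trans (ler_normD _ _)) // (le_trans (lerD (ler_normD _ _) (lexx _))) //.
  rewrite mulNr normrN normrM (ger0_norm (ltW half0)).
  have T' : `|hess_form p vy (gap y h) (gap y h) - 2 * Qc p * (z * z)| <= e / 4 * (z * z) := T.
  have e1 : 0 <= e * z ^+ 2 by rewrite mulr_ge0 // ltW.
  have e2 : 0 <= e * V by rewrite mulr_ge0 // ltW.
  by move: T' hE hF e1 e2; rewrite expr2; prune; lra.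
have hv k : `|vy k - vvec p k| <= d2 by exact: le_trans (fp_vv FP k) f3.
have hu k : `|uh k - 1 * uvec p k| <= d2 * 1 by rewrite mul1r mulr1 (le_trans (fp_uu FP k)).
have T := hT p vy _ _ 1 z hK (fp_half FP) hv ler01 z0 hu gz.
have uh2 k : `|uh k| <= 2.
  have := ler_normD (uh k - uvec p k) (uvec p k); rewrite subrK.
  move: (fp_uu FP k) (u_le1 hM k) f1; rewrite (gtr0_norm (u0 k)); prune; lra.
have gk k : gap y h k <= y k by exact: gap_le FP k.
pose E' : vec := fun k => \sum_l (Ms p y k l - Ms p h k l - \sum_m hess p k l m * gap y h m) * uh l.
have hE' : `|dot vy E'| <= d%:R * (W * (d%:R * (K3 * dl * G * 2))).
  apply: (dot_bound vW) => k; rewrite (le_trans (ler_norm_sum _ _ _)) // -sum_const_ord ler_sum // => l _.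
  rewrite normrM ler_pM //.
  have := Ms_taylor hp hK k (fp_y FP) g0 gk l.
  have -> : (fun i => 1 - (y i - gap y h i)) = defect h by apply/funext => i; rewrite /gap subKr.
  have -> : (fun i => y i - gap y h i) = h by apply/funext => i; rewrite /gap subKr.
  move=> /le_trans -> //; rewrite ler_wpM2r // ler_wpM2l ?(ltW K3p) //.
  exact: fp_dh FP.
pose F : vec := fun k => defect s k * mv (Ms p h) uh k.
have hF : `|dot vy F| <= d%:R * (W * (N * (d%:R * (K3 * 2)))).
  apply: (dot_bound vW) => k; rewrite /F normrM (ger0_norm (ds0 k)) ler_pM //; first exact: nrm_ge.
  by apply: mv_norm => // i j; have [] := pex_dmon hp hK i j (fp_h FP).
(* The term [F] appears because [rh] belongs to the derivative of s f while [ry] belongs to that of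
   f. *)
have ident : (ry - rh) * dot vy uh = hess_form p vy uh (gap y h) + dot vy E' + dot vy F.
  have r1 : ry * dot vy uh = dot vy (mv (Ms p y) uh).
    by rewrite dot_mv (_ : vm vy (Ms p y) = fun k => ry * vy k) ?dotZl //; apply/funext => l; exact: (fp_vy FP).
  have r2 : rh * dot vy uh = dot vy (fun k => s k * mv (Ms p h) uh k).
    by rewrite -dotZ; apply: eq_bigr => k _; rewrite (fp_uh FP).
  rewrite mulrBl r1 r2 /hess_form -!dotD -dotB; apply: eq_bigr => k _; congr (_ * _).
  have -> : E' k = mv (Ms p y) uh k - mv (Ms p h) uh k - Bq p uh (gap y h) k.
    rewrite /E' /mv /Bq -!sumrB; apply: eq_bigr => l _.
    rewrite mulrBl mulrBl; congr (_ - _); rewrite mulr_suml; apply: eq_bigr => m _; ring.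
  by rewrite /F /defect; ring.
have hD : `|dot vy uh - 1| <= dl * B4 / 2.
  have -> : dot vy uh - 1 = dot (fun k => vy k - vvec p k) uh + dot (vvec p) (fun k => uh k - uvec p k).
    rewrite dotB uv; have -> : dot (fun k => vy k - vvec p k) uh = dot vy uh - dot (vvec p) uh.
      by rewrite /dot -sumrB; apply: eq_bigr => k _; rewrite mulrBl.
    by ring.
  have q1 := dot_bound (fp_vv FP) uh2.
  have vn k : `|vvec p k| <= kap^-1 by rewrite gtr0_norm ?(v_le al0 hM).
  have q2 := dot_bound vn (fp_uu FP).
  rewrite (le_trans (ler_normD _ _)) // (le_trans (lerD q1 q2)) //.
  by rewrite /B4; prune; lra.
have err : `|dot vy E' + dot vy F| <= dl * B3 * z.
  rewrite (le_trans (ler_normD _ _)) //; apply: le_trans (lerD hE' hF) _.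
  have -> : d%:R * (W * (d%:R * (K3 * dl * G * 2))) = d%:R * W * (d%:R * (K3 * 2)) * (dl * G) by ring.
  have -> : d%:R * (W * (N * (d%:R * (K3 * 2)))) = d%:R * W * (d%:R * (K3 * 2)) * N by ring.
  have P0 : 0 <= d%:R * W * (d%:R * (K3 * 2)).
    by exact: mulr_ge0 (mulr_ge0 (ltW dp) (ltW W0)) (mulr_ge0 (ltW dp) (mulr_ge0 (ltW K3p) _)).
  rewrite -mulrDr.
  have -> : dl * B3 * z = d%:R * W * (d%:R * (K3 * 2)) * ((1 + C2) * dl * (2 * kap^-1 * z)).
    by rewrite /B3; ring.
  apply: ler_wpM2l => //.
  have : (1 + C2) * dl * G <= (1 + C2) * dl * (2 * kap^-1 * z).
    by apply: ler_wpM2l => //; exact: mulr_ge0 (addr_ge0 ler01 (ltW C20)) D0.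
  move: NG; prune; lra.
have [Qp Qb] : 0 < Qc p /\ Qc p <= Q1'.
  split; first exact: (Qc_gt0 a0 b0 hK (fp_half FP)).
  by have /andP[] := Qc_bounds a0 hK (fp_half FP).
set Dt := dot vy uh in ident hD.
have hD2 : 2^-1 <= Dt by move: hD SB4; prune; rewrite ler_norml => /andP[]; lra.
have Dp : 0 < Dt by apply: lt_le_trans hD2.
have -> : ry - rh - 2 * Qc p * z =
   ((hess_form p vy uh (gap y h) - 2 * Qc p * (1 * z)) + (dot vy E' + dot vy F) + 2 * Qc p * z * (1 - Dt)) / Dt.
  have -> : hess_form p vy uh (gap y h) - 2 * Qc p * (1 * z) + (dot vy E' + dot vy F) =
     (ry - rh) * Dt - 2 * Qc p * z by rewrite ident; ring.
  by field; rewrite gt_eqF.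
rewrite normrM normfV (gtr0_norm Dp) ler_pdivrMr //.
have T' : `|hess_form p vy uh (gap y h) - 2 * Qc p * (1 * z)| <= e / 4 * (1 * z) := T.
have h5 : `|2 * Qc p * z * (1 - Dt)| <= dl * (Q1' * B4) * z.
  rewrite normrM distrC (ger0_norm (mulr_ge0 (mulr_ge0 (ler0n _ 2) (ltW Qp)) z0)).
  have -> : dl * (Q1' * B4) * z = 2 * Q1' * z * (dl * B4 / 2) by field.
  have q1 : 2 * Qc p * z <= 2 * Q1' * z by apply: ler_wpM2r => //; rewrite ler_wpM2l.
  by apply: ler_pM => //; exact: mulr_ge0 (mulr_ge0 _ (ltW Qp)) z0.
rewrite (le_trans (ler_normD _ _)) // (le_trans (lerD (ler_normD _ _) (lexx _))) //.
have h6 : dl * (B3 + Q1' * B4) * z <= e / 16 * z by rewrite ler_wpM2r.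
have h7 : e * z * 2^-1 <= e * z * Dt by rewrite ler_wpM2l // mulr_ge0 // ltW.
have h8 : 0 <= e * z by rewrite mulr_ge0 // ltW.
move: T' err h5 h6 h7 h8; prune; lra.
Qed.

End Discriminant.

(** With m = 1 - rm, 1 - rr is m + 2 Q z up to e1 z, and (m + 2 Q z)^2 - m^2 = 4 Q (m z + Q z^2). As
    m >= 0, the first relation also bounds m z and z^2 by multiples of V, which makes every error
    relative to V. *)
Lemma disc_arith (R : realType) (q0 q1 e1 e rm rr z Q V : R) : 0 < q0 -> 0 <= q1 -> 0 < e1 -> e1 <= 1 -> e1 <= q0 / 2 ->
  e1 * (4 * q1 * (4 / q0 + 1) + 2 * (2 + 4 / q0) + 4 * q1 * (4 / q0) + 4 / q0) <= e ->
  0 <= z -> 0 <= V -> q0 <= Q -> Q <= q1 -> rm <= 1 ->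
  `|(1 - rm) * z + Q * z ^+ 2 - V| <= e1 * (z ^+ 2 + V) -> `|rm - rr - 2 * Q * z| <= e1 * z ->
  `|(1 - rr) ^+ 2 - (1 - rm) ^+ 2 - 4 * Q * V| <= e * V.
Proof.
move=> Q00 Q10 e10 f1 f2 f3 z0 V0 hq0 hq1 m1.
have q4 : 0 < 4 / q0 by rewrite divr_gt0.
set m := 1 - rm; set C := _ + 4 / q0 in f3 => h1 h2.
have m0 : 0 <= m by rewrite /m; lra.
pose dd := rm - rr - 2 * Q * z.
have z20 : 0 <= z ^+ 2 by exact: sqr_ge0.
have mz0 : 0 <= m * z by exact: mulr_ge0.
have hz1 : m * z + Q * z ^+ 2 <= V + e1 * (z ^+ 2 + V).
  by move: h1; rewrite ler_norml => /andP[_]; lra.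
have hz2 : e1 * (z ^+ 2 + V) <= q0 / 2 * z ^+ 2 + V.
  by rewrite mulrDr lerD ?ler_wpM2r // ler_piMl.
have hz3 : q0 * z ^+ 2 <= Q * z ^+ 2 by rewrite ler_wpM2r.
have hz4 : z ^+ 2 <= 4 / q0 * V.
  by rewrite mulrAC ler_pdivlMr //; lra.
have hz5 : m * z <= (2 + 4 / q0) * V.
  have : e1 * (z ^+ 2 + V) <= z ^+ 2 + V by rewrite ler_piMl // addr_ge0.
  have : 0 <= Q * z ^+ 2 by rewrite (le_trans _ hz3) // mulr_ge0 // ltW.
  lra.
have E : (1 - rr) ^+ 2 - m ^+ 2 - 4 * Q * V =
  4 * Q * (m * z + Q * z ^+ 2 - V) + (2 * m * dd + 4 * Q * z * dd + dd ^+ 2).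
  have -> : 1 - rr = m + (2 * Q * z + dd) by rewrite /m /dd; ring.
  ring.
rewrite E.
have hd : `|dd| <= e1 * z := h2.
have Qp : 0 <= Q by apply: le_trans (ltW Q00) hq0.
have t1 : `|4 * Q * (m * z + Q * z ^+ 2 - V)| <= 4 * q1 * (e1 * ((4 / q0 + 1) * V)).
  rewrite normrM ger0_norm ?(mulr_ge0 _ Qp) // ler_pM ?(mulr_ge0 _ Qp) //; first by lra.
  by apply: le_trans h1 _; rewrite ler_wpM2l ?(ltW e10) //; lra.
have t2 : `|2 * m * dd| <= 2 * (e1 * ((2 + 4 / q0) * V)).
  rewrite normrM ger0_norm ?mulr_ge0 //.
  have : m * `|dd| <= m * (e1 * z) by rewrite ler_wpM2l.
  have : e1 * (m * z) <= e1 * ((2 + 4 / q0) * V) by rewrite ler_wpM2l // ltW.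
  lra.
have ddz : z * `|dd| <= e1 * (4 / q0 * V).
  apply: (@le_trans _ _ (z * (e1 * z))); first by rewrite ler_wpM2l.
  by have : e1 * z ^+ 2 <= e1 * (4 / q0 * V) by [rewrite ler_wpM2l // ltW]; lra.
have t3 : `|4 * Q * z * dd| <= 4 * q1 * (e1 * (4 / q0 * V)).
  have -> : `|4 * Q * z * dd| = 4 * Q * (z * `|dd|).
    by rewrite normrM ger0_norm ?mulrA // (mulr_ge0 (mulr_ge0 _ Qp) z0).
  rewrite ler_pM ?(mulr_ge0 _ Qp) ?mulr_ge0 //; lra.
have t4 : `|dd ^+ 2| <= e1 * (4 / q0 * V).
  rewrite normrX expr2; apply: le_trans ddz; rewrite ler_wpM2r //.
  by apply: le_trans hd _; rewrite ler_piMl.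
rewrite (le_trans (ler_normD _ _)) //.
have := ler_normD (2 * m * dd + 4 * Q * z * dd) (dd ^+ 2).
have := ler_normD (2 * m * dd) (4 * Q * z * dd).
have : e1 * C * V <= e * V by rewrite ler_wpM2r.
rewrite /C; lra.
Qed.

Section PerronRoots.
Variables (R : realType) (d : nat) (a b c : R) (U : nat).
Hypotheses (d1 : (1 <= d)%N) (a0 : 0 < a) (b0 : 0 < b) (c0 : 0 < c) (U1 : (1 <= U)%N).
Local Notation vec := ('I_d -> R).
Local Notation inK := (inK a b c U).
Local Notation K3 := (remainder_const c).
Local Notation al := (a / 2).
Local Notation kap := (kap U al).
Local Notation near_critical := (near_critical (d := d) a b c U).
Local Notation crit := (crit a b c U).
Local Notation Q0 := (Q0 a b U).
Local Notation Q1 := (Q1 d a c U).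
Local Notation one := (@one R d).
Implicit Types (p : offspring R d) (s t x y z q w u v h : vec) (n m N : nat) (k l : 'I_d) (e : R).

Let al0 : 0 < al. Proof. by rewrite divr_gt0. Qed.
Let k0 : 0 < kap. Proof. exact: kap_gt0. Qed.
Let kV : 0 < kap^-1. Proof. by rewrite invr_gt0. Qed.
Let K3p : 0 < K3. Proof. by rewrite /remainder_const; have := c0; lra. Qed.
Let half0 : 0 < 2^-1 :> R. Proof. by rewrite invr_gt0. Qed.
Let Q00 : 0 < Q0. Proof. exact: Q0_gt0. Qed.
Let Q10 : 0 <= Q1.
Proof. by apply: mulr_ge0; [exact: mulr_ge0 (exprn_ge0 _ (ler0n _ _)) (ltW K3p) | exact: ltW]. Qed.

Lemma defect_one k : defect one k = 0. Proof. by rewrite /defect subrr. Qed.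

Lemma nrm_defect_one : nrm (defect one) = 0.
Proof. by rewrite /nrm big1 // => k _; exact: defect_one. Qed.

(** The pair (f, 1) is as close to criticality as (f, s), so every uniform estimate also holds for
    the extinction probabilities. *)
Lemma near_at_one (P : offspring R d * vec -> Prop) : (\forall ps \near near_critical, P ps) ->
  \forall ps \near near_critical, P (ps.1, one).
Proof.
move=> [e e0 hP]; exists e => // ps [h1 h2 _ _]; apply: hP; split=> //=; first exact: cube_one.
by rewrite nrm_defect_one ltW.
Qed.

Lemma jac_one p : jac p one = Ms p (hstar p one).
Proof. by apply/matrixP => k l; rewrite mxE mul1r. Qed.

Definition triple_close e p s :=
  [/\ primitive_class U al K3 (jac p s) (jac_root p s) (jac_u p s) (jac_v p s),
    `|jac_root p s - 1| <= e, forall k, `|jac_u p s k - uvec p k| <= e &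
    forall k, `|jac_v p s k - vvec p k| <= e].

Lemma near_triple_one e : 0 < e -> \forall ps \near near_critical, triple_close e ps.1 one.
Proof. by move=> e0; have := near_at_one (near_triple d1 a0 b0 c0 U1 e0). Qed.

Lemma near_triples e : 0 < e ->
  \forall ps \near near_critical, triple_close e ps.1 ps.2 /\ triple_close e ps.1 one.
Proof. by move=> e0; exact: (filterI (near_triple d1 a0 b0 c0 U1 e0) (near_triple_one e0)). Qed.

Lemma near_jac_root_one : \forall ps \near near_critical, 2^-1 <= jac_root ps.1 one <= 1.
Proof. by have := near_at_one (near_jac_root_le1 d1 a0 b0 c0 U1). Qed.

Lemma near_hstar_one e : 0 < e -> \forall ps \near near_critical, nrm (defect (hstar ps.1 one)) <= e.
Proof. by move=> e0; have := near_at_one (near_hstar U d1 a0 b0 c0 e0). Qed.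

(** [pair_asym] between y = mu, the fixed point for s = 1, and the fixed point for s. *)
Lemma near_disc e : 0 < e -> \forall ps \near near_critical,
  `|(1 - jac_root ps.1 ps.2) ^+ 2 - (1 - jac_root ps.1 one) ^+ 2 - 4 * Qc ps.1 * dot (vvec ps.1) (defect ps.2)|
    <= e * dot (vvec ps.1) (defect ps.2).
Proof.
move=> e0.
pose C := 4 * Q1 * (4 / Q0 + 1) + 2 * (2 + 4 / Q0) + 4 * Q1 * (4 / Q0) + 4 / Q0.
have q4 : 0 < 4 / Q0 by rewrite divr_gt0.
have C0 : 0 < C.
  by have := mulr_ge0 Q10 (ltW q4); have := Q10; rewrite /C; lra.
pose e1 := Num.min (Num.min 1 (Q0 / 2)) (e / C).
have e10 : 0 < e1 by rewrite /e1 !lt_min ltr01 !divr_gt0.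
have [f1 f2 f3] : [/\ e1 <= 1, e1 <= Q0 / 2 & e1 * C <= e].
  by split; rewrite -?ler_pdivlMr // /e1 !ge_min !lexx ?orbT.
clearbody e1; have [dl dl0 hp] := pair_asym U d1 a0 b0 c0 e10.
near=> ps.
have [hK r1 cs sd] : crit (Num.min 2^-1 dl) ps.
  by near: ps; apply: near_crit; rewrite lt_min half0.
have [[ha _ ua _] [hb rb _ vb]] : triple_close dl ps.1 ps.2 /\ triple_close dl ps.1 one.
  by near: ps; exact: near_triples.
have /andP[_ m1] : 2^-1 <= jac_root ps.1 one <= 1.
  by near: ps; exact: near_jac_root_one.
have hh : nrm (defect (hstar ps.1 ps.2)) <= dl by near: ps; exact: near_hstar.
set p := ps.1 in hK r1 ha ua hb rb vb m1 hh *; set s := ps.2 in cs sd ha ua hh *.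
have [hof _] := hK.
have c1 : cube one by exact: cube_one.
have r2 : `|rho p - 1| <= 2^-1 by apply: le_trans r1 _; rewrite ge_min lexx.
have FP : fixpair a b c U dl p s (hstar p one) (hstar p s) (jac_root p one) (jac_v p one) (jac_root p s) (jac_u p s).
  split=> //.
  - by apply: le_trans r1 _; rewrite ge_min lexx orbT.
  - exact: hstar_cube.
  - exact: hstar_cube.
  - by move=> k; apply: hstar_mono => // l; have /andP[] := cs l.
  - by move=> k; rewrite {1}(hstar_fix hof hK k c1); exact: mul1r.
  - by move=> k; exact: (hstar_fix hof hK).
  - by apply: le_trans sd _; rewrite ge_min lexx orbT.
  - by move=> l; rewrite -jac_one; have [_ _ [_ _ _ ->]] := hb.
  - move=> k; have [_ _ [_ _ <- _ _] _] := ha.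
    by rewrite /mv mulr_sumr; apply: eq_bigr => l _; rewrite [jac p s k l]mxE mulrA.
have [z0 _ h1 h2] := hp _ _ _ _ _ _ _ _ FP.
set z := dot (jac_v p one) _ in z0 h1 h2.
set V := dot (vvec p) (defect s) in h1 *.
have hM := Mmat_primitive_half a0 hK r2.
have [_ _ [u0 v0 _ _ _] _] := hM.
have V0 : 0 <= V.
  by apply: dot_ge0 => k; [exact: ltW | have /andP[] := defect_cube cs k].
have /andP[hq0 hq1] := Qc_bounds a0 hK r2.
by exact: (disc_arith Q00 Q10 e10 f1 f2 f3 z0 V0 hq0 hq1 m1 h1 h2).
Unshelve. all: by end_near. Qed.

(** [pair_asym] between the fixed points 1 and mu of f, with s = 1: there (1 - rho) z + Q z^2 is
    negligible against z^2. Either z = 0, or rho - 1 ~ Q z and rho - rho_mu ~ 2 Q z. *)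
Lemma near_rho_mu e : 0 < e -> \forall ps \near near_critical,
  `|(1 - jac_root ps.1 one) - (`|1 - rho ps.1|)| <= e * `|1 - rho ps.1|.
Proof.
move=> e0.
pose e1 := Num.min (Q0 / 2) (e * Q0 / 6).
have e10 : 0 < e1 by rewrite /e1 lt_min !divr_gt0 // mulr_gt0.
have [f1 f2] : e1 <= Q0 / 2 /\ e1 <= e * Q0 / 6 by rewrite /e1 !ge_min !lexx ?orbT.
clearbody e1; have [dl dl0 hp] := pair_asym U d1 a0 b0 c0 e10.
near=> ps.
have [hK r1 cs sd] : crit (Num.min 2^-1 dl) ps.
  by near: ps; apply: near_crit; rewrite lt_min half0.
have [hb _ ub _] : triple_close dl ps.1 one.
  by near: ps; exact: near_triple_one.
have /andP[_ m1] : 2^-1 <= jac_root ps.1 one <= 1.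
  by near: ps; exact: near_jac_root_one.
have hh : nrm (defect (hstar ps.1 one)) <= dl.
  by near: ps; exact: near_hstar_one.
set p := ps.1 in hK r1 hb ub m1 hh *.
have [hof _] := hK.
have c1 : cube one by exact: cube_one.
have r2 : `|rho p - 1| <= 2^-1 by apply: le_trans r1 _; rewrite ge_min lexx.
have r3 : `|rho p - 1| <= dl by apply: le_trans r1 _; rewrite ge_min lexx orbT.
have [_ _ [u0 v0 _ vM _] _] := Mmat_primitive_half a0 hK r2.
have FP : fixpair a b c U dl p one one (hstar p one) (rho p) (vvec p) (jac_root p one) (jac_u p one).
  split=> //.
  - exact: hstar_cube.
  - by move=> k; have /andP[] := hstar_cube hof c1 k.
  - by move=> k; rewrite (pgf_one hK).
  - by move=> k; exact: (hstar_fix hof hK).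
  - by rewrite nrm_defect_one ltW.
  - by move=> k; rewrite subrr normr0 ltW.
  - move=> k; have [_ _ [_ _ <- _ _] _] := hb.
    by rewrite jac_one mul1r.
have [z0 zg h1 h2] := hp _ _ _ _ _ _ _ _ FP.
set z := dot (vvec p) _ in z0 zg h1 h2.
have V0 : dot (vvec p) (defect one) = 0.
  by rewrite /dot big1 // => k _; rewrite defect_one mulr0.
rewrite V0 subr0 addr0 in h1.
(* If z = 0 then mu = 1 and the two roots coincide; the bound by 1 on the root at the fixed point
   gives the sign. *)
have [zz|zN0] := eqVneq z 0.
  have hone : hstar p one = one.
    apply/funext => k; have := congr1 (fun f => f k) (zg zz); rewrite /gap => /eqP.
    by rewrite subr_eq0 => /eqP.
  have rr : jac_root p one = rho p by rewrite /jac_root jac_one hone.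
  rewrite rr in m1 *; have r0 : 0 <= 1 - rho p by rewrite subr_ge0.
  by rewrite (ger0_norm r0) subrr normr0 mulr_ge0 // ltW.
have zp : 0 < z by rewrite lt0r zN0.
have /andP[hq0 _] := Qc_bounds a0 hK r2.
set Q := Qc p in h1 h2 hq0.
have h3 : `|(1 - rho p) + Q * z| <= e1 * z.
  have hz : `|(1 - rho p + Q * z) * z| <= e1 * z * z.
    have -> : (1 - rho p + Q * z) * z = (1 - rho p) * z + Q * z ^+ 2 by ring.
    by apply: le_trans h1 _; rewrite expr2 mulrA.
  by rewrite normrM (gtr0_norm zp) ler_pM2r in hz.
have q2 : Q0 / 2 * z <= rho p - 1.
  have : e1 * z <= Q0 / 2 * z by rewrite ler_wpM2r.
  have : Q0 * z <= Q * z by rewrite ler_wpM2r.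
  by move: h3; rewrite ler_norml => /andP[_]; lra.
have q20 : 0 < Q0 / 2 * z by rewrite mulr_gt0 // divr_gt0.
have rn : `|1 - rho p| = rho p - 1 by rewrite ler0_norm; [ring | lra].
rewrite rn.
have q6 : e1 * z <= e * Q0 / 6 * z by rewrite ler_wpM2r.
have qe : e * (Q0 / 2 * z) <= e * (rho p - 1) by rewrite ler_wpM2l // ltW.
move: h2 h3; rewrite !ler_norml => /andP[g1 g2] /andP[g3 g4].
by apply/andP; split; lra.
Unshelve. all: by end_near. Qed.

End PerronRoots.

(** * Limits along near-critical sequences *)

Section RealSequences.
Variable R : realType.
Implicit Types (f g x : nat -> R) (N : nat -> nat) (w l : R).

Lemma cvg_near_eq f g l : (\forall k \near \oo, f k = g k) -> f @ \oo --> l -> g @ \oo --> l.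
Proof. by move=> h; apply: cvg_trans; apply: near_eq_cvg. Qed.

(** Squeezed by 1 - 1/x <= ln x <= x - 1. *)
Lemma mul_ln_cvg x N w : x @ \oo --> (1 : R) -> (fun k => (N k)%:R * (1 - x k)) @ \oo --> w ->
  (fun k => (N k)%:R * ln (x k)) @ \oo --> - w.
Proof.
move=> x1 hw.
have x0 : \forall k \near \oo, 0 < x k by apply: (cvgr_gt _ x1); exact: ltr01.
have h1 : (fun k => - ((N k)%:R * (1 - x k))) @ \oo --> - w by exact: cvgN.
have h2 : (fun k => - ((N k)%:R * (1 - x k) * (x k)^-1)) @ \oo --> - w.
  by apply: cvgN; rewrite -[X in _ --> X]mulr1 -[X in _ * X]invr1; apply: cvgM => //; apply: cvgV.
apply: (squeeze_cvgr _ h2 h1); near=> k.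
have xk : 0 < x k by near: k.
have l1 : ln (x k) <= x k - 1.
  by have := @le_ln1Dx R (x k - 1); rewrite (addrC 1) subrK => -> //; lra.
have l2 : - ln (x k) <= (x k)^-1 - 1.
  rewrite -lnV ?posrE //; have xi : 0 < (x k)^-1 by rewrite invr_gt0.
  have := @le_ln1Dx R ((x k)^-1 - 1); rewrite (addrC 1) subrK => -> //; lra.
have n0 : 0 <= (N k)%:R :> R by exact: ler0n.
apply/andP; split.
  have -> : - ((N k)%:R * (1 - x k) * (x k)^-1) = (N k)%:R * - ((x k)^-1 - 1).
    by field; rewrite lt0r_neq0.
  by rewrite ler_wpM2l //; lra.
by rewrite -mulrN ler_wpM2l //; lra.
Unshelve. all: by end_near. Qed.

Lemma pow_cvg x N w : x @ \oo --> (1 : R) -> (fun k => (N k)%:R * (1 - x k)) @ \oo --> w ->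
  (fun k => x k ^+ N k) @ \oo --> expR (- w).
Proof.
move=> x1 hw; have h3 := mul_ln_cvg x1 hw.
have x0 : \forall k \near \oo, 0 < x k by apply: (cvgr_gt _ x1); exact: ltr01.
have h4 : (fun k => expR ((N k)%:R * ln (x k))) @ \oo --> expR (- w).
  by apply: continuous_cvg h3; exact: continuous_expR.
apply: cvg_near_eq h4; near=> k => /=.
by rewrite expRM_natl lnK // posrE; near: k.
Unshelve. all: by end_near. Qed.

(** The integral of exp(-w t) over [0, 1], with its value 1 at w = 0; it is the limit of normalized
    geometric sums. *)
Definition gfun w : R := if w == 0 then 1 else (1 - expR (- w)) / w.

Lemma gfun_neq0 w : gfun w != 0.
Proof.
rewrite /gfun; case: (eqVneq w 0) => [_|w0]; first exact: oner_neq0.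
by rewrite mulf_neq0 ?invr_eq0 // subr_eq0 eq_sym -expR0 (inj_eq (@expR_inj R)) oppr_eq0.
Qed.

Lemma gsum_cvg x N w : (\forall k \near \oo, 0 <= x k <= 1) -> (\forall k \near \oo, (0 < N k)%N) ->
  x @ \oo --> (1 : R) -> (fun k => (N k)%:R * (1 - x k)) @ \oo --> w ->
  (fun k => gsum (x k) (N k) / (N k)%:R) @ \oo --> gfun w.
Proof.
move=> x01 N0 x1 hw; have hp := pow_cvg x1 hw; rewrite /gfun.
case: (eqVneq w 0) => w0.
  rewrite w0 oppr0 expR0 in hp.
  apply: (squeeze_cvgr _ hp (cvg_cst (1 : R))); near=> k.
  have n0 : (0 : R) < (N k)%:R by rewrite ltr0n; near: k.
  have /andP[xk0 xk1] : 0 <= x k <= 1 by near: k.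
  by rewrite ler_pdivlMr // mulrC gsum_lb //= ler_pdivrMr // mul1r gsum_ub.
have h : (fun k => (1 - x k ^+ N k) / ((N k)%:R * (1 - x k))) @ \oo --> (1 - expR (- w)) / w.
  by apply: cvgM; [apply: cvgB => //; exact: cvg_cst|exact: cvgV].
apply: cvg_near_eq h; near=> k.
have h0 : (N k)%:R * (1 - x k) != 0 by near: k; apply: (cvgr_neq0 _ hw).
have := h0; rewrite mulf_eq0 negb_or => /andP[n0 m0].
by rewrite -gsum_geo; field; rewrite n0 m0.
Unshelve. all: by end_near. Qed.

End RealSequences.

Section FieldIdentities.
Variable F : fieldType.
Implicit Types x y p q u : F.

Lemma field_disc (m Q x y : F) : Q != 0 -> m / Q * x - 4 * (m * y) = m / Q * (x - 4 * Q * y).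
Proof. by move=> Q0; field. Qed.

Lemma field_disc_err (m Q q e y S : F) : Q != 0 -> S != 0 ->
  m / Q * (e * q / S * y) = e * ((q / Q) * (m * y / S)).
Proof. by move=> Q0 S0; field; rewrite Q0 S0. Qed.

Lemma field_ratio (x y Q u g h p q : F) : y != 0 -> Q != 0 -> u != 0 -> g != 0 -> h != 0 -> p != 0 ->
  q != 0 -> x * (Q * g ^+ 2 / (u * p)) / (y * (Q * h ^+ 2 / (u * q))) = x / y / ((h / g) ^+ 2 * (p / q)).
Proof. by move=> y0 Q0 u0 g0 h0 p0 q0; field; rewrite y0 Q0 u0 g0 h0 p0 q0. Qed.

End FieldIdentities.

Lemma cvg_quotient1 (R : realType) (f g : nat -> R) : f @ \oo --> (1 : R) -> g @ \oo --> (1 : R) ->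
  (fun k => f k / g k) @ \oo --> (1 : R).
Proof. by move=> hf hg; rewrite -[X in _ --> X]divr1; apply: cvgM => //; apply: cvgV. Qed.

Lemma cvg_mul1 (R : realType) (f g : nat -> R) (l : R) : f @ \oo --> (1 : R) -> g @ \oo --> l ->
  (fun k => f k * g k) @ \oo --> l.
Proof. by move=> hf hg; rewrite -[X in _ --> X]mul1r; exact: cvgM. Qed.

Section Sequences.
Variables (R : realType) (d : nat) (a b c : R) (U : nat).
Hypotheses (d1 : (1 <= d)%N) (a0 : 0 < a) (b0 : 0 < b) (c0 : 0 < c) (U1 : (1 <= U)%N).
Local Notation vec := ('I_d -> R).
Local Notation inK := (inK a b c U).
Local Notation K3 := (remainder_const c).
Local Notation al := (a / 2).
Local Notation kap := (kap U al).
Local Notation near_critical := (near_critical (d := d) a b c U).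
Local Notation crit := (crit a b c U).
Local Notation Q0 := (Q0 a b U).
Local Notation Q1 := (Q1 d a c U).
Local Notation one := (@one R d).
Implicit Types (P : offspring R d * vec -> Prop) (k : nat) (j l : 'I_d) (e : R).

Let al0 : 0 < al. Proof. by rewrite divr_gt0. Qed.
Let k0 : 0 < kap. Proof. exact: kap_gt0. Qed.
Let Q00 : 0 < Q0. Proof. exact: Q0_gt0. Qed.

Variables (t : vec) (n_ : nat -> nat) (f_ : nat -> offspring R d) (M : nat -> R).
Hypotheses (t0 : forall l, 0 <= t l) (hn : (fun k => (n_ k)%:R : R) @ \oo --> +oo)
  (hK : forall k, inK (f_ k)) (hrho : (fun k => rho (f_ k)) @ \oo --> (1 : R))
  (hM : M @ \oo --> +oo).

(** All three normalizations have the form M_k v with a scalar M_k tending to infinity, so v.(1 - s)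
    ~ T/M_k whatever the law. *)
Let s_ k : vec := fun l => expR (- (t l / (M k * vvec (f_ k) l))).
Let x_ k : vec := fun l => t l / (M k * vvec (f_ k) l).
Let N_ k := (n_ k).-1.
Let T := \sum_(l < d) t l.

Lemma near_n m : \forall k \near \oo, (m <= n_ k)%N.
Proof.
have /cvgryPge/(_ m%:R) h := hn.
by near=> k; rewrite -(ler_nat R); near: k.
Unshelve. all: by end_near. Qed.

Lemma near_rho e : 0 < e -> \forall k \near \oo, `|rho (f_ k) - 1| <= e.
Proof.
move=> e0; have /cvgrPdist_le/(_ e e0) h := hrho.
by near=> k; rewrite distrC; near: k.
Unshelve. all: by end_near. Qed.

Lemma near_M (A : R) : \forall k \near \oo, A <= M k.
Proof. by have /cvgryPge := hM. Qed.

Lemma near_v : \forall k \near \oo, forall l, kap <= vvec (f_ k) l.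
Proof.
near=> k => l; have r1 : `|rho (f_ k) - 1| <= 2^-1 by near: k; apply: near_rho; rewrite invr_gt0.
exact: (v_ge al0 (Mmat_primitive_half a0 (hK k) r1)).
Unshelve. all: by end_near. Qed.

Lemma near_x : \forall k \near \oo, forall l, 0 <= x_ k l <= t l / kap / M k.
Proof.
near=> k => l.
have m0 : 1 <= M k by near: k; exact: near_M.
have v0 : kap <= vvec (f_ k) l by move: l; near: k; exact: near_v.
have mp : 0 < M k by lra.
have vp : 0 < vvec (f_ k) l by exact: lt_le_trans v0.
rewrite /x_ divr_ge0 ?(ltW (mulr_gt0 mp vp)) //= -mulrA -invfM ler_wpM2l // lef_pV2 ?posrE ?mulr_gt0 //.
by rewrite [leLHS]mulrC ler_wpM2l // ltW.
Unshelve. all: by end_near. Qed.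

Lemma expR_bounds (x : R) : 0 <= x -> x * (1 - x) <= 1 - expR (- x) <= x.
Proof.
move=> x0; have := expR_ge1Dx (- x); have := expR_ge1Dx x => h1 h2.
apply/andP; split; last by lra.
have : expR (- x) <= (1 + x)^-1 by rewrite expRN lef_pV2 ?posrE ?expR_gt0 //; lra.
have : (1 + x)^-1 <= 1 - x + x ^+ 2.
  rewrite -div1r ler_pdivrMr; last by lra.
  have -> : (1 - x + x ^+ 2) * (1 + x) = 1 + x ^+ 3 by ring.
  by rewrite lerDl exprn_ge0.
by rewrite expr2; lra.
Qed.

Lemma near_cube : \forall k \near \oo, cube (s_ k).
Proof.
near=> k => l; have /andP[x0 _] : 0 <= x_ k l <= t l / kap / M k by move: l; near: k; exact: near_x.
by rewrite expR_ge0 /= -expR0 ler_expR oppr_le0.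
Unshelve. all: by end_near. Qed.

Lemma MV_cvg : (fun k => (M k)^-1) @ \oo --> (0 : R).
Proof.
apply/(gtr0_cvgV0 (f := M)) => //.
by near=> k; apply: (@lt_le_trans _ _ 1) => //; near: k; exact: near_M.
Unshelve. all: by end_near. Qed.

Lemma nrm_s_cvg : (fun k => nrm (defect (s_ k))) @ \oo --> (0 : R).
Proof.
have h : (fun k => (\sum_l t l / kap) * (M k)^-1) @ \oo --> (0 : R).
  rewrite -[X in _ --> X](mulr0 (\sum_l t l / kap)).
  by apply: cvgM; [exact: cvg_cst|exact: MV_cvg].
apply: (squeeze_cvgr _ (cvg_cst (0 : R)) h); near=> k.
have hx : forall l, 0 <= x_ k l <= t l / kap / M k by near: k; exact: near_x.
rewrite /nrm mulr_suml; apply/andP; split; last first.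
  apply: ler_sum => l _; have /andP[x0 x1] := hx l; apply: le_trans x1.
  by have /andP[] := expR_bounds x0.
by apply: sumr_ge0 => l _; have /andP[x0 x1] := hx l; rewrite subr_ge0 -expR0 ler_expR oppr_le0.
Unshelve. all: by end_near. Qed.

Lemma near_seq P : (\forall ps \near near_critical, P ps) -> \forall k \near \oo, P (f_ k, s_ k).
Proof.
move=> [e e0 hP]; near=> k; apply: hP; split => //=.
- by near: k; exact: near_rho.
- by near: k; exact: near_cube.
- by near: k; apply: (cvgr_le _ nrm_s_cvg).
Unshelve. all: by end_near. Qed.

Lemma MV_T : (fun k => M k * dot (vvec (f_ k)) (defect (s_ k))) @ \oo --> T.
Proof.
have h l : (fun k => M k * (vvec (f_ k) l * defect (s_ k) l)) @ \oo --> t l.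
  have h1 : (fun k => t l * (1 - t l / kap * (M k)^-1)) @ \oo --> t l * (1 - t l / kap * 0).
    apply: cvgM; first exact: cvg_cst.
    apply: cvgB; first exact: cvg_cst.
    by apply: cvgM; [exact: cvg_cst | exact: MV_cvg].
  rewrite mulr0 subr0 mulr1 in h1; apply: (squeeze_cvgr _ h1 (cvg_cst (t l))); near=> k.
  have mp : 1 <= M k by near: k; exact: near_M.
  have /(_ l) vk : forall l, kap <= vvec (f_ k) l by near: k; exact: near_v.
  have m0 : 0 < M k by lra.
  have v0 : 0 < vvec (f_ k) l by exact: lt_le_trans vk.
  have /(_ l) /andP[x0 x1] : forall l, 0 <= x_ k l <= t l / kap / M k by near: k; exact: near_x.
  have E : M k * vvec (f_ k) l * x_ k l = t l by rewrite /x_ mulrC divfK // mulf_neq0 // lt0r_neq0.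
  have mv0 := ltW (mulr_gt0 m0 v0).
  have /andP[b1 b2] := expR_bounds x0.
  rewrite mulrA /defect -[s_ k l]/(expR (- x_ k l)); apply/andP; split; last first.
    by rewrite -[leRHS]E ler_wpM2l.
  apply: (@le_trans _ _ (M k * vvec (f_ k) l * (x_ k l * (1 - x_ k l)))); last by rewrite ler_wpM2l.
  by rewrite mulrA E ler_wpM2l // lerB.
apply: (@cvg_near_eq R (fun k => \sum_l M k * (vvec (f_ k) l * defect (s_ k) l))).
  by near=> k; rewrite /dot mulr_sumr.
exact: cvg_sumr.
Unshelve. all: by end_near. Qed.

Let rm k := jac_root (f_ k) one.
Let rr k := jac_root (f_ k) (s_ k).

Lemma rho_muE p : is_offspring p -> rho_mu p = jac_root p one.
Proof. by move=> hp; rewrite /rho_mu muE // -jac_one. Qed.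

Lemma rm_cvg : rm @ \oo --> (1 : R).
Proof.
apply/cvgrPdist_le => e e0; have h := near_seq (near_triples d1 a0 b0 c0 U1 e0).
by near=> k; rewrite distrC; near: k; apply: filterS h => k [_ []].
Unshelve. all: by end_near. Qed.

Lemma rr_cvg : rr @ \oo --> (1 : R).
Proof.
apply/cvgrPdist_le => e e0; have h := near_seq (near_triples d1 a0 b0 c0 U1 e0).
by near=> k; rewrite distrC; near: k; apply: filterS h => k [[]].
Unshelve. all: by end_near. Qed.

Lemma near_rm : \forall k \near \oo, 2^-1 <= rm k <= 1.
Proof. exact: near_seq (near_jac_root_one d1 a0 b0 c0 U1). Qed.

Lemma near_rr : \forall k \near \oo, 2^-1 <= rr k <= 1.
Proof. exact: near_seq (near_jac_root_le1 d1 a0 b0 c0 U1). Qed.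

Lemma near_Q : \forall k \near \oo, Q0 <= Qc (f_ k) <= Q1.
Proof.
near=> k; apply: (Qc_bounds a0 (hK k)).
by near: k; apply: near_rho; rewrite invr_gt0.
Unshelve. all: by end_near. Qed.

(** [near_disc] has an error relative to v.(1 - s), and M_k v.(1 - s) stays bounded; Q is bounded
    below over the class. *)
Lemma disc_lim : (fun k => M k / Qc (f_ k) * ((1 - rr k) ^+ 2 - (1 - rm k) ^+ 2)) @ \oo --> 4 * T.
Proof.
pose V k := M k * dot (vvec (f_ k)) (defect (s_ k)).
have V4 : (fun k => 4 * V k) @ \oo --> 4 * T by apply: cvgM; [exact: cvg_cst | exact: MV_T].
have T0 : 0 <= T by exact: sumr_ge0.
suff h : (fun k => M k / Qc (f_ k) * ((1 - rr k) ^+ 2 - (1 - rm k) ^+ 2) - 4 * V k) @ \oo --> (0 : R).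
  rewrite -[X in _ --> X]add0r; apply: cvg_near_eq (cvgD h V4); near=> k.
  by rewrite /= subrK.
apply/cvgr0Pnorm_le => e e0.
have e'0 : 0 < e * Q0 / (T + 1) by rewrite !divr_gt0 ?mulr_gt0 // ltr_wpDl.
have h := near_seq (near_disc d1 a0 b0 c0 U1 e'0).
near=> k.
have mp : 1 <= M k by near: k; exact: near_M.
have m0 : 0 < M k by lra.
have /andP[q0 _] : Q0 <= Qc (f_ k) <= Q1 by near: k; exact: near_Q.
have qp : 0 < Qc (f_ k) by exact: lt_le_trans q0.
have V1 : V k <= T + 1 by near: k; apply: (cvgr_le _ MV_T); lra.
have hd : `|(1 - rr k) ^+ 2 - (1 - rm k) ^+ 2 - 4 * Qc (f_ k) * dot (vvec (f_ k)) (defect (s_ k))|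
    <= e * Q0 / (T + 1) * dot (vvec (f_ k)) (defect (s_ k)) by near: k; exact: h.
have -> : M k / Qc (f_ k) * ((1 - rr k) ^+ 2 - (1 - rm k) ^+ 2) - 4 * V k =
  M k / Qc (f_ k) * ((1 - rr k) ^+ 2 - (1 - rm k) ^+ 2 -
    4 * Qc (f_ k) * dot (vvec (f_ k)) (defect (s_ k))).
  by rewrite /V; apply: field_disc; rewrite lt0r_neq0.
rewrite normrM ger0_norm ?(divr_ge0 (ltW m0) (ltW qp)) //.
apply: (@le_trans _ _ (M k / Qc (f_ k) * (e * Q0 / (T + 1) * dot (vvec (f_ k)) (defect (s_ k))))).
  by rewrite ler_wpM2l // (divr_ge0 (ltW m0) (ltW qp)).
have -> : M k / Qc (f_ k) * (e * Q0 / (T + 1) * dot (vvec (f_ k)) (defect (s_ k))) =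
  e * ((Q0 / Qc (f_ k)) * (V k / (T + 1))).
  by rewrite /V; apply: field_disc_err; rewrite lt0r_neq0 // ltr_wpDl.
have q1 : 0 <= Q0 / Qc (f_ k) <= 1.
  by rewrite (divr_ge0 (ltW Q00) (ltW qp)) ler_pdivrMr // mul1r.
rewrite ler_piMr ?(ltW e0) //; case/andP: q1 => q1 q2.
apply: (@le_trans _ _ (Q0 / Qc (f_ k) * 1)); last by rewrite mulr1.
by rewrite ler_wpM2l // ler_pdivrMr ?mul1r // ltr_wpDl.
Unshelve. all: by end_near. Qed.

Lemma near_N m : \forall k \near \oo, (m <= N_ k)%N.
Proof.
have h := near_n m.+1; near=> k.
by have : (m < n_ k)%N by [near: k]; rewrite /N_; case: (n_ k).
Unshelve. all: by end_near. Qed.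

Lemma near_pos : \forall k \near \oo,
  [/\ 0 < gsum (rr k) (N_ k), 0 < gsum (rm k) (N_ k), 0 < rr k ^+ N_ k & 0 < rm k ^+ N_ k].
Proof.
have g (x : R) m : (0 < m)%N -> 2^-1 <= x <= 1 -> 0 < gsum x m /\ 0 < x ^+ m.
  move=> m0 /andP[x2 x1]; have x0 : 0 < x by apply: lt_le_trans x2; rewrite invr_gt0.
  split; last exact: exprn_gt0.
  by apply: lt_le_trans (gsum_lb m (ltW x0) x1); rewrite mulr_gt0 ?exprn_gt0 ?ltr0n.
apply: filterS3 near_rm near_rr (near_N 1) => k hm hr N0.
by have [g1 p1] := g _ _ N0 hm; have [g2 p2] := g _ _ N0 hr; split.
Qed.

(** [near_main] at s and at 1 involves the same Q and u_j, which cancel in the quotient. *)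
Lemma increment_ratio j :
  (fun k => Dn (f_ k) (s_ k) (N_ k) j / Dn (f_ k) one (N_ k) j /
    ((gsum (rm k) (N_ k) / gsum (rr k) (N_ k)) ^+ 2 * (rr k ^+ N_ k / rm k ^+ N_ k))) @ \oo --> (1 : R).
Proof.
pose A k := Dn (f_ k) (s_ k) (N_ k) j * (Qc (f_ k) * gsum (rr k) (N_ k) ^+ 2 / (uvec (f_ k) j * rr k ^+ N_ k)).
pose B k := Dn (f_ k) one (N_ k) j * (Qc (f_ k) * gsum (rm k) (N_ k) ^+ 2 / (uvec (f_ k) j * rm k ^+ N_ k)).
have A1 : A @ \oo --> (1 : R).
  apply/cvgrPdist_le => e e0; have [N hN] := near_main d1 a0 b0 c0 U1 e0.
  have h := near_seq hN; near=> k; rewrite distrC.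
  have [_ hh] : 0 < gsum (rr k) (N_ k) /\ forall j, `|Dn (f_ k) (s_ k) (N_ k) j *
     (Qc (f_ k) * gsum (rr k) (N_ k) ^+ 2 / (uvec (f_ k) j * rr k ^+ N_ k)) - 1| <= e.
    by have : (N <= N_ k)%N by [near: k; exact: near_N]; move: (N_ k); near: k; exact: h.
  exact: hh.
have B1 : B @ \oo --> (1 : R).
  apply/cvgrPdist_le => e e0; have [N hN] := near_main d1 a0 b0 c0 U1 e0.
  have h := near_seq (near_at_one hN); near=> k; rewrite distrC.
  have [_ hh] : 0 < gsum (rm k) (N_ k) /\ forall j, `|Dn (f_ k) one (N_ k) j *
     (Qc (f_ k) * gsum (rm k) (N_ k) ^+ 2 / (uvec (f_ k) j * rm k ^+ N_ k)) - 1| <= e.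
    by have : (N <= N_ k)%N by [near: k; exact: near_N]; move: (N_ k); near: k; exact: h.
  exact: hh.
apply: cvg_near_eq (cvg_quotient1 A1 B1); near=> k.
have [gs go p1 p0] : [/\ 0 < gsum (rr k) (N_ k), 0 < gsum (rm k) (N_ k), 0 < rr k ^+ N_ k & 0 < rm k ^+ N_ k].
  by near: k; exact: near_pos.
have B0 : B k != 0 by near: k; apply: (cvgr_neq0 _ B1); exact: oner_neq0.
have /andP[q0 _] : Q0 <= Qc (f_ k) <= Q1 by near: k; exact: near_Q.
have qp : 0 < Qc (f_ k) by exact: lt_le_trans q0.
have r1 : `|rho (f_ k) - 1| <= 2^-1 by near: k; apply: near_rho; rewrite invr_gt0.
have [_ _ [/(_ j) u0 _ _ _ _] _] := Mmat_primitive_half a0 (hK k) r1.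
move: B0; rewrite /A /B mulf_eq0 negb_or => /andP[b0' _].
exact: (field_ratio _ b0' (lt0r_neq0 qp) (lt0r_neq0 u0) (lt0r_neq0 gs) (lt0r_neq0 go) (lt0r_neq0 p1) (lt0r_neq0 p0)).
Unshelve. all: by end_near. Qed.

Let Phi_ k j := Phi (f_ k) (n_ k) j t (fun l => M k * vvec (f_ k) l).

(** Conditioning on N = n uses the increment from n - 1 to n, hence the exponent [N_] = n - 1. *)
Lemma Phi_cvg j (L : R) : (fun k => (gsum (rm k) (N_ k) / gsum (rr k) (N_ k)) ^+ 2 *
    (rr k ^+ N_ k / rm k ^+ N_ k)) @ \oo --> L ->
  (fun k => Phi_ k j) @ \oo --> L.
Proof.
move=> hL; apply: cvg_near_eq (cvg_mul1 (increment_ratio j) hL); near=> k.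
have n0 : (0 < n_ k)%N by near: k; exact: near_n.
have hx : forall l, 0 <= x_ k l.
  by move=> l; have /andP[] : 0 <= x_ k l <= t l / kap / M k by move: l; near: k; exact: near_x.
rewrite /Phi_; have <- : (N_ k).+1 = n_ k by rewrite prednK.
rewrite (PhiE (proj1 (hK k))) // -/(Dn (f_ k) (s_ k) (N_ k) j) /= divfK //.
have [gs go p1 p0] : [/\ 0 < gsum (rr k) (N_ k), 0 < gsum (rm k) (N_ k), 0 < rr k ^+ N_ k & 0 < rm k ^+ N_ k].
  by near: k; exact: near_pos.
exact: lt0r_neq0 (mulr_gt0 (exprn_gt0 _ (divr_gt0 go gs)) (divr_gt0 p1 p0)).
Unshelve. all: by end_near. Qed.

Let q_ k := rho_mu (f_ k).

(** Leaves a problem on two real sequences: y stands for r(s), and only its relation to rho_mu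
    matters from here on. *)
Lemma Phi_reduction : exists y : nat -> R,
  [/\ y @ \oo --> (1 : R), \forall k \near \oo, 2^-1 <= y k <= 1,
    (fun k => M k / Qc (f_ k) * ((1 - y k) ^+ 2 - (1 - q_ k) ^+ 2)) @ \oo --> 4 * T &
    forall j (L : R), (fun k => (gsum (q_ k) (n_ k).-1 / gsum (y k) (n_ k).-1) ^+ 2 *
      (y k ^+ (n_ k).-1 / q_ k ^+ (n_ k).-1)) @ \oo --> L ->
    (fun k => Phi (f_ k) (n_ k) j t (fun l => M k * vvec (f_ k) l)) @ \oo --> L].
Proof.
have hq : q_ = rm by apply/funext => k; exact: (rho_muE (proj1 (hK k))).
exists rr; split; [exact: rr_cvg | exact: near_rr | rewrite hq; exact: disc_lim |].
by move=> j L; rewrite hq; exact: Phi_cvg.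
Qed.

Lemma rho_mu_asym : [/\ (fun k => q_ k) @ \oo --> (1 : R),
  \forall k \near \oo, 2^-1 <= q_ k <= 1 &
  forall e, 0 < e -> \forall k \near \oo,
    `|(1 - q_ k) - (`|1 - rho (f_ k)|)| <= e * `|1 - rho (f_ k)|].
Proof.
have hq : q_ = rm by apply/funext => k; exact: (rho_muE (proj1 (hK k))).
split; first by rewrite hq; exact: rm_cvg.
  by rewrite hq; exact: near_rm.
move=> e e0; rewrite hq; exact: near_seq (near_rho_mu d1 a0 b0 c0 U1 e0).
Qed.

End Sequences.

(** * Limits of the scalar quotient in the three regimes *)

Section ScalarLimits.
Variable R : realType.
Variables (n N : nat -> nat) (x y : nat -> R) (T : R).
Hypotheses (nN : \forall k \near \oo, (0 < N k)%N /\ (N k).+1 = n k)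
  (x1 : x @ \oo --> (1 : R)) (y1 : y @ \oo --> (1 : R))
  (hx : \forall k \near \oo, 2^-1 <= x k <= 1) (hy : \forall k \near \oo, 2^-1 <= y k <= 1).

Let W k := (gsum (x k) (N k) / gsum (y k) (N k)) ^+ 2 * (y k ^+ N k / x k ^+ N k).

(** Passing from n to N = n - 1 changes the product by z, which tends to 0. *)
Lemma N_cvg (z : nat -> R) (w : R) : z @ \oo --> (0 : R) ->
  (fun k => (n k)%:R * z k) @ \oo --> w -> (fun k => (N k)%:R * z k) @ \oo --> w.
Proof.
move=> z0 hz; have h : (fun k => (n k)%:R * z k - z k) @ \oo --> w - 0 by exact: cvgB.
rewrite subr0 in h; apply: cvg_near_eq h; apply: filterS nN => k [_ <-].
by rewrite -natr1 mulrDl mul1r addrK.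
Qed.

Lemma one_sub_cvg (z : nat -> R) (w : R) : z @ \oo --> w -> (fun k => 1 - z k) @ \oo --> 1 - w.
Proof. by move=> h; apply: cvgB => //; exact: cvg_cst. Qed.

Lemma cvg_sub0 (z : nat -> R) : z @ \oo --> (1 : R) -> (fun k => 1 - z k) @ \oo --> (0 : R).
Proof. by move=> /one_sub_cvg; rewrite subrr. Qed.

Lemma sqrt_cvg (z : nat -> R) (w : R) : (\forall k \near \oo, 0 <= z k) ->
  (fun k => z k ^+ 2) @ \oo --> w -> z @ \oo --> Num.sqrt w.
Proof.
move=> z0 h.
have h' : (fun k => Num.sqrt (z k ^+ 2)) @ \oo --> Num.sqrt w.
  by apply: continuous_cvg h; exact: sqrt_continuous.
by apply: cvg_near_eq h'; apply: filterS z0 => k z0; rewrite sqrtr_sqr ger0_norm.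
Qed.

Lemma ratio_cvg (wx wy : R) : (fun k => (n k)%:R * (1 - x k)) @ \oo --> wx ->
  (fun k => (n k)%:R * (1 - y k)) @ \oo --> wy ->
  W @ \oo --> (gfun wx / gfun wy) ^+ 2 * expR (wx - wy).
Proof.
move=> /(N_cvg (cvg_sub0 x1)) hwx /(N_cvg (cvg_sub0 y1)) hwy.
have N0 : \forall k \near \oo, (0 < N k)%N by apply: filterS nN => k [].
have hx0 : \forall k \near \oo, 0 <= x k <= 1.
  by apply: filterS hx => k /andP[h1 ->]; rewrite (le_trans _ h1) // invr_ge0.
have hy0 : \forall k \near \oo, 0 <= y k <= 1.
  by apply: filterS hy => k /andP[h1 ->]; rewrite (le_trans _ h1) // invr_ge0.
have gx := gsum_cvg hx0 N0 x1 hwx; have gy := gsum_cvg hy0 N0 y1 hwy.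
have px := pow_cvg x1 hwx; have py := pow_cvg y1 hwy.
have eE : expR (wx - wy) = expR (- wy) / expR (- wx) by rewrite -expRN opprK -expRD addrC.
rewrite eE; apply: (@cvg_near_eq R (fun k => ((gsum (x k) (N k) / (N k)%:R) / (gsum (y k) (N k) / (N k)%:R)) ^+ 2 *
  (y k ^+ N k / x k ^+ N k))).
  apply: filterS N0 => k N0; congr (_ ^+ 2 * _).
  by rewrite invf_div mulrA divfK // pnatr_eq0 -lt0n.
apply: cvgM; last by apply: cvgM => //; apply: cvgV => //; exact: lt0r_neq0 (expR_gt0 _).
rewrite expr2; apply: (@cvg_near_eq R (fun k => ((gsum (x k) (N k) / (N k)%:R) / (gsum (y k) (N k) / (N k)%:R)) *
  ((gsum (x k) (N k) / (N k)%:R) / (gsum (y k) (N k) / (N k)%:R)))); first by near=> k; rewrite expr2.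
have h : (fun k => (gsum (x k) (N k) / (N k)%:R) / (gsum (y k) (N k) / (N k)%:R)) @ \oo --> gfun wx / gfun wy.
  by apply: cvgM => //; apply: cvgV => //; exact: gfun_neq0.
exact: cvgM.
Unshelve. all: by end_near. Qed.

(** Adding (n(1 - x))^2 to the discriminant relation gives the limit of (n(1 - y))^2; the square
    root is taken using 1 - y >= 0. *)
Lemma ratio_cvg_finite (be : nat -> R) (be0 wx : R) : be @ \oo --> be0 -> 0 < be0 ->
  (fun k => (n k)%:R * (1 - x k)) @ \oo --> wx ->
  (fun k => (n k)%:R ^+ 2 * be k * ((1 - y k) ^+ 2 - (1 - x k) ^+ 2)) @ \oo --> 4 * T ->
  let wy := Num.sqrt (wx ^+ 2 + 4 * T / be0) in
  W @ \oo --> (gfun wx / gfun wy) ^+ 2 * expR (wx - wy).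
Proof.
move=> hbe be0p hwx hd /=; apply: ratio_cvg => //; apply: sqrt_cvg.
  by apply: filterS hy => k /andP[_ ?]; rewrite mulr_ge0 // subr_ge0.
have h : (fun k => ((n k)%:R * (1 - x k)) * ((n k)%:R * (1 - x k)) +
    (n k)%:R ^+ 2 * be k * ((1 - y k) ^+ 2 - (1 - x k) ^+ 2) / be k) @ \oo --> wx * wx + 4 * T / be0.
  by apply: cvgD; apply: cvgM => //; apply: cvgV => //; exact: lt0r_neq0.
rewrite expr2; apply: cvg_near_eq h; near=> k.
have bk : be k != 0 by near: k; apply: (cvgr_neq0 _ hbe); exact: lt0r_neq0.
by field.
Unshelve. all: by end_near. Qed.

(** With A = 1 - x and B = 1 - y the relation gives B/A -> 1 and n(B - A) -> T. Both powers x^N and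
    y^N vanish, so the geometric sums have quotient tending to 1 and only (y/x)^N contributes. *)
Lemma ratio_cvg_infinite : (\forall k \near \oo, x k < 1) ->
  (fun k => (n k)%:R * (1 - x k)) @ \oo --> +oo ->
  (fun k => 2 * (n k)%:R / (1 - x k) * ((1 - y k) ^+ 2 - (1 - x k) ^+ 2)) @ \oo --> 4 * T ->
  W @ \oo --> expR (- T).
Proof.
move=> xlt hinf hd.
pose A k := 1 - x k; pose B k := 1 - y k.
have A0 : \forall k \near \oo, 0 < A k by apply: filterS xlt => k; rewrite subr_gt0.
have B0 : \forall k \near \oo, 0 <= B k by apply: filterS hy => k /andP[_ ?]; rewrite subr_ge0.
have nAV : (fun k => ((n k)%:R * A k)^-1) @ \oo --> (0 : R).
  apply/(gtr0_cvgV0 (f := fun k => (n k)%:R * A k)) => //.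
  by apply: filterS2 A0 nN => k A0 [_ <-]; rewrite mulr_gt0.
have n0 : \forall k \near \oo, (0 : R) < (n k)%:R by apply: filterS nN => k [_ <-].
have q2 : (fun k => (B k / A k) ^+ 2) @ \oo --> (1 : R).
  have h : (fun k => 1 + 2 * (n k)%:R / A k * (B k ^+ 2 - A k ^+ 2) * ((n k)%:R * A k)^-1 / 2) @ \oo -->
      1 + 4 * T * 0 / 2.
    apply: cvgD; first exact: cvg_cst.
    by apply: cvgM; [exact: cvgM|exact: cvg_cst].
  rewrite mulr0 mul0r addr0 in h; apply: cvg_near_eq h.
  apply: filterS2 A0 n0 => k A0 n0; field.
  by rewrite !lt0r_neq0.
have q1 : (fun k => B k / A k) @ \oo --> (1 : R).
  rewrite -[X in _ --> X]sqrtr1; apply: sqrt_cvg => //.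
  by apply: filterS2 A0 B0 => k A0 B0; exact: divr_ge0 (ltW _).
have nBA : (fun k => (n k)%:R * (B k - A k)) @ \oo --> T.
  have h : (fun k => 2 * (n k)%:R / A k * (B k ^+ 2 - A k ^+ 2) * (B k / A k + 1)^-1 / 2) @ \oo -->
      4 * T * (1 + 1)^-1 / 2.
    apply: cvgM; last exact: cvg_cst.
    apply: cvgM => //; apply: cvgV; first by rewrite -[_ + _]/(2%:R) pnatr_eq0.
    by apply: cvgD => //; exact: cvg_cst.
  have E : 4 * T * (1 + 1)^-1 / 2 = T by field.
  rewrite E in h; apply: cvg_near_eq h.
  apply: filterS3 A0 B0 n0 => k A0 B0 n0; field.
  by rewrite !lt0r_neq0 // ltr_wpDl.
have qN : (fun k => (y k / x k) ^+ N k) @ \oo --> expR (- T).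
  apply: pow_cvg; first by rewrite -[X in _ --> X]divr1; apply: cvgM => //; apply: cvgV.
  apply: N_cvg; first by apply: cvg_sub0; rewrite -[X in _ --> X]divr1; apply: cvgM => //; apply: cvgV.
  have h : (fun k => (n k)%:R * (B k - A k) / x k) @ \oo --> T / 1.
    by apply: cvgM => //; apply: cvgV.
  rewrite divr1 in h; apply: cvg_near_eq h; apply: filterS hx => k /andP[h _].
  rewrite /A /B; field.
  by apply: lt0r_neq0; apply: lt_le_trans h; rewrite invr_gt0.
(* N x^N A <= A gsum(x, N) <= 1, and n = N + 1 <= 2N. *)
have NA : \forall k \near \oo, x k ^+ N k <= 2 * ((n k)%:R * A k)^-1.
  apply: filterS3 nN hx A0 => k [N0 <-] /andP[h1 h2] A0.
  have xk : 0 <= x k by apply: le_trans h1; rewrite invr_ge0.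
  have g1 := gsum_lb (N k) xk h2; have g2 := gsum_geo (x k) (N k).
  have p0 : 0 <= x k ^+ N k by exact: exprn_ge0.
  rewrite ler_pdivlMr ?mulr_gt0 //.
  have N1 : 1 <= (N k)%:R :> R by rewrite ler1n.
  have m1 : A k * ((N k)%:R * x k ^+ N k) <= 1.
    by apply: (@le_trans _ _ (A k * gsum (x k) (N k))); [rewrite ler_wpM2l // ltW|rewrite g2; lra].
  have m2 : A k * x k ^+ N k <= A k * ((N k)%:R * x k ^+ N k).
    by rewrite ler_wpM2l ?(ltW A0) // ler_peMl.
  rewrite -natr1; lra.
have xN : (fun k => x k ^+ N k) @ \oo --> (0 : R).
  have h : (fun k => 2 * ((n k)%:R * A k)^-1) @ \oo --> 2 * (0 : R) by apply: cvgM => //; exact: cvg_cst.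
  rewrite mulr0 in h; apply: (squeeze_cvgr _ (cvg_cst (0 : R)) h).
  apply: filterS2 NA hx => k -> /andP[h1 _]; rewrite andbT exprn_ge0 //.
  by apply: le_trans h1; rewrite invr_ge0.
have yN : (fun k => y k ^+ N k) @ \oo --> (0 : R).
  have h : (fun k => (y k / x k) ^+ N k * x k ^+ N k) @ \oo --> expR (- T) * 0 by exact: cvgM.
  rewrite mulr0 in h; apply: cvg_near_eq h; apply: filterS hx => k /andP[h1 _].
  rewrite -exprMn divfK //.
  by apply: lt0r_neq0; apply: lt_le_trans h1; rewrite invr_gt0.
have g1 : (fun k => gsum (x k) (N k) / gsum (y k) (N k)) @ \oo --> (1 : R).
  have h : (fun k => (1 - x k ^+ N k) / (1 - y k ^+ N k) * (B k / A k)) @ \oo --> (1 - 0) / (1 - 0) * (1 : R).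
    apply: cvgM => //; apply: cvgM; first exact: one_sub_cvg.
    by apply: cvgV; [rewrite subr0 oner_eq0|exact: one_sub_cvg].
  rewrite subr0 divr1 mulr1 in h; apply: cvg_near_eq h; near=> k.
  have Ak : 0 < A k by near: k.
  have q0 : B k / A k != 0 by near: k; apply: (cvgr_neq0 _ q1); exact: oner_neq0.
  have y0 : 1 - y k ^+ N k != 0.
    by near: k; apply: (cvgr_neq0 _ (one_sub_cvg yN)); rewrite subr0 oner_neq0.
  move: q0 y0; rewrite mulf_eq0 negb_or => /andP[Bk _].
  rewrite -!gsum_geo mulf_eq0 negb_or => /andP[_ gy].
  rewrite -/(A k) -/(B k); field.
  by rewrite gy Bk lt0r_neq0.
have h : (fun k => (gsum (x k) (N k) / gsum (y k) (N k)) * (gsum (x k) (N k) / gsum (y k) (N k)) *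
   (y k / x k) ^+ N k) @ \oo --> 1 * 1 * expR (- T) by apply: cvgM => //; exact: cvgM.
rewrite !mul1r in h; apply: cvg_near_eq h; near=> k.
by rewrite /W -expr2 [(y k / x k) ^+ _]expr_div_n.
Unshelve. all: by end_near. Qed.

End ScalarLimits.

(** * Limits of the conditional transforms *)

Section Limits.
Variables (R : realType) (d : nat) (a b c : R) (U : nat).
Hypotheses (d1 : (1 <= d)%N) (a0 : 0 < a) (b0 : 0 < b) (c0 : 0 < c) (U1 : (1 <= U)%N).
Variables (t : 'I_d -> R) (n_ : nat -> nat) (f_ : nat -> offspring R d).
Hypotheses (t0 : forall l, 0 <= t l) (hn : (fun k => (n_ k)%:R : R) @ \oo --> +oo)
  (hK : forall k, inK a b c U (f_ k)) (hrho : (fun k => rho (f_ k)) @ \oo --> (1 : R)).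
Local Notation Q0 := (Q0 a b U).
Let T := \sum_(l < d) t l.
Let q k := rho_mu (f_ k).

Let qP : [/\ q @ \oo --> (1 : R), \forall k \near \oo, 2^-1 <= q k <= 1 &
  forall e, 0 < e -> \forall k \near \oo, `|(1 - q k) - (`|1 - rho (f_ k)|)| <= e * `|1 - rho (f_ k)|].
Proof. exact: (rho_mu_asym d1 a0 b0 c0 U1 t0 hK hrho hn). Qed.

Lemma near_pred_n : \forall k \near \oo, (0 < (n_ k).-1)%N /\ (n_ k).-1.+1 = n_ k.
Proof. by apply: filterS (near_n hn 2) => k; case: (n_ k) => [|[|m]]. Qed.

Lemma near_Q0 : \forall k \near \oo, 0 < Q0 /\ Q0 <= Qc (f_ k).
Proof.
apply: filterS (near_Q a0 hK hrho) => k /andP[h _]; split => //; exact: Q0_gt0.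
Qed.

Lemma near_n_ge (A : R) : \forall k \near \oo, A <= (n_ k)%:R.
Proof. by have /cvgryPge := hn. Qed.

Lemma rho_mu_finite (w : R) : (fun k => (n_ k)%:R * `|1 - rho (f_ k)|) @ \oo --> w ->
  (fun k => (n_ k)%:R * (1 - q k)) @ \oo --> w.
Proof.
move=> hw; have [_ _ hq] := qP.
have w1 : 0 < `|w| + 1 by rewrite ltr_wpDl.
suff h : (fun k => (n_ k)%:R * (1 - q k) - (n_ k)%:R * `|1 - rho (f_ k)|) @ \oo --> (0 : R).
  have h' : (fun k => (n_ k)%:R * (1 - q k) - (n_ k)%:R * `|1 - rho (f_ k)| +
    (n_ k)%:R * `|1 - rho (f_ k)|) @ \oo --> 0 + w by exact: cvgD.
  by rewrite add0r in h'; apply: cvg_near_eq h'; near=> k; rewrite subrK.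
apply/cvgr0Pnorm_le => e e0; have h := hq _ (divr_gt0 e0 w1); near=> k.
have h1 : `|(1 - q k) - (`|1 - rho (f_ k)|)| <= e / (`|w| + 1) * `|1 - rho (f_ k)| by near: k.
have h2 : (n_ k)%:R * `|1 - rho (f_ k)| <= `|w| + 1.
  by near: k; apply: (cvgr_le _ hw); have := ler_norm w; lra.
rewrite -mulrBr normrM ger0_norm ?ler0n //.
apply: (@le_trans _ _ ((n_ k)%:R * (e / (`|w| + 1) * `|1 - rho (f_ k)|))); first by rewrite ler_wpM2l.
by rewrite mulrCA -mulrA ler_piMr ?(ltW e0) // mulrC ler_pdivrMr // mul1r.
Unshelve. all: by end_near. Qed.

Lemma rho_mu_half : \forall k \near \oo, 2^-1 * `|1 - rho (f_ k)| <= 1 - q k.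
Proof.
have [_ _ hq] := qP; have half : 0 < 2^-1 :> R by rewrite invr_gt0.
by apply: filterS (hq _ half) => k; rewrite ler_norml => /andP[+ _]; lra.
Qed.

Lemma rho_mu_infinite : (fun k => (n_ k)%:R * `|1 - rho (f_ k)|) @ \oo --> +oo ->
  (fun k => (n_ k)%:R * (1 - q k)) @ \oo --> +oo.
Proof.
move=> /cvgryPge h; apply/cvgryPge => A; apply: filterS2 (h (2 * A)) rho_mu_half => k h1 h2.
have := ler_wpM2l (ler0n R (n_ k)) h2; lra.
Qed.

(** Cases (1) and (2) share the normalization Q n^2 be v with a convergent factor [be]; they differ
    only in [be] and in the limit w. *)
Lemma Phi_finite (M be : nat -> R) (be0 w : R) :
  (\forall k \near \oo, M k = Qc (f_ k) * ((n_ k)%:R ^+ 2 * be k)) -> be @ \oo --> be0 -> 0 < be0 ->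
  (fun k => (n_ k)%:R * `|1 - rho (f_ k)|) @ \oo --> w ->
  let w' := Num.sqrt (w ^+ 2 + 4 * T / be0) in
  forall j, (fun k => Phi (f_ k) (n_ k) j t (fun l => M k * vvec (f_ k) l)) @ \oo -->
    (gfun w / gfun w') ^+ 2 * expR (w - w').
Proof.
move=> hMe hbe be0p /rho_mu_finite hw w' j; have [q1 q2 _] := qP.
have hM : M @ \oo --> +oo.
  apply/cvgryPge => A; near=> k.
  have [Q00 hQ] : 0 < Q0 /\ Q0 <= Qc (f_ k) by near: k; exact: near_Q0.
  have -> : M k = Qc (f_ k) * ((n_ k)%:R ^+ 2 * be k) by near: k.
  have b1 : be0 / 2 <= be k by near: k; apply: (cvgr_ge _ hbe); lra.
  have n1 : 1 <= (n_ k)%:R :> R by near: k; exact: near_n_ge.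
  have n2 : A / (Q0 * (be0 / 2)) <= (n_ k)%:R by near: k; exact: near_n_ge.
  rewrite ler_pdivrMr ?(mulr_gt0 Q00) ?divr_gt0 // in n2; apply: le_trans n2 _.
  have n3 : (n_ k)%:R <= (n_ k)%:R ^+ 2 :> R by rewrite expr2 ler_peMl.
  have n0 : 0 <= (n_ k)%:R :> R by [].
  have b0' : 0 <= be0 / 2 by rewrite ltW // divr_gt0.
  rewrite mulrCA; apply: ler_pM => //; [exact: ltW | exact: mulr_ge0 | exact: ler_pM].
have [y [y1 hy hd hPhi]] := Phi_reduction d1 a0 b0 c0 U1 t0 hn hK hrho hM.
apply: hPhi; apply: (ratio_cvg_finite near_pred_n q1 y1 q2 hy hbe be0p hw).
apply: cvg_near_eq hd; near=> k.
have [Q00 hQ] : 0 < Q0 /\ Q0 <= Qc (f_ k) by near: k; exact: near_Q0.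
have -> : M k = Qc (f_ k) * ((n_ k)%:R ^+ 2 * be k) by near: k.
by rewrite [X in X / _]mulrC mulfK // lt0r_neq0 // (lt_le_trans Q00).
Unshelve. all: by end_near. Qed.

(** Here M/Q is 2n/(1 - rho_mu); rho != 1 makes 1 - rho_mu positive through [rho_mu_half]. *)
Lemma Phi_infinite (M : nat -> R) :
  (forall k, M k = 2 * Qc (f_ k) * (n_ k)%:R / (1 - rho_mu (f_ k))) -> (forall k, rho (f_ k) != 1) ->
  (fun k => (n_ k)%:R * `|1 - rho (f_ k)|) @ \oo --> +oo ->
  forall j, (fun k => Phi (f_ k) (n_ k) j t (fun l => M k * vvec (f_ k) l)) @ \oo --> expR (- T).
Proof.
move=> hMe r1 hinf j; have [q1 q2 _] := qP.
have hq1 : \forall k \near \oo, q k < 1.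
  apply: filterS rho_mu_half => k h; rewrite -subr_gt0; apply: lt_le_trans h.
  by rewrite mulr_gt0 ?invr_gt0 // normr_gt0 subr_eq0 eq_sym.
have hM : M @ \oo --> +oo.
  apply/cvgryPge => A; near=> k.
  have [Q00 hQ] : 0 < Q0 /\ Q0 <= Qc (f_ k) by near: k; exact: near_Q0.
  have /andP[q3 _] : 2^-1 <= q k <= 1 by near: k.
  have q4 : q k < 1 by near: k.
  rewrite hMe -/(q k) ler_pdivlMr ?subr_gt0 //.
  have n1 : `|A| / Q0 <= (n_ k)%:R by near: k; exact: near_n_ge.
  rewrite ler_pdivrMr // in n1.
  have n2 : (n_ k)%:R * Q0 <= (n_ k)%:R * Qc (f_ k) by rewrite ler_wpM2l.
  have : A * (1 - q k) <= `|A| * 1.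
    apply: (@le_trans _ _ (`|A| * (1 - q k))).
      by rewrite ler_wpM2r ?ler_norm // subr_ge0 ltW.
    rewrite ler_wpM2l //; have : (0 : R) < 2^-1 by rewrite invr_gt0.
    lra.
  have := normr_ge0 A; lra.
have [y [y1 hy hd hPhi]] := Phi_reduction d1 a0 b0 c0 U1 t0 hn hK hrho hM.
apply: hPhi; apply: (ratio_cvg_infinite near_pred_n q1 y1 q2 hy hq1 (rho_mu_infinite hinf)).
apply: cvg_near_eq hd; apply: filterS near_Q0 => k [Q00 hQ].
congr (_ * _); rewrite hMe -/(q k) mulrAC; congr (_ / _).
by rewrite -(mulrA 2) (mulrC (Qc _)) mulrA mulfK // lt0r_neq0 // (lt_le_trans Q00).
Unshelve. all: by end_near. Qed.

End Limits.

(** * Identification of the limiting expressions *)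

Lemma hfun_gt0 (R : realType) (x : R) : x < 0 -> 0 < hfun x.
Proof.
move=> x0; have e1 : expR x < 1 by rewrite -expR0 ltr_expR.
rewrite /hfun -oppr_lt0 -mulrN -invrN ltr_pdivrMr ?mul0r.
  have : x * (1 + expR x) < 0 by rewrite nmulr_rlt0 // ltr_wpDr // expR_ge0.
  lra.
have -> : - (expR x - 1) ^+ 3 = (1 - expR x) ^+ 3 by ring.
by rewrite exprn_gt0 // subr_gt0.
Qed.

Lemma hfun_cvg (R : realType) (z : nat -> R) (x : R) : x < 0 -> z @ \oo --> x ->
  (fun k => hfun (z k)) @ \oo --> hfun x.
Proof.
move=> x0 hz; have e1 : expR x < 1 by rewrite -expR0 ltr_expR.
have he : (fun k => expR (z k)) @ \oo --> expR x by apply: continuous_cvg hz; exact: continuous_expR.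
have h1 : (fun k => expR (z k) - 1) @ \oo --> expR x - 1 by apply: cvgB => //; exact: cvg_cst.
have h3 : (fun k => (expR (z k) - 1) ^+ 3) @ \oo --> (expR x - 1) ^+ 3.
  by apply: (@cvg_comp _ _ _ _ (fun y : R => y ^+ 3) _ _ _ h1); exact: exprn_continuous.
apply: cvgM; last by apply: cvgV => //; rewrite expf_neq0 // subr_eq0 lt_eqF.
apply: cvgB.
  by apply: cvgM => //; apply: cvgD => //; exact: cvg_cst.
by apply: cvgM; [exact: cvg_cst | apply: cvgB => //; exact: cvg_cst].
Qed.

(** The definition of [dfun] amounts to w' = w D, so that exp(-w') is the power r^D and exp(-w) is
    r. *)
Lemma dfun_limit (R : realType) (T r : R) : 0 <= T -> 0 < r < 1 ->
  let w := - ln r in let be := 2 * (1 - r) ^+ 2 * hfun (ln r) / w ^+ 2 in let D := dfun T r in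
  let w' := Num.sqrt (w ^+ 2 + 4 * T / be) in
  (gfun w / gfun w') ^+ 2 * expR (w - w') = (1 - r) ^+ 2 * r `^ D * D ^+ 2 / (r * (1 - r `^ D) ^+ 2).
Proof.
move=> T0 /andP[r0 r1] w be D w'.
have lr : ln r < 0 by rewrite ln_lt0 // r0.
have w0 : 0 < w by rewrite oppr_gt0.
have h0 : 0 < (1 - r) ^+ 2 * hfun (ln r) by rewrite mulr_gt0 ?hfun_gt0 // exprn_gt0 // subr_gt0.
have wE : w' = w * D.
  have -> : w * D = Num.sqrt (w ^+ 2 * (1 + 2 * T / ((1 - r) ^+ 2 * hfun (ln r)))).
    by rewrite sqrtrM ?sqr_ge0 // sqrtr_sqr ger0_norm // ltW.
  congr (Num.sqrt _); rewrite /be.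
  have h0' := lt0r_neq0 h0; move: h0'; rewrite mulf_eq0 negb_or => /andP[/[dup] r2 + h2].
  rewrite expf_eq0 /= => r3.
  by field; rewrite h2 r3 lt0r_neq0.
have D0 : 0 < D.
  rewrite sqrtr_gt0 ltr_wpDr //; apply: divr_ge0; [exact: mulr_ge0 | exact: ltW].
have pE : r `^ D = expR (- w') by rewrite /powR (gt_eqF r0) wE /w mulNr opprK mulrC.
have eE : expR (w - w') = r `^ D / r.
  by rewrite expRD mulrC pE; congr (_ * _); rewrite /w expRN lnK // posrE.
have w'0 : 0 < w' by rewrite wE mulr_gt0.
have p1 : 1 - r `^ D != 0.
  by rewrite pE subr_eq0 gt_eqF // -expR0 ltr_expR oppr_lt0.
rewrite eE /gfun !gt_eqF // -pE {1}/w opprK lnK // wE.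
by field; rewrite p1 !lt0r_neq0.
Qed.

(** For w = 0 and be = 1/3 one has w' = 2 sqrt(3T), and the quotient becomes a squared hyperbolic
    sine after multiplication by exp(w'). The value at T = 0 is treated apart, as in [lim2]. *)
Lemma lim2_limit (R : realType) (T : R) : 0 <= T ->
  let w' := Num.sqrt (0 ^+ 2 + 4 * T / 3^-1) in (gfun 0 / gfun w') ^+ 2 * expR (0 - w') = lim2 T.
Proof.
move=> T0 w'; rewrite /lim2 /gfun eqxx.
have wE : w' = 2 * Num.sqrt (3 * T).
  have -> : 2 = Num.sqrt (2 ^+ 2) :> R by rewrite sqrtr_sqr ger0_norm.
  rewrite -sqrtrM ?sqr_ge0 //; congr Num.sqrt; rewrite invrK; ring.
rewrite wE sub0r; case: (eqVneq T 0) => [->|Tn0].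
  by rewrite mulr0 sqrtr0 mulr0 eqxx divr1 expr1n oppr0 expR0 mulr1.
have Tp : 0 < T by rewrite lt_neqAle eq_sym Tn0.
set s := Num.sqrt _; have s0 : 0 < s by rewrite sqrtr_gt0 mulr_gt0.
have -> : 3 * T = s ^+ 2 by rewrite sqr_sqrtr // mulr_ge0.
rewrite gt_eqF ?mulr_gt0 // /sinhR.
have e2 : expR (- (2 * s)) = (expR s) ^- 2 by rewrite expRN expRM_natl.
have E1 : 1 < expR s by rewrite -expR0 ltr_expR.
rewrite e2 expRN; set E := expR s in E1 *.
have E2 : 0 < E ^+ 2 - 1 by rewrite subr_gt0 exprn_egt1.
field.
by rewrite !lt0r_neq0 ?andbT //; lra.
Qed.

Unset Implicit Arguments. Set Strict Implicit. Set Printing Implicit Defensive.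

Theorem theorem4 (R : realType) (d : nat) (a b c : R) (U : nat)
  (hd : (1 <= d)%N) (ha : 0 < a) (hb : 0 < b) (hc : 0 < c) (hU : (1 <= U)%N)
  (H : HypH d a b c U)
  (t : 'I_d -> R) (ht : forall l, 0 <= t l)
  (n_ : nat -> nat) (f_ : nat -> offspring R d)
  (hn_ : (fun k => (n_ k)%:R : R) @ \oo --> +oo)
  (hK : forall k, inK a b c U (f_ k))
  (hrho : (fun k => rho (f_ k)) @ \oo --> (1 : R)) :
  let T := \sum_(l < d) t l in
  (* (1) *)
  (forall r : R, 0 < r < 1 ->
     (forall k, rho (f_ k) != 1) ->
     (fun k => (n_ k)%:R * `|1 - rho (f_ k)|) @ \oo --> - ln r ->
     let D := dfun T r in
     forall j : 'I_d,
       (fun k =>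
          let n := n_ k in let f := f_ k in
          let rm := rho_mu f in
          Phi f n j t (fun l => 2 * Qc f * (1 - rm ^+ n) ^+ 2
                                * hfun (n%:R * ln rm) / (1 - rm) ^+ 2 * vvec f l))
       @ \oo --> (1 - r) ^+ 2 * r `^ D * D ^+ 2 / (r * (1 - r `^ D) ^+ 2)) /\
  (* (2) *)
  ((fun k => (n_ k)%:R * `|1 - rho (f_ k)|) @ \oo --> (0 : R) ->
     forall j : 'I_d,
       (fun k =>
          let n := n_ k in let f := f_ k in
          Phi f n j t (fun l => Qc f * (n%:R) ^+ 2 / 3 * vvec f l))
       @ \oo --> lim2 T) /\
  (* (3) *)
  ((forall k, rho (f_ k) != 1) ->
     (fun k => (n_ k)%:R * `|1 - rho (f_ k)|) @ \oo --> +oo ->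
     forall j : 'I_d,
       (fun k =>
          let n := n_ k in let f := f_ k in
          Phi f n j t (fun l => 2 * Qc f * n%:R / (1 - rho_mu f) * vvec f l))
       @ \oo --> expR (- T)).

Proof.
move=> T; have T0 : 0 <= T by exact: sumr_ge0.
have n1 : \forall k \near \oo, (n_ k)%:R != 0 :> R.
  by apply: filterS (near_n hn_ 1) => k; rewrite pnatr_eq0 -lt0n.
split; [|split].
- move=> r r01 r1 hw D j; have /andP[r0 rlt] := r01.
  have lr : ln r < 0 by rewrite ln_lt0.
  have w0 : 0 < - ln r by rewrite oppr_gt0.
  have [q1 _ _] := rho_mu_asym hd ha hb hc hU ht hK hrho hn_.
  have hq := rho_mu_finite hd ha hb hc hU ht hn_ hK hrho hw.
  have hp := pow_cvg q1 hq; have hl := mul_ln_cvg q1 hq.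
  rewrite opprK in hl; rewrite opprK lnK // in hp.
  have hh := hfun_cvg lr hl.
  (* The normalization of case (1) divided by Q n^2 v. It converges because rho_mu^n tends to r and
     theta_n to ln r. *)
  pose be k := 2 * (1 - rho_mu (f_ k) ^+ n_ k) ^+ 2 * hfun ((n_ k)%:R * ln (rho_mu (f_ k)))
    / ((n_ k)%:R * (1 - rho_mu (f_ k))) ^+ 2.
  have hbe : be @ \oo --> 2 * (1 - r) ^+ 2 * hfun (ln r) / (- ln r) ^+ 2.
    have sqr_cvg (g : nat -> R) (l : R) : g @ \oo --> l -> (fun k => g k ^+ 2) @ \oo --> l ^+ 2.
      by move=> hg; apply: (@cvg_comp _ _ _ _ (fun y : R => y ^+ 2) _ _ _ hg); exact: exprn_continuous.
    apply: cvgM; last by apply: cvgV; [rewrite expf_neq0 // lt0r_neq0 | exact: sqr_cvg].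
    apply: cvgM => //; apply: cvgM; first exact: cvg_cst.
    by apply: sqr_cvg; apply: cvgB => //; exact: cvg_cst.
  have be0 : 0 < 2 * (1 - r) ^+ 2 * hfun (ln r) / (- ln r) ^+ 2.
    by rewrite divr_gt0 ?exprn_gt0 // mulr_gt0 ?hfun_gt0 // mulr_gt0 // exprn_gt0 // subr_gt0.
  rewrite -(dfun_limit T0 r01).
  apply: (Phi_finite hd ha hb hc hU ht hn_ hK hrho _ hbe be0 hw); near=> k.
  have nk : (n_ k)%:R != 0 :> R by near: k.
  have : (n_ k)%:R * (1 - rho_mu (f_ k)) != 0 by near: k; apply: (cvgr_neq0 _ hq); exact: lt0r_neq0.
  rewrite mulf_eq0 negb_or => /andP[_ mk]; rewrite /be.
  move: (rho_mu (f_ k)) (Qc (f_ k)) (hfun _) mk => q Q h mk.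
  by field; rewrite nk mk.
- move=> hw j; have be0 : 0 < 3^-1 :> R by rewrite invr_gt0.
  rewrite -(lim2_limit T0).
  apply: (Phi_finite hd ha hb hc hU ht hn_ hK hrho _ (cvg_cst _) be0 hw).
  by near=> k; rewrite mulrA.
- move=> r1 hw j.
  exact: (Phi_infinite hd ha hb hc hU ht hn_ hK hrho _ r1 hw).
Unshelve. all: by end_near. Qed.
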